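(* There exist a 2-step affine nilsystem $(\mathbb{T}^2,\mathcal{B}_{\mathbb{T}^2},m_{\mathbb{T}^2},T_1,T_2,T_3,T_4)$ and polynomials $p_1,p_2,p_3,p_4\in\mathbb{Z}[n]$ such that $(T_1^{p_1(n)},\ldots,T_4^{p_4(n)})_{n\in\mathbb Z}$ is not jointly ergodic for the system, but it is jointly ergodic for the projection of the system onto its Kronecker factor (i.e. onto the first coordinate of $\mathbb{T}^2$).
   Context: $\mathbb{T}=\mathbb{R}/\mathbb{Z}$; $\mathcal B$ and $m$ denote the Borel $\sigma$-algebra and the Haar (Lebesgue) probability measure. A 2-step affine nilsystem $(\mathbb{T}^2,\mathcal{B}_{\mathbb{T}^2},m_{\mathbb{T}^2},T_1,\ldots,T_4)$ is one in which each $T_i$ is a unipotent affine transformation $y\mapsto A_iy+\alpha_i$ of $\mathbb{T}^2$ ($\alpha_i\in\mathbb{T}^2$, $A_i$ an automorphism of $\mathbb T^2$ with $A_i-I$ nilpotent), the system is a 2-step nilsystem (i.e. $\mathbb{T}^2$ is realized as $G/\Gamma$ with $G$ a 2-step nilpotent Lie group and $\Gamma$ a discrete cocompact subgroup, with each $T_i$ acting as left multiplication by an element of $G$), and the group $\langle T_1,\ldots,T_4\rangle$ is 2-step nilpotent. The Kronecker factor of an action is the factor associated with the $\sigma$-algebra generated by its eigenfunctions; in the asserted system, for each $T_i$ it is the $\sigma$-algebra generated by the first coordinate $(x,y)\mapsto x$, and the projected system is the system induced by $T_1,\ldots,T_4$ on $(\mathbb T,\mathcal B_{\mathbb T},m_{\mathbb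 T})$. $(T_1^{p_1(n)},\ldots,T_\ell^{p_\ell(n)})_{n\in\mathbb{Z}}$ is jointly ergodic for $(X,\mathcal X,\mu)$ if for all $f_1,\ldots,f_\ell\in L^\infty(\mu)$, $\frac1N\sum_{n=1}^N f_1(T_1^{p_1(n)}\cdot)\cdots f_\ell(T_\ell^{p_\ell(n)}\cdot)\to\int f_1\,d\mu\cdots\int f_\ell\,d\mu$ in $L^2(\mu)$ as $N\to\infty$. *)

(* Defs.v *)
From HB Require Import structures.
From mathcomp Require Import all_boot all_order all_algebra generic_quotient ring_quotient.
From mathcomp Require Import all_classical all_reals all_analysis.
From mathcomp Require Import measurable_realfun complex.

Set Implicit Arguments.
Unset Strict Implicit.
Unset Printing Implicit Defensive.

Import Order.TTheory GRing.Theory Num.Theory.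
Import numFieldNormedType.Exports.

Local Open Scope classical_set_scope.
Local Open Scope ring_scope.

Section GroupNotions.
Local Open Scope group_scope.
Variable G : groupType.
Implicit Types (H K A : set G) (g : G).

Definition zexpg g (k : int) : G :=
  match k with Posz n => g ^+ n | Negz n => g ^- n.+1 end.

Definition subgroup_closed H : Prop :=
  H 1 /\ forall x y, H x -> H y -> H (x / y).

Definition generated A : set G := smallest subgroup_closed A.

Definition commutator_subgroup H K : set G :=
  generated [set g | exists x y, [/\ H x, K y & g = [~ x, y]]].

(** [lower_central H n] is the term of index [n.+1] of the lower central series
    of the subgroup [H]. *)
Definition lower_central H (n : nat) : set G :=
  iter n (commutator_subgroup H) H.

(** Nilpotency class exactly [s]. *)
Definition step_nilpotent (s : nat) H : Prop :=
  lower_central H s = [set 1] /\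
  forall r, (r < s)%N -> lower_central H r <> [set 1].

Record subgroupType := Subgroup {
  sgset : set G;
  sgP : subgroup_closed sgset }.

End GroupNotions.

(** The group of bijections of [X], with product [(S * T) x = S (T x)]. *)
Section Bijections.
Variable X : Type.

Record bijection := Bijection {
  bij_fun :> X -> X;
  bij_inv : X -> X;
  bij_funK : cancel bij_fun bij_inv;
  bij_invK : cancel bij_inv bij_fun }.

Lemma bijection_eq (S T : bijection) : S =1 T -> S = T.
Proof.
case: S T => [s s' sK s'K] [t t' tK t'K] /= st.
have {}st : s = t by apply/funext.
subst t.
have ss' : s' = t' by apply/funext => x; rewrite -[in LHS](t'K x) sK.
subst t'.
by congr Bijection; exact: Prop_irrelevance.
Qed.

Definition bij_one := @Bijection id id (fun=> erefl) (fun=> erefl).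
Definition bij_V (T : bijection) := Bijection (bij_invK T) (bij_funK T).
Definition bij_mul (S T : bijection) :=
  Bijection (can_comp (bij_funK S) (bij_funK T))
            (can_comp (bij_invK T) (bij_invK S)).

HB.instance Definition _ := gen_eqMixin bijection.
HB.instance Definition _ := gen_choiceMixin bijection.

Let mulA : associative bij_mul.
Proof. by move=> S T U; exact: bijection_eq. Qed.
Let mul1 : left_id bij_one bij_mul.
Proof. by move=> S; exact: bijection_eq. Qed.
Let mulr1 : right_id bij_one bij_mul.
Proof. by move=> S; exact: bijection_eq. Qed.
Let mulV : left_inverse bij_one bij_V bij_mul.
Proof. by move=> S; apply: bijection_eq => x /=; rewrite bij_funK. Qed.
Let mulrV : right_inverse bij_one bij_V bij_mul.
Proof. by move=> S; apply: bijection_eq => x /=; rewrite bij_invK. Qed.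

HB.instance Definition _ := isGroup.Build bijection mulA mul1 mulr1 mulV mulrV.

End Bijections.

HB.mixin Record isTopologicalGroup G of Group G & Topological G := {
  mulg_continuous : continuous (fun xy : G * G => (xy.1 * xy.2)%g);
  invg_continuous : continuous (fun x : G => (x^-1)%g) }.

#[short(type="topologicalGroupType")]
HB.structure Definition TopologicalGroup :=
  {G of isTopologicalGroup G & Group G & Topological G}.

Section Smooth.
Variables (R : realType) (V W : normedModType R).

(** [U] is meant to be open. Existence and continuity on [U] of all first-order
    directional derivatives is equivalent to [f] being of class C^1 on [U]. *)
Fixpoint class_C (k : nat) (U : set V) (f : V -> W) : Prop :=
  (forall x, U x -> {for x, continuous f}) /\
  if k is k'.+1 then
    forall v, (forall x, U x -> derivable f x v) /\ class_C k' U ('D_v f)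
  else True.

Definition smooth_on (U : set V) (f : V -> W) : Prop :=
  forall k, class_C k U f.

End Smooth.

Record chart (R : realType) (M : topologicalType) (n : nat) := Chart {
  chart_dom : set M;
  chart_fun :> M -> 'rV[R]_n;
  chart_inv : 'rV[R]_n -> M;
  chart_dom_open : open chart_dom;
  chart_cod_open : open (chart_fun @` chart_dom);
  chart_funK : forall x, chart_dom x -> chart_inv (chart_fun x) = x;
  chart_fun_continuous : forall x, chart_dom x -> {for x, continuous chart_fun};
  chart_inv_continuous : forall u, (chart_fun @` chart_dom) u ->
    {for u, continuous chart_inv} }.

Definition chart_cod (R : realType) (M : topologicalType) n
  (c : chart R M n) : set 'rV[R]_n := c @` chart_dom c.

(** [G] may be disconnected, as is usual for nilsystems. *)
Record lie_structure (R : realType) (G : topologicalGroupType) := LieStructure {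
  lie_dim : nat;
  lie_atlas : set (chart R G lie_dim);
  lie_hausdorff : hausdorff_space G;
  lie_second_countable : @second_countable G;
  lie_cover : forall x : G, exists2 c, lie_atlas c & chart_dom c x;
  lie_transition : forall c d, lie_atlas c -> lie_atlas d ->
    smooth_on [set u | chart_cod c u /\ chart_dom d (chart_inv c u)]
      (fun u => d (chart_inv c u));
  lie_mul : forall c d e, lie_atlas c -> lie_atlas d -> lie_atlas e ->
    smooth_on
      [set uv : 'rV[R]_lie_dim * 'rV[R]_lie_dim |
        [/\ chart_cod c uv.1, chart_cod d uv.2 &
            chart_dom e (chart_inv c uv.1 * chart_inv d uv.2)%g]]
      (fun uv => e (chart_inv c uv.1 * chart_inv d uv.2)%g);
  lie_inv : forall c d, lie_atlas c -> lie_atlas d ->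
    smooth_on [set u | chart_cod c u /\ chart_dom d (chart_inv c u)^-1%g]
      (fun u => d (chart_inv c u)^-1%g) }.

Section Cosets.
Local Open Scope quotient_scope.
Variables (G : topologicalGroupType) (Gamma : subgroupType G).

Definition same_coset (x y : G) : bool := `[< sgset Gamma (x^-1 * y)%g >].

Let sg1 : sgset Gamma 1%g := (sgP Gamma).1.
Let sgB x y : sgset Gamma x -> sgset Gamma y -> sgset Gamma (x / y)%g := (sgP Gamma).2 x y.
Let sgV x : sgset Gamma x -> sgset Gamma x^-1%g.
Proof. by move=> Gx; rewrite -[x^-1%g]mul1g; exact: sgB. Qed.

Let same_coset_refl : reflexive same_coset.
Proof. by move=> x; apply/asboolP; rewrite mulVg. Qed.

Let same_coset_sym : symmetric same_coset.
Proof.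
by move=> x y; apply/asboolP/asboolP => /sgV; rewrite invgM invgK.
Qed.

Let same_coset_trans : transitive same_coset.
Proof.
move=> y x z /asboolP xy /asboolP yz; apply/asboolP.
by have := sgB xy (sgV yz); rewrite invgK mulgA mulgK.
Qed.

Canonical same_coset_equiv :=
  EquivRel same_coset same_coset_refl same_coset_sym same_coset_trans.

(** [G / Gamma], the space of left cosets [x Gamma]. *)
Definition coset_space : Type := quotient_topology {eq_quot same_coset}.
HB.instance Definition _ := Topological.on coset_space.
HB.instance Definition _ := Quotient.on coset_space.

Definition coset_translate (g : G) (x : coset_space) : coset_space :=
  \pi_coset_space (g * repr x)%g.

Lemma coset_translateE g h :
  coset_translate g (\pi_coset_space h) = \pi_coset_space (g * h)%g.
Proof.
rewrite /coset_translate; apply/eqmodP/asboolP.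
rewrite invgM -!mulgA mulKg.
by have /eqmodP/asboolP := reprK (\pi_({eq_quot same_coset}) h).
Qed.

Definition discrete_subgroup : Prop :=
  forall g, sgset Gamma g -> exists2 U : set G, open U & U `&` sgset Gamma = [set g].

Definition cocompact_subgroup : Prop := compact [set: coset_space].

End Cosets.

Definition integers (R : realType) : zmodClosed R :=
  GRing.ZmodClosed.clone R (@Num.int_num_subdef R) _.

(** R/Z, with the quotient group structure, the quotient topology and the
    Borel sigma-algebra. *)
Definition circle (R : realType) : Type :=
  quotient_topology (Quotient.quot (integers R)).

Section Circle.
Local Open Scope quotient_scope.
Variable R : realType.

HB.instance Definition _ := PointedTopological.on (circle R).
HB.instance Definition _ := Quotient.on (circle R).
HB.instance Definition _ := GRing.Zmodule.copy (circle R) (Quotient.quot (integers R)).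
HB.instance Definition _ := Measurable.copy (circle R)
  (g_sigma_algebraType (@open (circle R))).

Definition to_circle (x : R) : circle R := \pi_(circle R) x.

Lemma to_circle_continuous : continuous to_circle.
Proof. exact: pi_continuous. Qed.

Lemma to_circle_eq (x y : R) :
  to_circle x = to_circle y <-> x - y \is a Num.int.
Proof.
have -> : (x - y \is a Num.int) = (x == y %[mod Quotient.quot (integers R)]).
  by rewrite -Quotient.idealrBE.
split=> [e|/eqP]; last by [].
by apply/eqP.
Qed.

Lemma to_circle_is_zmod_morphism : zmod_morphism to_circle.
Proof. exact: (pi_is_zmod_morphism (Quotient.quot (integers R))). Qed.

HB.instance Definition _ :=
  GRing.isZmodMorphism.Build R (circle R) to_circle to_circle_is_zmod_morphism.

Lemma measurable_to_circle : measurable_fun [set: R] to_circle.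
Proof.
apply: (@measurability _ _ _ _ _ _ (@open (circle R))) => //.
move=> _ [U oU <-]; rewrite setTI; apply: open_measurable.
by move/continuousP : to_circle_continuous; exact.
Qed.

HB.instance Definition _ :=
  isMeasurableFun.Build _ _ R (circle R) to_circle measurable_to_circle.

(** Lebesgue measure, read on the fundamental domain [0,1[. *)
Definition circle_measure (A : set (circle R)) : \bar R :=
  lebesgue_measure (to_circle @^-1` A `&` `[0%R, 1%R[).

Let circle_measure0 : circle_measure set0 = 0%E.
Proof. by rewrite /circle_measure preimage_set0 set0I measure0. Qed.

Let circle_measure_ge0 A : (0 <= circle_measure A)%E.
Proof. exact: measure_ge0. Qed.

Let circle_measure_additive : semi_sigma_additive circle_measure.
Proof.
have mI A : measurable A -> measurable (to_circle @^-1` A `&` `[0%R, 1%R[).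
  move=> mA; apply: measurableI; last exact: measurable_itv.
  by rewrite -[X in measurable X]setTI; exact: measurable_to_circle.
move=> F mF tF mUF; rewrite /circle_measure preimage_bigcup setI_bigcupl.
apply: (@measure_semi_sigma_additive _ _ _ (@lebesgue_measure R)).
- by move=> n; exact: mI.
- apply/trivIsetP => i j _ _ ij; rewrite setIACA -preimage_setI.
  by move/trivIsetP : tF => /(_ _ _ _ _ ij) ->//; rewrite preimage_set0 set0I.
- by rewrite -setI_bigcupl -preimage_bigcup; exact: mI.
Qed.

HB.instance Definition _ := isMeasure.Build _ _ _ circle_measure
  circle_measure0 circle_measure_ge0 circle_measure_additive.

Let circle_measure_setT : circle_measure setT = 1%E.
Proof.
rewrite /circle_measure preimage_setT setTI.
by rewrite lebesgue_measure_itv /= lte_fin ltr01 oppr0 adde0.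
Qed.

HB.instance Definition _ :=
  Measure_isProbability.Build _ _ _ circle_measure circle_measure_setT.

End Circle.

(** The measurable structure of the product is the product sigma-algebra, which
    is the Borel sigma-algebra of the torus. *)
Notation torus R := (circle R * circle R)%type.

Definition torus_measure (R : realType) :
    {measure set (torus R) -> \bar R} :=
  (@circle_measure R \x @circle_measure R)%E.

Section Dynamics.
Context d (X : measurableType d) (R : realType).
Variable mu : {measure set X -> \bar R}.

Definition measure_preserving (T : bijection X) : Prop :=
  [/\ measurable_fun [set: X] T, measurable_fun [set: X] (T^-1)%g &
      forall A, measurable A -> mu (T @^-1` A) = mu A].

Definition complex_Lfun (p : \bar R) (f : X -> R[i]) : Prop :=
  (fun x => complex.Re (f x)) \in Lfun mu p /\
  (fun x => complex.Im (f x)) \in Lfun mu p.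

Definition complex_integral (f : X -> R[i]) : R[i] :=
  Complex (\int[mu]_x complex.Re (f x))%R (\int[mu]_x complex.Im (f x))%R.

(** Common eigenfunctions of the [T i], i.e. eigenfunctions of the action of the
    group they generate. *)
Definition eigenfunction (I : Type) (T : I -> bijection X) (f : X -> R[i]) :
    Prop :=
  [/\ complex_Lfun 2%:E f,
      ~ {ae mu, forall x, f x = 0} &
      exists lambda : I -> R[i], forall i,
        `|lambda i| = 1 /\ {ae mu, forall x, f (T i x) = lambda i * f x}].

(** The Borel sigma-algebra of the complex plane is that of [R * R]. The result
    contains every measurable null set, since a function equal almost everywhere
    to an eigenfunction is an eigenfunction. *)
Definition kronecker_algebra (I : Type) (T : I -> bijection X) :
    set (set X) :=
  <<s [set A | exists f (B : set (R * R)),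
        [/\ eigenfunction T f, measurable B &
            A = (fun x => (complex.Re (f x), complex.Im (f x))) @^-1` B]] >>.

(** Equality of sigma-algebras modulo null sets. *)
Definition eq_mod_null (S1 S2 : set (set X)) : Prop :=
  (forall A, S1 A -> exists2 B, S2 B & mu ((A `\` B) `|` (B `\` A)) = 0%E) /\
  (forall B, S2 B -> exists2 A, S1 A & mu ((A `\` B) `|` (B `\` A)) = 0%E).

Section JointErgodicity.
Variables (l : nat) (T : 'I_l -> bijection X) (p : 'I_l -> {poly int}).

Definition multiple_average (f : 'I_l -> X -> R[i]) (N : nat) (x : X) : R[i] :=
  N%:R^-1 *
  \sum_(1 <= n < N.+1) \prod_(i < l) f i (zexpg (T i) (p i).[n%:Z] x).

Definition jointly_ergodic : Prop :=
  forall f : 'I_l -> X -> R[i], (forall i, complex_Lfun +oo%E (f i)) ->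
    (fun N => 'N[mu]_2%:E[(fun x =>
       (ComplexField.Normc.normc (multiple_average f N x -
          \prod_(i < l) complex_integral (f i)))%:E)])%E @ \oo --> 0%E.

End JointErgodicity.

End Dynamics.

Section TorusSystems.
Variable R : realType.

Definition unipotent_affine (T : bijection (torus R)) : Prop :=
  exists (A B : {additive torus R -> torus R}) (alpha : torus R),
    [/\ cancel A B /\ cancel B A,
        continuous A /\ continuous B,
        exists n, forall y, iter n (fun z => A z - z) y = 0 &
        forall y, T y = A y + alpha].

(** The torus with the [T i] is isomorphic, as a topological and as a measure
    space, to [G / Gamma] with the invariant measure, each [T i] corresponding
    to the left multiplication by some element of [G]. *)
Definition nilsystem (s l : nat) (T : 'I_l -> bijection (torus R)) : Prop :=
  exists (G : topologicalGroupType) (_ : lie_structure R G)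
         (Gamma : subgroupType G),
    [/\ step_nilpotent s [set: G],
        discrete_subgroup Gamma,
        cocompact_subgroup Gamma &
        exists (phi : coset_space Gamma -> torus R)
               (psi : torus R -> coset_space Gamma),
          [/\ cancel phi psi /\ cancel psi phi,
              continuous phi /\ continuous psi,
              forall g A, measurable A ->
                torus_measure R
                  ((fun y => phi (coset_translate g (psi y))) @^-1` A) =
                torus_measure R A &
              forall i, exists g : G, forall x,
                T i (phi x) = phi (coset_translate g x)]].

Definition affine_nilsystem (s l : nat) (T : 'I_l -> bijection (torus R)) :
    Prop :=
  [/\ forall i, measure_preserving (torus_measure R) (T i),
      forall i, unipotent_affine (T i),
      nilsystem s T &
      step_nilpotent s (generated (range T))].

Definition first_coordinate_algebra : set (set (torus R)) :=
  preimage_set_system [set: torus R] fst (@measurable _ (circle R)).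

End TorusSystems.

(* Main.v *)
From HB Require Import structures.
Require Import Defs.
From mathcomp Require Import all_boot all_order all_algebra.
From mathcomp Require Import generic_quotient ring_quotient.
From mathcomp Require Import all_classical all_reals all_analysis.
From mathcomp Require Import measurable_realfun complex.
From mathcomp Require Import zify ring lra.

Set Implicit Arguments.
Unset Strict Implicit.
Unset Printing Implicit Defensive.
Import Order.TTheory GRing.Theory Num.Theory.
Import numFieldNormedType.Exports.
Local Open Scope classical_set_scope.
Local Open Scope ring_scope.

(** The four maps are skew shifts [T_i (x, y) = (x + a_i, y + x + c_i)], with
    [a = (sqrt 2, sqrt 2, sqrt 3, sqrt 3 + 2 sqrt 2)] and
    [p = (n^3 + n, n^3, n^2, n^2 + n)].  Since
    [T_i^N (x, y) = (x + N a_i, y + N x + N c_i + a_i (N^2 - N) / 2)], the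
    alternating sum of the vertical coordinates of the [T_i^(p_i) (x, y)] has
    quadratic part [(a_1 p_1^2 - a_2 p_2^2 + a_3 p_3^2 - a_4 p_4^2) / 2], which
    reduces to a linear combination of the [p_i], and the [c_i] are chosen to
    cancel it.  So the product of the characters [e(y)], [e(-y)], [e(y)], [e(-y)]
    is constantly [1] along the orbits, although each has integral [0].  On the
    first coordinate, no nontrivial integer combination of the [a_i p_i] has
    only rational coefficients, so Weyl's theorem applies to products of
    characters, and by density to bounded functions.  The Fourier coefficients
    of an eigenfunction of a skew shift have constant modulus along the
    frequencies [(k + j l, l)], j = 0, 1, 2, ..., so they vanish for [l <> 0] by
    Bessel's inequality and the eigenfunction depends on [x] only. *)

(** * Weyl sums *)

Section SquaredModulus.
Context {R : rcfType}.
Implicit Types z w : R[i].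

(** Write a = sqrt 2 and b = sqrt 3. The exponents satisfy p_1 - p_2 + p_3 - p_4 = 0, which removes
    x from the alternating sum. In its quadratic part the sixth powers cancel within the first pair,
    leaving a (2 n^4 + n^2); the summand 2 a of the fourth angle is there to remove 2 a n^4. What
    survives is a combination of n^3 = p_2 and n^2 = p_3, which vertical rotations can absorb.

    Density in L^2 alone does not control a product of four functions. The factors are therefore
    released from being characters one at a time, the others staying uniformly bounded. Each release
    is an induction over the closure of the characters under linear combinations and bounded
    pointwise limits, shown to contain every bounded Borel function. The same induction turns the
    vanishing of the coefficients of an eigenfunction into dependence on x alone, so completeness of
    the characters in L^2 is never invoked.

    The nilpotent group is disconnected, a semidirect product of Z and R^2: the linear part of a
    skew shift is an integer, kept as a discrete coordinate. *)

Definition sqn z : R := complex.Re z ^+ 2 + complex.Im z ^+ 2.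

Lemma sqn_ge0 z : 0 <= sqn z.
Proof. by rewrite addr_ge0// sqr_ge0. Qed.

Lemma sqn0 : sqn 0 = 0.
Proof. by rewrite /sqn /= expr0n addr0. Qed.

Lemma sqn1 : sqn 1 = 1.
Proof. by rewrite /sqn /= expr1n expr0n addr0. Qed.

Lemma sqnM z w : sqn (z * w) = sqn z * sqn w.
Proof. by case: z w => [a b] [c d]; rewrite /sqn /=; ring. Qed.

Lemma sqnN z : sqn (- z) = sqn z.
Proof. by case: z => [a b]; rewrite /sqn /= !sqrrN. Qed.

Lemma sqnC z w : sqn (z - w) = sqn (w - z).
Proof. by rewrite -sqnN opprB. Qed.

Lemma sqn_conj z : sqn (conjc z) = sqn z.
Proof. by case: z => [a b]; rewrite /sqn /= sqrrN. Qed.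

Lemma mulc_conj z : z * conjc z = (sqn z)%:C%C.
Proof.
by case: z => [a b]; rewrite /sqn /=; apply/eqP; rewrite eq_complex /=;
  apply/andP; split; apply/eqP; ring.
Qed.

Lemma sqn_real (a : R) : sqn a%:C%C = a ^+ 2.
Proof. by rewrite /sqn /= expr0n addr0. Qed.

Lemma sqnD_le z w : sqn (z + w) <= 2 * (sqn z + sqn w).
Proof.
case: z w => [a b] [c d]; rewrite /sqn /=.
have := sqr_ge0 (a - c); have := sqr_ge0 (b - d); nra.
Qed.

Lemma sqn_eq0 z : sqn z = 0 -> z = 0.
Proof.
case: z => [a b]; rewrite /sqn /= => /eqP.
by rewrite paddr_eq0 ?sqr_ge0// !sqrf_eq0 => /andP[/eqP -> /eqP ->].
Qed.

Lemma Re_le_sqn z : complex.Re z ^+ 2 <= sqn z.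
Proof. by rewrite lerDl sqr_ge0. Qed.

Lemma Im_le_sqn z : complex.Im z ^+ 2 <= sqn z.
Proof. by rewrite lerDr sqr_ge0. Qed.

Lemma sqn_sum_le N (w : nat -> R[i]) :
  sqn (\sum_(n < N) w n) <= N%:R * \sum_(n < N) sqn (w n).
Proof.
elim: N => [|N IH]; first by rewrite !big_ord0 sqn0 mulr0.
rewrite !big_ord_recr /=.
set S := \sum_(i < N) w i in IH *; set Q := \sum_(i < N) _ in IH *.
have [N0|N0] := posnP N.
  by rewrite /S /Q N0 !big_ord0 !add0r mul1r.
have N_gt0 : (0 : R) < N%:R by rewrite ltr0n.
rewrite -natr1; set n := N%:R in IH N_gt0 *.
(* Expanding |S - n w_N|^2 >= 0 bounds the cross term 2 n Re (S conj w_N), the only one that the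
   induction hypothesis does not control. *)
move: (sqn_ge0 (S - n%:C%C * w N)) IH; rewrite /sqn.
case: S => [a b]; case: (w N) => [c d] /= h IH.
rewrite -(ler_pM2l N_gt0); nra.
Qed.

Lemma sqn_normc z : sqn z = ComplexField.Normc.normc z ^+ 2.
Proof. by case: z => a b; rewrite /sqn /= sqr_sqrtr// addr_ge0// sqr_ge0. Qed.

Lemma Re_sum I (r : seq I) (P : pred I) (F : I -> R[i]) :
  complex.Re (\sum_(i <- r | P i) F i) = \sum_(i <- r | P i) complex.Re (F i).
Proof. by apply: (big_morph (@complex.Re R)) => // [[a b] [c d]]. Qed.

End SquaredModulus.

Section Phase.
Context {R : realType}.
Implicit Types (s t : R) (z : R[i]).

Definition phase t : R[i] := (cos (2 * pi * t) +i* sin (2 * pi * t))%C.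

Lemma phaseD s t : phase (s + t) = phase s * phase t.
Proof.
rewrite /phase mulrDr cosD sinD; apply/eqP; rewrite eq_complex /=.
by rewrite eqxx addrC /=.
Qed.

Lemma phase0 : phase 0 = 1.
Proof. by rewrite /phase mulr0 cos0 sin0. Qed.

Lemma sqn_phase t : sqn (phase t) = 1.
Proof. by rewrite /sqn /= cos2Dsin2. Qed.

Lemma phaseN t : phase (- t) = conjc (phase t).
Proof. by rewrite /phase mulrN cosN sinN. Qed.

Lemma phaseB s t : phase (s - t) = phase s * conjc (phase t).
Proof. by rewrite phaseD phaseN. Qed.

Lemma phase_int t : t \is a Num.int -> phase t = 1.
Proof.
suff pn (n : nat) : phase n%:R = 1.
  move=> /intrP[[n|n] ->]; first exact: pn.
  by rewrite NegzE mulrNz phaseN pn; apply/eqP; rewrite eq_complex /= oppr0 !eqxx.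
elim: n => [|n IH]; first exact: phase0.
rewrite -natr1 phaseD IH mul1r /phase mulr1 mulrC mulr_natr cos2pi sin2pi.
by apply/eqP; rewrite eq_complex /= !eqxx.
Qed.

Lemma phase_eq1 t : phase t = 1 -> t \is a Num.int.
Proof.
have /andP[ft tf] := Num.Theory.floor_itv t.
set f := Num.floor t in ft tf *; have [->//|ft1] := eqVneq t f%:~R.
have -> : t = f%:~R + (t - f%:~R) by ring.
rewrite phaseD phase_int ?intr_int// mul1r => /(congr1 (@complex.Re R)) /= c1.
exfalso; set r := t - f%:~R in c1.
have r0 : 0 < r by rewrite /r subr_gt0 lt_neqAle eq_sym ft1.
have r1 : r < 1 by rewrite /r ltrBlDr; move: tf; rewrite intrD addrC.
have : 0 < sin (pi * r).
  apply: sin_gt0_pi; rewrite mulr_gt0 ?pi_gt0//=.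
  by rewrite -[ltRHS]mulr1 ltr_pM2l// pi_gt0.
(* The half-angle form turns a cosine equal to 1 into a vanishing sine, whereas pi r lies strictly
   between 0 and pi. *)
have : cos (2 * pi * r) = 1 - 2 * sin (pi * r) ^+ 2.
  have -> : 2 * pi * r = (pi * r) *+ 2 by rewrite mulr2n; ring.
  by rewrite cos_mulr2n sin2cos2 mulr2n; ring.
rewrite c1; nra.
Qed.

End Phase.

(** * Cesaro averages and van der Corput's method *)

Section Weyl.
Context {R : realType}.
Implicit Types (u v : nat -> R[i]).

Definition cesaro u (N : nat) : R[i] := N%:R^-1 * \sum_(n < N) u n.

Definition cesaro_null u :=
  forall e : R, 0 < e -> \forall N \near \oo, sqn (cesaro u N) < e.

Lemma sqn_invn (N : nat) : sqn (N%:R^-1 : R[i]) = N%:R ^- 2.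
Proof.
have -> : (N%:R^-1 : R[i]) = (N%:R^-1 : R)%:C%C by rewrite fmorphV /= rmorph_nat.
by rewrite sqn_real exprVn.
Qed.

Lemma sqn_cesaro_le u N : sqn (cesaro u N) <= N%:R^-1 * \sum_(n < N) sqn (u n).
Proof.
rewrite /cesaro sqnM sqn_invn; have [->|N0] := posnP N.
  by rewrite !big_ord0 sqn0 !mulr0.
rewrite expr2 invfM -mulrA ler_pM2l ?invr_gt0 ?ltr0n//.
by rewrite ler_pdivrMl ?ltr0n// sqn_sum_le.
Qed.

Lemma cesaro_null0 : cesaro_null (fun=> 0).
Proof.
by move=> e e0; near=> N; rewrite /cesaro big1// mulr0 sqn0.
Unshelve. all: end_near. Qed.

Lemma cesaro_nullD u v :
  cesaro_null u -> cesaro_null v -> cesaro_null (fun n => u n + v n).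
Proof.
move=> nu nv e e0; have e4 : 0 < e / 4 by rewrite divr_gt0.
near=> N; have hu : sqn (cesaro u N) < e / 4 by near: N; exact: nu.
have hv : sqn (cesaro v N) < e / 4 by near: N; exact: nv.
rewrite {1}/cesaro big_split /= mulrDr.
have := sqnD_le (cesaro u N) (cesaro v N); rewrite /cesaro; lra.
Unshelve. all: end_near. Qed.

Lemma cesaro_nullZ (c : R[i]) u :
  cesaro_null u -> cesaro_null (fun n => c * u n).
Proof.
move=> nu e e0; have e4 : 0 < e / (sqn c + 1).
  by rewrite divr_gt0// ltr_wpDl// sqn_ge0.
near=> N; have : sqn (cesaro u N) < e / (sqn c + 1) by near: N; exact: nu.
have -> : cesaro (fun n => c * u n) N = c * cesaro u N.
  by rewrite /cesaro -mulr_sumr mulrCA.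
rewrite (sqnM c) ltr_pdivlMr ?ltr_wpDl ?sqn_ge0//.
have := sqn_ge0 (cesaro u N); have := sqn_ge0 c; nra.
Unshelve. all: end_near. Qed.

Lemma cesaro_null_sum I (r : seq I) (P : pred I) (u : I -> nat -> R[i]) :
  (forall i, P i -> cesaro_null (u i)) ->
  cesaro_null (fun n => \sum_(i <- r | P i) u i n).
Proof.
move=> nu; elim: r => [|i r IH].
  under eq_fun do rewrite big_nil; exact: cesaro_null0.
under eq_fun do rewrite big_cons.
by case: (P i) (nu i) => // nui; apply: cesaro_nullD => //; exact: nui.
Qed.

Lemma sum_conj I (r : seq I) (P : pred I) (F : I -> R[i]) :
  conjc (\sum_(i <- r | P i) F i) = \sum_(i <- r | P i) conjc (F i).
Proof. exact: rmorph_sum. Qed.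

Lemma cesaro_null_conj u :
  cesaro_null u -> cesaro_null (fun n => conjc (u n)).
Proof.
move=> nu e e0; near=> N.
rewrite /cesaro -sum_conj sqnM sqn_conj -sqnM; near: N; exact: nu.
Unshelve. all: end_near. Qed.

Lemma cesaro_telescope u : (forall n, sqn (u n) <= 1) ->
  cesaro_null (fun n => u n.+1 - u n).
Proof.
move=> u1 e e0; near=> N.
have -> : cesaro (fun n => u n.+1 - u n) N = N%:R^-1 * (u N - u 0).
  rewrite /cesaro; congr (_ * _); clear.
  elim: N => [|N IH]; first by rewrite big_ord0 subrr.
  by rewrite big_ord_recr /= IH; ring.
have N_gt0 : (0 : R) < N%:R.
  by rewrite ltr0n; near: N; exact: nbhs_infty_gt.
(* |u N - u 0|^2 is at most 2 (1 + 1) = 4, and dividing by N^2 >= N leaves less than e. *)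
have N_gt : 4 / e < N%:R by near: N; exact: nbhs_infty_gtr.
rewrite sqnM sqn_invn ltr_pdivrMl ?exprn_gt0//.
have := sqnD_le (u N) (- u 0); rewrite sqnN.
have := u1 N; have := u1 0%N; move: N_gt; rewrite ltr_pdivrMr//.
have : (1 : R) <= N%:R by rewrite ler1n -(ltr0n R).
nra.
Unshelve. all: end_near. Qed.

Lemma cesaro_shiftB u h : (forall n, sqn (u n) <= 1) ->
  cesaro_null (fun n => u (n + h)%N - u n).
Proof.
move=> u1; elim: h => [|h IH].
  under eq_fun do rewrite addn0 subrr; exact: cesaro_null0.
have := cesaro_nullD (@cesaro_telescope (fun n => u (n + h)%N) (fun n => u1 _)) IH.
by congr cesaro_null; apply/funext => n; rewrite addnS addSn; ring.
Qed.

Lemma cesaro_null_shift u h : (forall n, sqn (u n) <= 1) ->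
  cesaro_null u -> cesaro_null (fun n => u (n + h)%N).
Proof.
move=> u1 nu; have := cesaro_nullD (cesaro_shiftB h u1) nu.
by congr cesaro_null; apply/funext => n; ring.
Qed.

(** Replacing [u] by its averages [w] over windows of length [H] changes the Cesaro mean by a null
    term. By convexity the squared mean of [w] is at most the mean of |w n|^2, in which the diagonal
    terms contribute at most 1/H and the others are shifted correlations, null on average. *)
Lemma van_der_corput u : (forall n, sqn (u n) <= 1) ->
  (forall h, (0 < h)%N -> cesaro_null (fun n => u (n + h)%N * conjc (u n))) ->
  cesaro_null u.
Proof.
move=> u1 nuu e e0.
(* Three terms below e/8 remain at the end: the mean of u - w, the diagonal 1/H and the
   correlations. The factor 2 of [sqnD_le] still leaves less than e. *)
have [H H0 He] : exists2 H : nat, (0 < H)%N & 8 / e < H%:R.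
  exists (Num.trunc (8 / e)).+1 => //; exact: truncnS_gt.
pose w n := H%:R^-1 * \sum_(h < H) u (n + h)%N.
pose v n := \sum_(h < H) \sum_(k < H | k != h) u (n + h)%N * conjc (u (n + k)%N).
have u1' n m : sqn (u n * conjc (u m)) <= 1.
  by rewrite sqnM sqn_conj mulr_ile1 ?sqn_ge0.
have nv : cesaro_null v.
  apply: cesaro_null_sum => h _; apply: cesaro_null_sum => k kh.
  (* The pairs with k < h are the correlations of the hypothesis shifted by k; those with h < k are
     conjugates of such. *)
  move: kh; rewrite -val_eqE /=; case: ltngtP => [kh _|hk _|//].
  - have := @cesaro_null_shift (fun n => u (n + (h - k))%N * conjc (u n)) k (fun=> u1' _ _) (nuu _ _).
    rewrite subn_gt0 => /(_ kh); congr cesaro_null; apply/funext => n.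
    by rewrite -addnA subnKC// ltnW.
  - have := cesaro_null_conj (@cesaro_null_shift (fun n => u (n + (k - h))%N * conjc (u n)) h (fun=> u1' _ _) (nuu _ _)).
    rewrite subn_gt0 => /(_ hk); congr cesaro_null; apply/funext => n.
    by rewrite -addnA subnKC 1?ltnW// rmorphM /= conjcK mulrC.
have nw : cesaro_null (fun n => u n - w n).
  have := cesaro_nullZ (- H%:R^-1) (@cesaro_null_sum _ (index_enum 'I_H) predT (fun h n => u (n + h)%N - u n) (fun h _ => cesaro_shiftB h u1)).
  congr cesaro_null; apply/funext => n.
  rewrite sumrB sumr_const card_ord /w -[u n *+ H]mulr_natl.
  set S := \sum_(i < H) u _; rewrite -/S.
  have H0' : (H%:R : R[i]) != 0 by rewrite pnatr_eq0 -lt0n.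
  by field.
have sw n : sqn (w n) <= H%:R^-1 + H%:R ^- 2 * complex.Re (v n).
  rewrite /w sqnM sqn_invn.
  have : (sqn (\sum_(h < H) u (n + h)%N))%:C%C = (\sum_(h < H) sqn (u (n + h)%N))%:C%C + v n.
    rewrite -mulc_conj sum_conj mulr_suml (rmorph_sum (real_complex R)) -big_split /=.
    apply: eq_bigr => h _; rewrite mulr_sumr (bigD1 h)//=; congr (_ + _).
    exact: mulc_conj.
  move/(congr1 (@complex.Re R)); case: (v n) => a b /= ->.
  rewrite mulrDr lerD2r expr2 invfM -mulrA ler_piMr ?invr_ge0//.
  rewrite ler_pdivrMl ?ltr0n// mulr1.
  by rewrite (le_trans (ler_sum _ (fun h _ => u1 _)))// sumr_const card_ord.
near=> N.
have N_gt0 : (0 : R) < N%:R.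
  by rewrite ltr0n; near: N; exact: nbhs_infty_gt.
have h1 : sqn (cesaro (fun n => u n - w n) N) < e / 8.
  by near: N; apply: nw; rewrite divr_gt0.
have h2 : sqn (cesaro v N) < (e / 8) ^+ 2.
  by near: N; apply: nv; rewrite exprn_gt0// divr_gt0.
have h3 : complex.Re (cesaro v N) < e / 8.
  have := Re_le_sqn (cesaro v N); have : 0 < e / 8 by rewrite divr_gt0.
  nra.
have h4 : sqn (cesaro w N) <= H%:R^-1 + H%:R ^- 2 * complex.Re (cesaro v N).
  apply: (le_trans (sqn_cesaro_le _ _)); rewrite ler_pdivrMl//.
  apply: (le_trans (ler_sum _ (fun (n : 'I_N) _ => sw n))).
  rewrite big_split /= sumr_const card_ord -mulr_sumr mulrDr mulr_natl.
  rewrite lerD2l mulrCA ler_wpM2l ?invr_ge0 ?exprn_ge0//.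
  rewrite /cesaro -Re_sum.
  have -> : (N%:R^-1 : R[i]) = (N%:R^-1 : R)%:C%C by rewrite fmorphV /= rmorph_nat.
  case: (\sum_(i < N) v i) => a b /=.
  by rewrite mul0r subr0 mulVKf// gt_eqF.
have -> : cesaro u N = cesaro (fun n => u n - w n) N + cesaro w N.
  by rewrite /cesaro -mulrDr -big_split /=; congr (_ * _); apply: eq_bigr => n _; ring.
have h5 : (H%:R : R)^-1 < e / 8.
  by rewrite -[ltRHS]invrK ltf_pV2 ?posrE ?invr_gt0 ?divr_gt0 ?ltr0n// invf_div.
have h6 : H%:R ^- 2 * complex.Re (cesaro v N) < e / 8.
  have [c0|c0] := leP (complex.Re (cesaro v N)) 0.
    by rewrite (le_lt_trans (mulr_ge0_le0 _ c0)) ?divr_gt0// invr_ge0 exprn_ge0.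
  apply: le_lt_trans h3; rewrite ler_piMl ?(ltW c0)//.
  by rewrite invf_le1 ?exprn_gt0 ?ltr0n// exprn_ege1// ler1n.
by have := sqnD_le (cesaro (fun n => u n - w n) N) (cesaro w N); lra.
Unshelve. all: end_near. Qed.

Definition irrational (t : R) := forall k : int, k != 0 -> k%:~R * t \isn't a Num.int.

Lemma irrational_nat t h : (0 < h)%N -> irrational t -> irrational (t * h%:R).
Proof.
move=> h0 it k k0; have := it (k * h%:Z)%R; rewrite mulf_neq0//; last by case: h h0.
by move=> /(_ isT); rewrite rmorphM /= -mulrA [_ * t]mulrC -[h%:~R]/(h%:R).
Qed.

(** The geometric sequence telescopes: phase (a n + b) is a constant multiple of phase (a (n + 1)) -
    phase (a n), as phase a is not 1. *)
Lemma weyl_linear (a b : R) : irrational a ->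
  cesaro_null (fun n => phase (a * n%:R + b)).
Proof.
move=> ia.
have z1 : phase a - 1 != 0.
  rewrite subr_eq0; apply/eqP => /phase_eq1; apply/negP.
  by have := ia 1; rewrite mul1r; apply.
have s0 : 0 < sqn (phase a - 1).
  rewrite lt_neqAle sqn_ge0 andbT eq_sym; apply: contra z1 => /eqP.
  by move=> /sqn_eq0 ->.
pose c := phase b / (phase a - 1).
have := cesaro_nullZ c (@cesaro_telescope (fun n => phase (a * n%:R)) _).
move=> /(_ (fun n => ltac:(by rewrite sqn_phase))); congr cesaro_null.
apply/funext => n; rewrite phaseD -natr1 (mulrDr a) mulr1 phaseD.
have -> : phase (a * n%:R) * phase a - phase (a * n%:R) = phase (a * n%:R) * (phase a - 1) by ring.
by rewrite /c; field.
Qed.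

(** The correlation at lag h is a linear phase of slope 2 a h, again irrational. *)
Lemma weyl_quadratic (a b c : R) : irrational a ->
  cesaro_null (fun n => phase (a * n%:R ^+ 2 + b * n%:R + c)).
Proof.
move=> ia; apply: van_der_corput => [n|h h0]; first by rewrite sqn_phase.
have /(@weyl_linear _ (a * h%:R ^+ 2 + b * h%:R)) := irrational_nat (isT : 0 < 2)%N (irrational_nat h0 ia).
congr cesaro_null; apply/funext => n; rewrite -phaseB natrD; congr phase; ring.
Qed.

(** The correlation at lag h is a quadratic phase with leading coefficient 3 a h. *)
Lemma weyl_cubic (a b c d : R) : irrational a ->
  cesaro_null (fun n => phase (a * n%:R ^+ 3 + b * n%:R ^+ 2 + c * n%:R + d)).
Proof.
move=> ia; apply: van_der_corput => [n|h h0]; first by rewrite sqn_phase.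
have /(@weyl_quadratic _ (3 * a * h%:R ^+ 2 + 2 * b * h%:R)
  (a * h%:R ^+ 3 + b * h%:R ^+ 2 + c * h%:R)) := irrational_nat (isT : 0 < 3)%N (irrational_nat h0 ia).
congr cesaro_null; apply/funext => n; rewrite -phaseB natrD; congr phase; ring.
Qed.

End Weyl.

(** A nontrivial relation, squared so as to leave at most one root, would make 2, 3 or 6 a rational
    square. *)
Lemma irrational_sqrt2_sqrt3 (R : realType) (k l : int) :
  k%:~R * Num.sqrt 2 + l%:~R * Num.sqrt 3 \is a @Num.int R -> k = 0 /\ l = 0.
Proof.
set a : R := Num.sqrt 2; set b : R := Num.sqrt 3 => /intrP[m klm].
have a2 : a ^+ 2 = 2 by rewrite sqr_sqrtr.
have b2 : b ^+ 2 = 3 by rewrite sqr_sqrtr.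
(* In d x^2 = e y^2 with x nonzero, the p-adic valuations of the two sides have opposite
   parities. *)
have sqr_nat (x y : int) (d e p : nat) : prime p ->
    logn p d = 1%N -> logn p e = 0%N -> (0 < d)%N -> (0 < e)%N ->
    d%:R * x%:~R ^+ 2 = e%:R * y%:~R ^+ 2 :> R -> x = 0.
  move=> pp pd pe d0 e0.
  move=> dxey; have : d%:Z * x ^+ 2 = e%:Z * y ^+ 2.
    by apply: (@intr_inj R); rewrite (intrM _ d%:Z) (intrM _ e%:Z) !rmorphXn /= dxey.
  move=> /(congr1 absz); rewrite (abszM d%:Z) (abszM e%:Z) !abszX /= => xy.
  apply/eqP; rewrite -absz_eq0 -leqn0 leqNgt; apply/negP => x0.
  have y0 : (0 < `|y|)%N.
    rewrite lt0n; apply/eqP => y0; move: xy; rewrite y0 muln0 => /eqP.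
    by rewrite muln_eq0 expn_eq0 andbT eqn0Ngt d0 eqn0Ngt x0.
  move: (congr1 (logn p) xy); rewrite !lognM ?expn_gt0 ?x0 ?y0//.
  by rewrite pd pe; lia.
have [m0|m0] := eqVneq m 0.
  have : 3 * l%:~R ^+ 2 = 2 * k%:~R ^+ 2 :> R.
    rewrite -a2 -b2 -!exprMn; move: klm; rewrite m0 => /eqP.
    by rewrite addr_eq0 => /eqP h; rewrite [a * _]mulrC h sqrrN mulrC.
  move=> h; have l0 := sqr_nat _ _ 3%N 2%N 3%N isT erefl erefl isT isT h.
  have k0 := sqr_nat _ _ 2%N 3%N 2%N isT erefl erefl isT isT (esym h).
  by [].
exfalso; move/eqP: m0; apply.
have [k0|k0] := eqVneq k 0.
  have h : 3 * l%:~R ^+ 2 = 1 * m%:~R ^+ 2 :> R.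
    by rewrite mul1r -klm k0 mul0r add0r exprMn b2 mulrC.
  have l0 := sqr_nat _ _ 3%N 1%N 3%N isT erefl erefl isT isT h.
  by move: h => /eqP; rewrite l0 expr0n mulr0 mul1r eq_sym sqrf_eq0 intr_eq0 => /eqP.
(* Squaring l sqrt 3 = m - k sqrt 2 leaves sqrt 2 as the only irrationality. *)
have h : 2 * m%:~R * k%:~R * a = m%:~R ^+ 2 + 2 * k%:~R ^+ 2 - 3 * l%:~R ^+ 2.
  have lb : l%:~R * b = m%:~R - k%:~R * a by rewrite -klm; ring.
  have lb2 : 3 * l%:~R ^+ 2 = (m%:~R - k%:~R * a) ^+ 2.
    by rewrite -lb exprMn b2 mulrC.
  have -> : 2 * k%:~R ^+ 2 = a ^+ 2 * k%:~R ^+ 2 :> R by rewrite a2.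
  by rewrite lb2; ring.
have h2 : 2 * (2 * m * k)%:~R ^+ 2 = 1 * (m ^+ 2 + 2 * k ^+ 2 - 3 * l ^+ 2)%:~R ^+ 2 :> R.
  have -> : (2 * m * k)%:~R = 2 * m%:~R * k%:~R :> R by rewrite !intrM.
  have -> : (m ^+ 2 + 2 * k ^+ 2 - 3 * l ^+ 2)%:~R =
      m%:~R ^+ 2 + 2 * k%:~R ^+ 2 - 3 * l%:~R ^+ 2 :> R.
    by rewrite !expr2 rmorphB /= intrD !intrM.
  by rewrite mul1r -h [in RHS]exprMn a2 [RHS]mulrC.
have := sqr_nat _ _ 2%N 1%N 2%N isT erefl erefl isT isT h2.
by move=> /eqP; rewrite !mulf_eq0 (negPf k0) !orbF /= => /eqP.
Qed.

(** * The circle *)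

Section CircleTopology.
Context {R : realType}.
Implicit Types (x y : circle R) (s t : R).

Lemma to_circleK x : to_circle (repr x) = x.
Proof. exact: reprK. Qed.

Lemma to_circleP x : exists t, x = to_circle t.
Proof. by exists (repr x); rewrite to_circleK. Qed.

Lemma to_circle_open (U : set R) : open U -> open (@to_circle R @` U).
Proof.
move=> oU; rewrite /open /= /quotient_open.
have -> : \pi_(circle R)%qT @^-1` (@to_circle R @` U) =
    \bigcup_(k in [set: int]) (fun t => t + k%:~R) @^-1` U.
  apply/seteqP; split=> [t [s Us /to_circle_eq /intrP[k stk]]|t [k _ Utk]].
    by exists k => //=; rewrite -stk; have -> : t + (s - t) = s by ring.
  exists (t + k%:~R) => //; apply/to_circle_eq.
  by rewrite addrAC subrr add0r intr_int.
apply: bigcup_open => k _; apply: open_comp => // t _.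
by apply: continuousD; [exact: cvg_id|exact: cvg_cst].
Qed.

Lemma circle_nbhsP (U : set (circle R)) t :
  nbhs (to_circle t) U <-> nbhs t (@to_circle R @^-1` U).
Proof.
split; first exact: to_circle_continuous.
rewrite nbhsE => -[V [oV Vt] VU]; rewrite nbhsE.
exists (@to_circle R @` V); last by move=> _ [s Vs <-]; exact: VU.
by split; [exact: to_circle_open|exists t].
Qed.

Lemma circle_addr_continuous : continuous (fun xy : circle R * circle R => xy.1 + xy.2).
Proof.
move=> [x y] U /=; have [s ->] := to_circleP x; have [t ->] := to_circleP y.
rewrite -raddfD => /circle_nbhsP /(@add_continuous R (s, t)) [[A B] /= [nA nB] ABU].
exists (@to_circle R @` A, @to_circle R @` B) => /=.
  split; apply/circle_nbhsP.
    by apply: filterS nA => a Aa; exists a.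
  by apply: filterS nB => b Bb; exists b.
move=> [_ _] [/= [a Aa <-] [b Bb <-]]; rewrite -raddfD.
by apply: (ABU (a, b)).
Qed.

Lemma circle_continuousP (Z : topologicalType) (f : circle R -> Z) :
  continuous (f \o @to_circle R) -> continuous f.
Proof. by move=> cf; apply/quotient_continuous. Qed.

Lemma circle_measurable_continuous (f : circle R -> R) :
  continuous f -> measurable_fun setT f.
Proof.
move=> /continuousP cf; apply: (measurability _ (RGenOpens.measurableE R)).
move=> _ [_ [a [b ->]] <-]; rewrite setTI; apply: sub_sigma_algebra.
by apply: cf; exact: interval_open.
Qed.

(** Evaluated at an arbitrary representative; [character_to_circle] shows that the choice is
    immaterial. *)
Definition character (k : int) x : R[i] := phase (k%:~R * repr x).

Lemma character_to_circle k t : character k (to_circle t) = phase (k%:~R * t).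
Proof.
have /to_circle_eq/intrP[m tm] : to_circle t = to_circle (repr (to_circle t)).
  by rewrite to_circleK.
have -> : k%:~R * t = k%:~R * (t - repr (to_circle t)) + k%:~R * repr (to_circle t).
  by ring.
by rewrite /character phaseD tm -intrM (@phase_int _ (k * m)%:~R) ?intr_int// mul1r.
Qed.

Lemma characterD k x y : character k (x + y) = character k x * character k y.
Proof.
have [s ->] := to_circleP x; have [t ->] := to_circleP y.
by rewrite -raddfD !character_to_circle mulrDr phaseD.
Qed.

Lemma character_addl k l x : character (k + l) x = character k x * character l x.
Proof. by rewrite /character intrD mulrDl phaseD. Qed.

Lemma character0 x : character 0 x = 1.
Proof. by rewrite /character mul0r phase0. Qed.

Lemma characterN k x : character (- k) x = conjc (character k x).
Proof. by rewrite /character mulrNz mulNr phaseN. Qed.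

Lemma sqn_character k x : sqn (character k x) = 1.
Proof. exact: sqn_phase. Qed.

Lemma Re_character_continuous k : continuous (fun x => complex.Re (character k x)).
Proof.
apply: circle_continuousP.
have -> : (fun x => complex.Re (character k x)) \o @to_circle R =
    cos \o (fun t => 2 * pi * k%:~R * t).
  by apply/funext => t; rewrite /comp character_to_circle /= !mulrA.
by move=> t; apply: continuous_comp; [exact: mulrl_continuous|exact: continuous_cos].
Qed.

Lemma Im_character_continuous k : continuous (fun x => complex.Im (character k x)).
Proof.
apply: circle_continuousP.
have -> : (fun x => complex.Im (character k x)) \o @to_circle R =
    sin \o (fun t => 2 * pi * k%:~R * t).
  by apply/funext => t; rewrite /comp character_to_circle /= !mulrA.
by move=> t; apply: continuous_comp; [exact: mulrl_continuous|exact: continuous_sin].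
Qed.

(** In terms of angles the condition reads t < cos (2 pi (x - c)), an open arc centred at c. Written
    through [character 1], it exhibits the arc as a superlevel set of a trigonometric polynomial. *)
Definition arc (c t : R) : set (circle R) :=
  [set x | t < cos (2 * pi * c) * complex.Re (character 1 x) +
               sin (2 * pi * c) * complex.Im (character 1 x)].

Lemma arcE c t s : arc c t (to_circle s) = (t < cos (2 * pi * (s - c))) :> Prop.
Proof.
rewrite /arc /mkset character_to_circle mul1r /= [2 * pi * (s - c)]mulrBr cosB.
by rewrite [X in X + _]mulrC [X in _ + X]mulrC.
Qed.

Lemma cos_gt_near_int (d : R) : 0 < d -> d < 2^-1 ->
  forall s, cos (2 * pi * d) < cos (2 * pi * s) -> exists k : int, `|s - k%:~R| < d.
Proof.
(* The integer nearest to s; then |s - k| is at most 1/2, and cos (2 pi r) decreases for r in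
   [0, 1/2]. *)
move=> d0 d2 s ds; have /andP[kl kr] := Num.Theory.floor_itv (s + 2^-1).
set k := Num.floor (s + 2^-1) in kl kr *; exists k.
move: kr; rewrite intrD => kr.
rewrite ltNge; apply: contraTN ds => dk; rewrite -leNgt.
have -> : cos (2 * pi * s) = cos (2 * pi * `|s - k%:~R|).
  transitivity (complex.Re (phase (s - k%:~R))).
    by rewrite phaseB (phase_int (intr_int R k)) /= mulr1 oppr0 mulr0 subr0.
  by rewrite /=; case: (ger0P (s - k%:~R)) => // _; rewrite mulrN cosN.
have : `|s - k%:~R| <= 2^-1 by rewrite ler_norml; apply/andP; split; lra.
move: (`|_|) dk => r dr r2; rewrite leNgt; apply/negP.
have pi0 := pi_gt0 R; rewrite ltr_cos ?in_itv/=; nra.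
Qed.

(** Arcs with rational data are countably many, so this union is available in a sigma-algebra: arcs
    generate the Borel sets. *)
Lemma open_bigcup_arc (U : set (circle R)) : open U ->
  U = \bigcup_(q in [set q : rat * rat | arc (ratr q.1) (ratr q.2) `<=` U])
        arc (ratr q.1) (ratr q.2).
Proof.
move=> oU; apply/seteqP; split=> [x Ux|x [q qU qx]]; last exact: qU.
have [s xs] := to_circleP x; rewrite {}xs in Ux *.
have /circle_nbhsP/nbhs_ballP[e /= e0 eU] : nbhs (to_circle s) U.
  by apply: open_nbhs_nbhs.
(* The centre c is within d/2 of s and the arc within d of c modulo 1, hence within 3 d / 2 < e of
   s; d <= 1/4 keeps the angles where the cosine decreases. *)
pose d := Num.min (e / 2) 4^-1.
have d0 : 0 < d by rewrite lt_min divr_gt0//= invr_gt0.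
have de : d <= e / 2 by rewrite ge_min lexx.
have d4 : d <= 4^-1 by rewrite ge_min lexx orbT.
have [c] : exists c : rat, ratr c \in `]s - d / 2, s + d / 2[.
  by apply: rat_in_itvoo; lra.
rewrite in_itv /= => /andP[sc cs].
have [t] : exists t : rat, ratr t \in `]cos (2 * pi * d) : R, cos (2 * pi * (d / 2))[.
  apply: rat_in_itvoo; have pi0 := pi_gt0 R; rewrite ltr_cos ?in_itv/=; nra.
rewrite in_itv /= => /andP[ct tc].
exists (c, t) => /=; last first.
  rewrite arcE (lt_trans tc)//.
  have -> : cos (2 * pi * (s - ratr c)) = cos (2 * pi * `|s - ratr c|) :> R.
    by case: (ger0P (s - ratr c)) => // _; rewrite mulrN cosN.
  have : `|s - ratr c| < d / 2 by rewrite ltr_norml; apply/andP; split; lra.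
  have := normr_ge0 (s - ratr c); move: (`|_|) => r r0 rd.
  have pi0 := pi_gt0 R; rewrite ltr_cos ?in_itv/=; nra.
move=> y; have [r ->] := to_circleP y; rewrite arcE => /(lt_trans ct).
move=> /cos_gt_near_int [||k rk]//; first by lra.
have -> : to_circle r = to_circle (r - k%:~R).
  by apply/to_circle_eq; have -> : r - (r - k%:~R) = k%:~R by ring.
apply: eU; rewrite /ball /= ltr_norml; move: rk; rewrite ltr_norml => /andP[? ?].
by apply/andP; split; lra.
Qed.

Lemma circle_measurable_ind (P : set (circle R) -> Prop) :
  (forall c t, P (arc c t)) ->
  (forall A, P A -> P (~` A)) ->
  (forall F : nat -> set (circle R), (forall n, P (F n)) -> P (\bigcup_n F n)) ->
  forall A, measurable A -> P A.
Proof.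
move=> Parc PC PU.
have P0 : P set0.
  have -> : set0 = arc 0 1.
    apply/esym/seteqP; split=> // x; have [s ->] := to_circleP x.
    by rewrite arcE ltNge cos_le1.
  exact: Parc.
apply: smallest_sub; first by split => // A PA; rewrite setTD; exact: PC.
(* Indices that code no pair, or a pair whose arc leaves U, receive the empty set, which is itself
   an arc of threshold 1. *)
move=> U oU; pose F n := if @unpickle (rat * rat)%type n is Some q then
  (if `[< arc (ratr q.1) (ratr q.2) `<=` U >] then arc (ratr q.1) (ratr q.2) else set0)
  else set0.
have -> : U = \bigcup_n F n.
  rewrite [LHS](open_bigcup_arc oU); apply/seteqP; split=> [x [q qU qx]|x [n _]].
    exists (pickle q); first exact: Logic.I.
    by rewrite /F pickleK; case: asboolP.
  rewrite /F; case: unpickle => // q; case: asboolP => // qU qx; by exists q.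
apply: PU => n; rewrite /F; case: unpickle => // q; by case: asboolP.
Qed.

End CircleTopology.

(** * Rotation invariance of the measure of the circle *)

Lemma lebesgue_measure_shift (R : realType) (a : R) (A : set R) : measurable A ->
  lebesgue_measure ((fun t => t + a) @^-1` A) = lebesgue_measure A.
Proof.
have ms : measurable_fun setT (fun t : measurableTypeR R => t + a : measurableTypeR R).
  by apply: measurable_funD.
pose s := MeasurableFun.Pack (MeasurableFun.Class (isMeasurableFun.Build _ _ _ _ _ ms)).
move=> mA; apply/esym.
apply: (@lebesgue_measure_unique _ (pushforward lebesgue_measure s)) => // _ [[x y] _ <-].
transitivity (lebesgue_measure (`]x - a, y - a]%classic : set R)); last first.
  congr lebesgue_measure.
  by apply/seteqP; split=> t /=; rewrite !in_itv /= ltrBlDr lerBrDr.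
rewrite !lebesgue_measure_itv /= !lte_fin ltrD2r; case: ifP => // _.
by rewrite -!EFinB; congr EFin; ring.
Qed.

Section CircleMeasure.
Context {R : realType}.
Local Notation m := (@circle_measure R).

Lemma circle_measurable_shift (a : circle R) :
  measurable_fun setT (fun x : circle R => x + a).
Proof.
apply: (measurability (@open (circle R))) => // _ [U oU <-].
rewrite setTI; apply: sub_sigma_algebra.
apply: open_comp => // x _; move: x; have [s ->] := to_circleP a.
apply: circle_continuousP => t.
have -> : (fun x => x + to_circle s) \o @to_circle R = @to_circle R \o (fun t => t + s).
  by apply/funext => r /=; rewrite raddfD.
apply: continuous_comp; last exact: to_circle_continuous.
by apply: continuousD; [exact: cvg_id|exact: cvg_cst].
Qed.

(** Translation by t in [0, 1) turns the window [0, 1) into [t, 1 + t); its part beyond 1 is brought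
    back to [0, t) because the preimage of A has period 1. *)
Lemma circle_measure_shift (a : circle R) (A : set (circle R)) :
  measurable A -> m ((fun x => x + a) @^-1` A) = m A.
Proof.
move=> mA.
have [t [t0 t1 ->]] : exists t, [/\ 0 <= t, t < 1 & a = to_circle t].
  have [s ->] := to_circleP a; have /andP[fl fr] := Num.Theory.floor_itv s.
  exists (s - (Num.floor s)%:~R); rewrite intrD in fr.
  split; [lra|lra|apply/to_circle_eq].
  by have -> : s - (s - (Num.floor s)%:~R) = (Num.floor s)%:~R by ring.
pose P : set R := @to_circle R @^-1` A.
have mP : measurable P.
  by rewrite -[P]setTI; exact: measurable_to_circle.
have P1 : (fun s => s + 1) @^-1` P = P.
  apply/funext => s; rewrite /P /preimage /=; congr A; apply/to_circle_eq.
  by rewrite addrAC subrr add0r.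
have I (x y : R) : measurable (P `&` [set` `[x, y[]).
  by apply: measurableI.
rewrite /circle_measure -/P.
have -> : @to_circle R @^-1` ((fun x => x + to_circle t) @^-1` A) `&` [set` `[0, 1[] =
    (fun s => s + t) @^-1` (P `&` [set` `[t, 1 + t[]).
  apply/seteqP; split=> s /=; rewrite /P /= -raddfD !in_itv /= => -[? /andP[? ?]];
    by split=> //; apply/andP; split; lra.
rewrite lebesgue_measure_shift//.
have -> : P `&` [set` `[t, 1 + t[] = (P `&` [set` `[t, 1[]) `|` (P `&` [set` `[1, 1 + t[]).
  rewrite -setIUr; congr (_ `&` _); apply/seteqP; split=> s /=; rewrite !in_itv /=.
    move=> /andP[ts st]; have [s1|s1] := ltP s 1; [left|right]; rewrite ?ts//=.
  by move=> [] /andP[? ?]; apply/andP; split; lra.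
have -> : P `&` [set` `[0, 1[] = (P `&` [set` `[0, t[]) `|` (P `&` [set` `[t, 1[]).
  rewrite -setIUr; congr (_ `&` _); apply/seteqP; split=> s /=; rewrite !in_itv /=.
    move=> /andP[ts st]; have [s1|s1] := ltP s t; [left|right]; rewrite ?ts ?st//=.
  by move=> [] /andP[? ?]; apply/andP; split; lra.
have D (x y z : R) : (P `&` [set` `[x, y[]) `&` (P `&` [set` `[y, z[]) = set0.
  by apply/seteqP; split=> // s [[_ /=]] + [_ /=]; rewrite !in_itv/=; lra.
rewrite [LHS]measureU; [|exact: I|exact: I|exact: D].
rewrite [RHS]measureU; [|exact: I|exact: I|exact: D].
rewrite [RHS]addeC.
congr (_ + _)%E; apply: (etrans (esym (lebesgue_measure_shift 1 (I 1 (1 + t))))).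
congr lebesgue_measure.
rewrite preimage_setI P1; congr (_ `&` _); apply/seteqP; split=> s /=;
  by rewrite !in_itv /=; lra.
Qed.

End CircleMeasure.

(** * Integrals of complex functions *)

Section ComplexIntegral.
Context d (X : measurableType d) (R : realType).
Implicit Types (f g : X -> R[i]).

Definition cmeasurable f :=
  measurable_fun setT (fun x => complex.Re (f x)) /\
  measurable_fun setT (fun x => complex.Im (f x)).

(** The bound holds everywhere and not just almost everywhere, so that it survives products,
    compositions and pointwise limits without null sets. *)
Definition cbounded f := exists M : R, forall x, sqn (f x) <= M.

Definition bmeas f := cmeasurable f /\ cbounded f.

Definition ccvg (F : nat -> X -> R[i]) f := forall x,
  (complex.Re (F n x) @[n --> \oo] --> complex.Re (f x)) /\
  (complex.Im (F n x) @[n --> \oo] --> complex.Im (f x)).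

Lemma cmeasurable_cst (c : R[i]) : cmeasurable (fun=> c).
Proof. by split; exact: measurable_cst. Qed.

Lemma cmeasurableD f g :
  cmeasurable f -> cmeasurable g -> cmeasurable (fun x => f x + g x).
Proof.
move=> [f1 f2] [g1 g2]; split.
  rewrite (_ : (fun x => _) = (fun x => complex.Re (f x)) \+ (fun x => complex.Re (g x))).
    exact: measurable_funD.
  by apply/funext => x /=; case: (f x) (g x) => [? ?] [? ?].
rewrite (_ : (fun x => _) = (fun x => complex.Im (f x)) \+ (fun x => complex.Im (g x))).
  exact: measurable_funD.
by apply/funext => x /=; case: (f x) (g x) => [? ?] [? ?].
Qed.

Lemma Re_mulc (z w : R[i]) : complex.Re (z * w) =
  complex.Re z * complex.Re w - complex.Im z * complex.Im w.
Proof. by case: z w => [? ?] [? ?]. Qed.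

Lemma Im_mulc (z w : R[i]) : complex.Im (z * w) =
  complex.Re z * complex.Im w + complex.Im z * complex.Re w.
Proof. by case: z w => [? ?] [? ?]. Qed.

Lemma Re_addc (z w : R[i]) : complex.Re (z + w) = complex.Re z + complex.Re w.
Proof. by case: z w => [? ?] [? ?]. Qed.

Lemma Im_addc (z w : R[i]) : complex.Im (z + w) = complex.Im z + complex.Im w.
Proof. by case: z w => [? ?] [? ?]. Qed.

Lemma complex_eq (z w : R[i]) : complex.Re z = complex.Re w ->
  complex.Im z = complex.Im w -> z = w.
Proof. by case: z w => [? ?] [? ?] /= -> ->. Qed.

Lemma cmeasurableM f g :
  cmeasurable f -> cmeasurable g -> cmeasurable (fun x => f x * g x).
Proof.
move=> [f1 f2] [g1 g2]; split.
  under eq_fun do rewrite Re_mulc.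
  by apply: measurable_funB; apply: measurable_funM.
under eq_fun do rewrite Im_mulc.
by apply: measurable_funD; apply: measurable_funM.
Qed.

Lemma cmeasurable_sum I (r : seq I) (F : I -> X -> R[i]) :
  (forall i, cmeasurable (F i)) -> cmeasurable (fun x => \sum_(i <- r) F i x).
Proof.
move=> mF; elim: r => [|i r IH].
  under eq_fun do rewrite big_nil; exact: cmeasurable_cst.
by under eq_fun do rewrite big_cons; exact: cmeasurableD.
Qed.

Lemma cmeasurable_prod I (r : seq I) (F : I -> X -> R[i]) :
  (forall i, cmeasurable (F i)) -> cmeasurable (fun x => \prod_(i <- r) F i x).
Proof.
move=> mF; elim: r => [|i r IH].
  under eq_fun do rewrite big_nil; exact: cmeasurable_cst.
by under eq_fun do rewrite big_cons; exact: cmeasurableM.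
Qed.

Lemma measurable_sqn f : cmeasurable f -> measurable_fun setT (fun x => sqn (f x)).
Proof. by move=> [f1 f2]; apply: measurable_funD; apply: measurable_funX. Qed.

Lemma bmeas_cst (c : R[i]) : bmeas (fun=> c).
Proof. by split; [exact: cmeasurable_cst|exists (sqn c)]. Qed.

Lemma bmeasD f g : bmeas f -> bmeas g -> bmeas (fun x => f x + g x).
Proof.
move=> [mf [M fM]] [mg [N gN]]; split; first exact: cmeasurableD.
exists (2 * (M + N)) => x; apply: (le_trans (sqnD_le _ _)).
by rewrite ler_pM2l// lerD.
Qed.

Lemma bmeasM f g : bmeas f -> bmeas g -> bmeas (fun x => f x * g x).
Proof.
move=> [mf [M fM]] [mg [N gN]]; split; first exact: cmeasurableM.
by exists (M * N) => x; rewrite sqnM ler_pM ?sqn_ge0.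
Qed.

Lemma bmeasZ (c : R[i]) f : bmeas f -> bmeas (fun x => c * f x).
Proof. by move=> bf; apply: bmeasM => //; exact: bmeas_cst. Qed.

Lemma bmeasB f g : bmeas f -> bmeas g -> bmeas (fun x => f x - g x).
Proof.
move=> bf /(bmeasZ (-1)) bg; have := bmeasD bf bg.
by congr bmeas; apply/funext => x; rewrite mulN1r.
Qed.

Lemma bmeas_sum I (r : seq I) (P : pred I) (F : I -> X -> R[i]) :
  (forall i, P i -> bmeas (F i)) -> bmeas (fun x => \sum_(i <- r | P i) F i x).
Proof.
move=> bF; elim: r => [|i r IH].
  under eq_fun do rewrite big_nil; exact: bmeas_cst.
under eq_fun do rewrite big_cons.
by case: (P i) (bF i) => // bFi; apply: bmeasD => //; exact: bFi.
Qed.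

Lemma bmeas_prod I (r : seq I) (P : pred I) (F : I -> X -> R[i]) :
  (forall i, P i -> bmeas (F i)) -> bmeas (fun x => \prod_(i <- r | P i) F i x).
Proof.
move=> bF; elim: r => [|i r IH].
  under eq_fun do rewrite big_nil; exact: bmeas_cst.
under eq_fun do rewrite big_cons.
by case: (P i) (bF i) => // bFi; apply: bmeasM => //; exact: bFi.
Qed.

Lemma normr_Re_le (z : R[i]) (M : R) : sqn z <= M -> `|complex.Re z| <= M + 1.
Proof.
move=> zM; have := le_trans (Re_le_sqn z) zM; rewrite -real_normK ?num_real//.
by have := normr_ge0 (complex.Re z); nra.
Qed.

Lemma normr_Im_le (z : R[i]) (M : R) : sqn z <= M -> `|complex.Im z| <= M + 1.
Proof.
move=> zM; have := le_trans (Im_le_sqn z) zM; rewrite -real_normK ?num_real//.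
by have := normr_ge0 (complex.Im z); nra.
Qed.

Lemma ccvg_sqn F f x (c : R[i]) : ccvg F f ->
  sqn (F n x + c) @[n --> \oo] --> sqn (f x + c).
Proof.
move=> /(_ x)[cR cI]; rewrite /sqn.
under eq_fun do rewrite !(Re_addc, Im_addc) !expr2.
rewrite !(Re_addc, Im_addc) !expr2.
by apply: cvgD; apply: cvgM; apply: cvgD => //; exact: cvg_cst.
Qed.

Lemma bmeas_lim (F : nat -> X -> R[i]) f (M : R) :
  (forall n, cmeasurable (F n)) -> (forall n x, sqn (F n x) <= M) -> ccvg F f ->
  cmeasurable f /\ forall x, sqn (f x) <= M.
Proof.
move=> mF FM cF; split.
  split.
    apply: (measurable_fun_cvg (h := fun n x => complex.Re (F n x))) => [n|x _].
      exact: (mF n).1.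
    exact: (cF x).1.
  apply: (measurable_fun_cvg (h := fun n x => complex.Im (F n x))) => [n|x _].
    exact: (mF n).2.
  exact: (cF x).2.
move=> x; have := @ccvg_sqn F f x 0 cF; rewrite addr0.
under eq_fun do rewrite addr0.
by move=> /cvgr_to_le; apply; exact: nearW.
Qed.

Variable mu : {measure set X -> \bar R}.
Hypothesis mu1 : mu setT = 1%E.

Definition rintegrable (u : X -> R) := mu.-integrable setT (EFin \o u).

Lemma rintegrable_bounded (u : X -> R) (M : R) : measurable_fun setT u ->
  (forall x, `|u x| <= M) -> rintegrable u.
Proof.
move=> mu_ uM; apply: measurable_bounded_integrable => //; first by rewrite mu1 ltry.
by exists M; split=> [|M' MM' x _ /=]; [exact: num_real|rewrite (le_trans (uM x))// ltW].
Qed.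

Lemma rintegrableM (u v : X -> R) (M : R) : rintegrable u -> measurable_fun setT v ->
  (forall x, `|v x| <= M) -> rintegrable (fun x => u x * v x).
Proof.
move=> iu mv vM; apply: (eq_integrable _ _ _ _ (integrableMl _ iu mv _)) => //.
by exists M; split=> [|M' MM' x _ /=]; [exact: num_real|rewrite (le_trans (vM x))// ltW].
Qed.

Lemma rintegrableD (u v : X -> R) : rintegrable u -> rintegrable v ->
  rintegrable (fun x => u x + v x).
Proof. by move=> iu iv; apply: (eq_integrable _ _ _ _ (integrableD _ iu iv)). Qed.

Lemma rintegrableZ (c : R) (u : X -> R) : rintegrable u ->
  rintegrable (fun x => c * u x).
Proof. by move=> iu; apply: (eq_integrable _ _ _ _ (integrableZl _ c iu)). Qed.

Lemma rintegrableB (u v : X -> R) : rintegrable u -> rintegrable v ->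
  rintegrable (fun x => u x - v x).
Proof. by move=> iu iv; apply: (eq_integrable _ _ _ _ (integrableB _ iu iv)). Qed.

Definition cintegrable f := rintegrable (fun x => complex.Re (f x)) /\
  rintegrable (fun x => complex.Im (f x)).

Local Notation cI := (complex_integral mu).

Lemma bmeas_integrable f : bmeas f -> cintegrable f.
Proof.
move=> [[m1 m2] [M fM]]; split; apply: (@rintegrable_bounded _ (M + 1)) => // x.
  exact: normr_Re_le.
exact: normr_Im_le.
Qed.

Lemma cintegrableM f g : cintegrable f -> bmeas g -> cintegrable (fun x => f x * g x).
Proof.
move=> [i1 i2] [[m1 m2] [M gM]]; rewrite /cintegrable.
have h1 u : rintegrable u -> rintegrable (fun x => u x * complex.Re (g x)).
  by move=> iu; apply: (@rintegrableM _ _ (M + 1)) => // x; exact: normr_Re_le.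
have h2 u : rintegrable u -> rintegrable (fun x => u x * complex.Im (g x)).
  by move=> iu; apply: (@rintegrableM _ _ (M + 1)) => // x; exact: normr_Im_le.
split.
  under [X in rintegrable X]eq_fun do rewrite Re_mulc.
  by apply: rintegrableB; [exact: h1|exact: h2].
under [X in rintegrable X]eq_fun do rewrite Im_mulc.
by apply: rintegrableD; [exact: h2|exact: h1].
Qed.

Lemma cintegrableD f g : cintegrable f -> cintegrable g ->
  cintegrable (fun x => f x + g x).
Proof.
move=> [f1 f2] [g1 g2]; split.
  under [X in rintegrable X]eq_fun do rewrite Re_addc; exact: rintegrableD.
under [X in rintegrable X]eq_fun do rewrite Im_addc; exact: rintegrableD.
Qed.

Lemma complex_integralD f g : cintegrable f -> cintegrable g ->
  cI (fun x => f x + g x) = cI f + cI g.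
Proof.
move=> [f1 f2] [g1 g2]; apply: complex_eq => /=.
  under eq_Rintegral do rewrite Re_addc; exact: RintegralD.
under eq_Rintegral do rewrite Im_addc; exact: RintegralD.
Qed.

Lemma complex_integralZ (c : R[i]) f : cintegrable f ->
  cI (fun x => c * f x) = c * cI f.
Proof.
move=> [f1 f2]; apply: complex_eq.
  rewrite Re_mulc /=; under eq_Rintegral do rewrite Re_mulc.
  by rewrite RintegralB ?RintegralZl//; exact: rintegrableZ.
rewrite Im_mulc /=; under eq_Rintegral do rewrite Im_mulc.
by rewrite RintegralD ?RintegralZl//; exact: rintegrableZ.
Qed.

Lemma Rintegral1 (c : R) : Rintegral mu setT (fun=> c) = c.
Proof. by rewrite Rintegral_cst// mu1 mulr1. Qed.

Lemma complex_integral_cst (c : R[i]) : cI (fun=> c) = c.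
Proof. by apply: complex_eq; rewrite /= Rintegral1. Qed.

Lemma rintegral_dominated (u v : X -> R) (W : nat -> X -> R) (M : R) :
  rintegrable u -> (forall n, measurable_fun setT (W n)) ->
  (forall n x, `|W n x| <= M) -> (forall x, W n x @[n --> \oo] --> v x) ->
  Rintegral mu setT (fun x => u x * W n x) @[n --> \oo] -->
  Rintegral mu setT (fun x => u x * v x).
Proof.
move=> iu mW WM Wv.
have mu_ : measurable_fun setT u by apply/measurable_EFinP; exact: (measurable_int mu).
have mv : measurable_fun setT v.
  by apply: (measurable_fun_cvg (h := W)) => // x _; exact: Wv.
have vM x : `|v x| <= M.
  by apply: (cvgr_to_le (cvg_norm (Wv x))); exact: nearW.
have h n : measurable_fun setT (fun x => u x * W n x) by exact: measurable_funM.
have M0 : X -> 0 <= M by move=> x; exact: le_trans (normr_ge0 _) (vM x).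
have h1 : {ae mu, forall x, setT x -> (u x * W n x)%:E @[n --> \oo] --> (u x * v x)%:E}.
  apply: aeW => x _; apply: cvg_EFin; first exact: nearW.
  by apply: cvgM; [exact: cvg_cst|exact: Wv].
have h2 : {ae mu, forall x n, setT x -> (`|(u x * W n x)%:E| <= M%:E * `|(u x)%:E|)%E}.
  by apply: aeW => x n _; rewrite /= lee_fin normrM mulrC ler_wpM2r.
have [_ _] := @dominated_convergence _ X R mu setT measurableT
  (fun n => EFin \o (fun x => u x * W n x)) (EFin \o (fun x => u x * v x))
  (fun x => (M%:E * `|(u x)%:E|)%E)
  (fun n => (measurable_EFinP _ _).2 (h n))
  ((measurable_EFinP _ _).2 (measurable_funM mu_ mv)) h1
  (integrableZl measurableT _ (integrable_abse iu)) h2.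
rewrite -(fineK (integrable_fin_num _ (rintegrableM iu mv vM)))//.
exact: fine_cvg.
Qed.

(** The weight [f] is only integrable, which admits eigenfunctions, known merely to be square
    integrable. *)
Lemma complex_integral_dominated f (F : nat -> X -> R[i]) g (M : R) :
  cintegrable f -> (forall n, cmeasurable (F n)) ->
  (forall n x, sqn (F n x) <= M) -> ccvg F g ->
  (complex.Re (cI (fun x => f x * F n x)) @[n --> \oo] -->
     complex.Re (cI (fun x => f x * g x))) /\
  (complex.Im (cI (fun x => f x * F n x)) @[n --> \oo] -->
     complex.Im (cI (fun x => f x * g x))).
Proof.
move=> [f1 f2] mF FM Fg.
have [mg gM] := bmeas_lim mF FM Fg.
have bF n : bmeas (F n) by split => //; exists M.
have bg : bmeas g by split => //; exists M.
have dR u : rintegrable u -> Rintegral mu setT (fun x => u x * complex.Re (F n x))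
    @[n --> \oo] --> Rintegral mu setT (fun x => u x * complex.Re (g x)).
  move=> iu; apply: (@rintegral_dominated _ _ _ (M + 1)) => // [n|n x|x].
  - exact: (mF n).1.
  - exact: normr_Re_le.
  - exact: (Fg x).1.
have dI u : rintegrable u -> Rintegral mu setT (fun x => u x * complex.Im (F n x))
    @[n --> \oo] --> Rintegral mu setT (fun x => u x * complex.Im (g x)).
  move=> iu; apply: (@rintegral_dominated _ _ _ (M + 1)) => // [n|n x|x].
  - exact: (mF n).2.
  - exact: normr_Im_le.
  - exact: (Fg x).2.
have iR u h : rintegrable u -> bmeas h -> rintegrable (fun x => u x * complex.Re (h x)).
  move=> iu [[m1 _] [N hN]]; apply: (@rintegrableM _ _ (N + 1)) => // x.
  exact: normr_Re_le.
have iI u h : rintegrable u -> bmeas h -> rintegrable (fun x => u x * complex.Im (h x)).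
  move=> iu [[_ m2] [N hN]]; apply: (@rintegrableM _ _ (N + 1)) => // x.
  exact: normr_Im_le.
have ER h : bmeas h -> complex.Re (cI (fun x => f x * h x)) =
    Rintegral mu setT (fun x => complex.Re (f x) * complex.Re (h x)) -
    Rintegral mu setT (fun x => complex.Im (f x) * complex.Im (h x)).
  move=> bh /=; under eq_Rintegral do rewrite Re_mulc.
  by rewrite RintegralB//; [exact: iR|exact: iI].
have EI h : bmeas h -> complex.Im (cI (fun x => f x * h x)) =
    Rintegral mu setT (fun x => complex.Re (f x) * complex.Im (h x)) +
    Rintegral mu setT (fun x => complex.Im (f x) * complex.Re (h x)).
  move=> bh /=; under eq_Rintegral do rewrite Im_mulc.
  by rewrite RintegralD//; [exact: iI|exact: iR].
split.
  rewrite ER//; under eq_fun do rewrite ER//.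
  by apply: cvgB; [exact: dR|exact: dI].
rewrite EI//; under eq_fun do rewrite EI//.
by apply: cvgD; [exact: dI|exact: dR].
Qed.

Definition energy f := Rintegral mu setT (fun x => sqn (f x)).

Lemma energy_ge0 f : 0 <= energy f.
Proof. by apply: Rintegral_ge0 => x _; exact: sqn_ge0. Qed.

Lemma bmeas_sqn f : bmeas f -> rintegrable (fun x => sqn (f x)).
Proof.
move=> [mf [M fM]]; apply: (@rintegrable_bounded _ M); first exact: measurable_sqn.
by move=> x; rewrite ger0_norm ?sqn_ge0.
Qed.

Lemma energy_cst c : energy (fun=> c) = sqn c.
Proof. exact: Rintegral1. Qed.

Lemma energyD f g : bmeas f -> bmeas g ->
  energy (fun x => f x + g x) <= 2 * (energy f + energy g).
Proof.
move=> bf bg; rewrite /energy -RintegralD//; [|exact: bmeas_sqn|exact: bmeas_sqn].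
have i2 := rintegrableD (bmeas_sqn bf) (bmeas_sqn bg).
rewrite -RintegralZl//; apply: le_Rintegral => //.
- exact/bmeas_sqn/bmeasD.
- exact: rintegrableZ.
- by move=> x _; exact: sqnD_le.
Qed.

Lemma energyZ c f : bmeas f -> energy (fun x => c * f x) = sqn c * energy f.
Proof.
move=> bf; rewrite /energy; under eq_Rintegral do rewrite sqnM.
by rewrite RintegralZl//; exact: bmeas_sqn.
Qed.

Lemma le_energyM f g (M : R) : bmeas f -> bmeas g -> (forall x, sqn (g x) <= M) ->
  energy (fun x => f x * g x) <= M * energy f.
Proof.
move=> bf bg gM; rewrite /energy -RintegralZl//; last exact: bmeas_sqn.
apply: le_Rintegral => //.
- exact/bmeas_sqn/bmeasM.
- exact/rintegrableZ/bmeas_sqn.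
- by move=> x _; rewrite sqnM mulrC ler_wpM2r// sqn_ge0.
Qed.

Lemma energy_cesaro_le (u : nat -> X -> R[i]) N (M : R) :
  (forall n, bmeas (u n)) -> (forall n, energy (u n) <= M) -> 0 <= M ->
  energy (fun x => cesaro (u^~ x) N) <= M.
Proof.
move=> bu uM M0; have [->|N0] := posnP N.
  rewrite /energy; under eq_Rintegral do rewrite /cesaro big_ord0 mulr0 sqn0.
  by rewrite Rintegral1.
have bs (n : nat) : rintegrable (fun x => \sum_(i < n) sqn (u i x)).
  elim: n => [|n IH].
    under [X in rintegrable X]eq_fun do rewrite big_ord0.
    by apply: (@rintegrable_bounded _ 0) => // x; rewrite normr0.
  under [X in rintegrable X]eq_fun do rewrite big_ord_recr /=.
  by apply: rintegrableD => //; exact: bmeas_sqn.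
have es (n : nat) : Rintegral mu setT (fun x => \sum_(i < n) sqn (u i x)) <= n%:R * M.
  elim: n => [|n IH].
    by under eq_Rintegral do rewrite big_ord0; rewrite Rintegral1 mul0r.
  under eq_Rintegral do rewrite big_ord_recr /=.
  rewrite RintegralD//; [|exact: bs|exact: bmeas_sqn].
  by rewrite -natr1 mulrDl mul1r; exact: (lerD IH (uM n)).
apply: (@le_trans _ _ (N%:R^-1 * (N%:R * M))); last by rewrite mulKf// pnatr_eq0 -lt0n.
apply: le_trans (ler_wpM2l _ (es N)); last by rewrite invr_ge0.
rewrite -RintegralZl//; last exact: bs.
apply: le_Rintegral => //.
- by apply/bmeas_sqn/bmeasZ/bmeas_sum => n _; exact: bu.
- exact/rintegrableZ/bs.
- by move=> x _; exact: sqn_cesaro_le.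
Qed.

(** The variance of [f] is nonnegative, and expanding it gives the energy minus the squared modulus
    of the integral. *)
Lemma sqn_integral_le f : bmeas f -> sqn (cI f) <= energy f.
Proof.
move=> bf; have [[m1 m2] _] := bf; have [i1 i2] := bmeas_integrable bf.
set a := complex.Re (cI f); set b := complex.Im (cI f).
have : 0 <= energy (fun x => f x - cI f) by exact: energy_ge0.
have -> : energy (fun x => f x - cI f) = energy f - sqn (cI f).
  rewrite /energy.
  have e x : sqn (f x - cI f) = sqn (f x) + (- 2 * a) * complex.Re (f x)
      + (- 2 * b) * complex.Im (f x) + sqn (cI f).
    by rewrite /a /b /sqn; case: (f x) (cI f) => [? ?] [? ?] /=; ring.
  under eq_Rintegral do rewrite e.
  have s := bmeas_sqn bf.
  have z1 := rintegrableZ (- 2 * a) i1; have z2 := rintegrableZ (- 2 * b) i2.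
  have sz1 := rintegrableD s z1; have sz2 := rintegrableD sz1 z2.
  have c : rintegrable (fun=> sqn (cI f)) by apply: (@rintegrable_bounded _ `|sqn (cI f)|).
  rewrite RintegralD// RintegralD// RintegralD// !RintegralZl// Rintegral1.
  have -> : Rintegral mu setT (fun x => complex.Re (f x)) = a by [].
  have -> : Rintegral mu setT (fun x => complex.Im (f x)) = b by [].
  have -> : sqn (cI f) = a ^+ 2 + b ^+ 2 by [].
  ring.
by rewrite subr_ge0.
Qed.

Lemma energy_dominated (F : nat -> X -> R[i]) f (M : R) :
  (forall n, cmeasurable (F n)) -> (forall n x, sqn (F n x) <= M) -> ccvg F f ->
  energy (fun x => F n x - f x) @[n --> \oo] --> 0.
Proof.
move=> mF FM Ff; have [mf fM] := bmeas_lim mF FM Ff.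
have bF n : bmeas (F n) by split => //; exists M.
have bf : bmeas f by split => //; exists M.
have i1 : rintegrable (fun=> 1) by apply: (@rintegrable_bounded _ 1) => // x; rewrite normr1.
have := @rintegral_dominated (fun=> 1) (fun=> 0) (fun n x => sqn (F n x - f x)) (4 * M) i1.
rewrite mulr0 Rintegral1.
have -> : (fun n => Rintegral mu setT (fun x => 1 * sqn (F n x - f x))) =
    (fun n => energy (fun x => F n x - f x)).
  by apply/funext => n; apply: eq_Rintegral => x _; rewrite mul1r.
apply => [n|n x|x].
- by apply: measurable_sqn; case: (bmeasB (bF n) bf).
- rewrite ger0_norm ?sqn_ge0// (le_trans (sqnD_le _ _))// sqnN.
  by have := FM n x; have := fM x; lra.
- by have := ccvg_sqn (x := x) (c := - f x) Ff; rewrite subrr sqn0.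
Qed.

Lemma integral_preserved (T : X -> X) (f : X -> \bar R) :
  measurable_fun setT T -> (forall A, measurable A -> mu (T @^-1` A) = mu A) ->
  measurable_fun setT f -> (\int[mu]_x f (T x) = \int[mu]_x f x)%E.
Proof.
move=> mT Tmu mf.
pose s : {mfun X >-> X} := MeasurableFun.Pack (MeasurableFun.Class (isMeasurableFun.Build _ _ _ _ _ mT)).
have ge0 (g : X -> \bar R) : measurable_fun setT g -> (forall x, 0 <= g x)%E ->
    (\int[mu]_x g (T x) = \int[mu]_x g x)%E.
  move=> mg g0; have := @ge0_integral_pushforward _ _ _ _ R s mT mu setT g measurableT mg (fun x _ => g0 x).
  rewrite preimage_setT => <-; apply: eq_measure_integral => A mA _.
  exact: Tmu.
rewrite [LHS]integralE [RHS]integralE; congr (_ - _)%E.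
  rewrite -(ge0 _ (measurable_funepos mf)) => [|x]; last exact: funepos_ge0.
  by apply: eq_integral => x _; rewrite !funeposE.
rewrite -(ge0 _ (measurable_funeneg mf)) => [|x]; last exact: funeneg_ge0.
by apply: eq_integral => x _; rewrite !funenegE.
Qed.

Lemma complex_integral_preserved (T : X -> X) f :
  measurable_fun setT T -> (forall A, measurable A -> mu (T @^-1` A) = mu A) ->
  cmeasurable f -> cI (fun x => f (T x)) = cI f.
Proof.
move=> mT Tmu [m1 m2]; apply: complex_eq => /=; congr fine.
  exact: (integral_preserved mT Tmu ((measurable_EFinP _ _).2 m1)).
exact: (integral_preserved mT Tmu ((measurable_EFinP _ _).2 m2)).
Qed.

Lemma energy_preserved (T : X -> X) f :
  measurable_fun setT T -> (forall A, measurable A -> mu (T @^-1` A) = mu A) ->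
  cmeasurable f -> energy (fun x => f (T x)) = energy f.
Proof.
move=> mT Tmu mf; congr fine.
exact: (integral_preserved mT Tmu ((measurable_EFinP _ _).2 (measurable_sqn mf))).
Qed.

End ComplexIntegral.

Lemma bmeas_comp d d' (X : measurableType d) (Y : measurableType d') (R : realType)
    (T : X -> Y) (f : Y -> R[i]) :
  measurable_fun setT T -> bmeas f -> bmeas (fun x => f (T x)).
Proof.
move=> mT [[m1 m2] [M fM]]; split; last by exists M.
split.
  exact: (measurableT_comp m1 mT).
exact: (measurableT_comp m2 mT).
Qed.

(** * Joint ergodicity of circle rotations *)

Section TrigClosure.
Context {R : realType}.
Local Notation circ := (circle R).

(** This closure turns out to be the set of all bounded Borel functions, so a property stable under
    both operations extends from characters to them by induction on this predicate. The uniform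
    bound [M] is what dominated convergence asks for. *)
Inductive trig_closure : (circ -> R[i]) -> Prop :=
| trig_character k : trig_closure (character k)
| trig_linear c f g : trig_closure f -> trig_closure g ->
    trig_closure (fun x => c * f x + g x)
| trig_limit (F : nat -> circ -> R[i]) f (M : R) :
    (forall n, trig_closure (F n)) -> (forall n x, sqn (F n x) <= M) ->
    ccvg F f -> trig_closure f.

Lemma bmeas_character k : bmeas (@character R k).
Proof.
split; last by exists 1 => x; rewrite sqn_character.
split; apply: circle_measurable_continuous.
  exact: Re_character_continuous.
exact: Im_character_continuous.
Qed.

Lemma trig_closure_bmeas f : trig_closure f -> bmeas f.
Proof.
elim=> [k|c {}f g _ bf _ bg|F {}f M _ bF FM Ff]; first exact: bmeas_character.
  by apply: bmeasD => //; exact: bmeasZ.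
by have [mf fM] := bmeas_lim (fun n => (bF n).1) FM Ff; split=> //; exists M.
Qed.

Lemma ccvgM (F : nat -> circ -> R[i]) f g : ccvg F f ->
  ccvg (fun n x => F n x * g x) (fun x => f x * g x).
Proof.
move=> Ff x; have [c1 c2] := Ff x; split.
  under eq_fun do rewrite Re_mulc.
  by rewrite Re_mulc; apply: cvgB; apply: cvgMl.
under eq_fun do rewrite Im_mulc.
by rewrite Im_mulc; apply: cvgD; apply: cvgMl.
Qed.

(** Induction on [f] reduces multiplication by a fixed [g] to the case of characters; applied to
    each factor in turn, it gives stability under products. *)
Lemma trig_closure_mull f g : trig_closure f -> bmeas g ->
  (forall k, trig_closure (fun x => character k x * g x)) ->
  trig_closure (fun x => f x * g x).
Proof.
move=> tf bg tg; elim: tf => [//|c {}f h _ IHf _ IHh|F {}f M _ IH FM Ff].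
  have := trig_linear c IHf IHh; congr trig_closure.
  by apply/funext => x; rewrite mulrDl mulrA.
have [N gN] := bg.2.
apply: (trig_limit (F := fun n x => F n x * g x) (M := M * N)) => // [n x|].
  by rewrite sqnM ler_pM ?sqn_ge0.
exact: ccvgM.
Qed.

Lemma trig_closureM f g : trig_closure f -> trig_closure g ->
  trig_closure (fun x => f x * g x).
Proof.
move=> tf tg; apply: trig_closure_mull => //; first exact: trig_closure_bmeas.
move=> k; have := trig_closure_mull tg (bmeas_character k).
under eq_fun do rewrite mulrC; apply => l.
have := trig_character (l + k); congr trig_closure.
by apply/funext => x; rewrite character_addl.
Qed.

Lemma trig_closure_cst c : trig_closure (fun=> c).
Proof.
have := trig_linear (c - 1) (trig_character 0) (trig_character 0).
by congr trig_closure; apply/funext => x; rewrite character0; ring.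
Qed.

Definition rtrig (u : circ -> R) := trig_closure (fun x => (u x)%:C%C).

Lemma rtrig_cst a : rtrig (fun=> a).
Proof. exact: trig_closure_cst. Qed.

Lemma rtrigD u v : rtrig u -> rtrig v -> rtrig (fun x => u x + v x).
Proof.
move=> tu tv; have := trig_linear 1 tu tv; congr trig_closure.
by apply/funext => x; rewrite mul1r rmorphD.
Qed.

Lemma rtrigM u v : rtrig u -> rtrig v -> rtrig (fun x => u x * v x).
Proof.
move=> tu tv; have := trig_closureM tu tv; congr trig_closure.
by apply/funext => x; rewrite rmorphM.
Qed.

Lemma rtrigZ a u : rtrig u -> rtrig (fun x => a * u x).
Proof. by move=> tu; apply: rtrigM => //; exact: rtrig_cst. Qed.

Lemma rtrig_sum n (u : nat -> circ -> R) : (forall i, rtrig (u i)) ->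
  rtrig (fun x => \sum_(i < n) u i x).
Proof.
move=> tu; elim: n => [|n IH].
  by under [X in rtrig X]eq_fun do rewrite big_ord0; exact: rtrig_cst.
by under [X in rtrig X]eq_fun do rewrite big_ord_recr /=; exact: rtrigD.
Qed.

Lemma rtrig_prod n (u : nat -> circ -> R) : (forall i, rtrig (u i)) ->
  rtrig (fun x => \prod_(i < n) u i x).
Proof.
move=> tu; elim: n => [|n IH].
  by under [X in rtrig X]eq_fun do rewrite big_ord0; exact: rtrig_cst.
by under [X in rtrig X]eq_fun do rewrite big_ord_recr /=; exact: rtrigM.
Qed.

Lemma rtrig_limit (U : nat -> circ -> R) u (M : R) : (forall n, rtrig (U n)) ->
  (forall n x, `|U n x| <= M) -> (forall x, U n x @[n --> \oo] --> u x) -> rtrig u.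
Proof.
move=> tU UM Uu; apply: (trig_limit (F := fun n x => (U n x)%:C%C) (M := M ^+ 2)) => //.
  move=> n x; rewrite sqn_real -real_normK ?num_real// lerXn2r ?nnegrE//.
  exact: le_trans (UM n x).
by move=> x; split => /=; [exact: Uu|exact: cvg_cst].
Qed.

Lemma rtrig_Re k : rtrig (fun x => complex.Re (character k x)).
Proof.
have := trig_linear 1 (trig_character k) (trig_character (- k)).
move=> /(trig_linear 2^-1) /(_ (trig_closure_cst 0)); congr trig_closure.
apply/funext => x; rewrite characterN; case: (character k x) => a b.
have -> : (2^-1 : R[i]) = (2^-1 : R)%:C%C by rewrite fmorphV /= rmorph_nat.
by apply: complex_eq => /=; field.
Qed.

Lemma rtrig_Im k : rtrig (fun x => complex.Im (character k x)).
Proof.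
have := trig_linear (-1) (trig_character (- k)) (trig_character k).
move=> /(trig_linear (- 2^-1 * 'i%C)) /(_ (trig_closure_cst 0)); congr trig_closure.
apply/funext => x; rewrite characterN; case: (character k x) => a b.
have -> : (2^-1 : R[i]) = (2^-1 : R)%:C%C by rewrite fmorphV /= rmorph_nat.
by apply: complex_eq => /=; field.
Qed.

(* On [-1, 1] the iterates of this cubic converge to the sign function. *)
Definition sgn_step (t : R) : R := (3 * t - t ^+ 3) / 2.

(** For the cubic q, 1 + q(s) = (1 + s)^2 (2 - s) / 2 and 1 - q(s) = (1 - s)^2 (2 + s) / 2. *)
Lemma sgn_step_iter_bound t n : `|t| <= 1 -> `|iter n sgn_step t| <= 1.
Proof.
move=> t1; elim: n => [//|n /=]; rewrite !ler_norml /sgn_step.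
move: (iter _ _ _) => s /andP[s1 s2].
rewrite ler_pdivlMr// ler_pdivrMr//; apply/andP; split.
  have : 0 <= (s + 1) ^+ 2 * (2 - s) by rewrite mulr_ge0 ?sqr_ge0//; lra.
  nra.
have : 0 <= (1 - s) ^+ 2 * (2 + s) by rewrite mulr_ge0 ?sqr_ge0//; lra.
nra.
Qed.

Lemma sgn_step_iter_pos t : 0 < t -> t <= 1 ->
  iter n sgn_step t @[n --> \oo] --> (1 : R).
Proof.
(* One step multiplies the distance to 1 by (1 - s) (2 + s) / 2 = 1 - (s + s^2) / 2, which is at
   most q as long as s >= t. *)
move=> t0 t1; pose q := 1 - t / 2.
have h n : t <= iter n sgn_step t <= 1 /\ 1 - iter n sgn_step t <= q ^+ n.
  elim: n => [|n] /=; first by rewrite lexx t1 expr0; split=> //; lra.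
  move: (iter _ _ _) => s [/andP[ts s1] sq].
  have e : 1 - sgn_step s = (1 - s) * ((1 - s) * (2 + s) / 2) by rewrite /sgn_step; field.
  have a0 : 0 <= (1 - s) * (2 + s) / 2 by rewrite divr_ge0// mulr_ge0//; lra.
  have a1 : (1 - s) * (2 + s) / 2 <= q.
    by rewrite /q ler_pdivrMr//; nra.
  have le1 : 0 <= 1 - sgn_step s by rewrite e mulr_ge0//; lra.
  have les : 1 - sgn_step s <= 1 - s.
    by rewrite e ler_piMr//; [lra|rewrite (le_trans a1)// /q; lra].
  split; first by apply/andP; split; lra.
  rewrite e exprSr; apply: ler_pM => //; lra.
have q1 : `|q| < 1 by rewrite /q ltr_norml; apply/andP; split; lra.
apply/cvgrPdist_le => e e0.
have /cvgrPdist_le/(_ e e0) := cvg_expr q1.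
apply: filterS => n; rewrite sub0r normrN => qe.
have [/andP[? ?] ?] := h n; rewrite ger0_norm ?subr_ge0//.
by apply: le_trans (le_trans (ler_norm _) qe).
Qed.

Lemma sgn_stepN t : sgn_step (- t) = - sgn_step t.
Proof. by rewrite /sgn_step; field. Qed.

Lemma sgn_step_iter_cvg t : `|t| <= 1 ->
  iter n sgn_step t @[n --> \oo] --> (Num.sg t : R).
Proof.
move=> t1; have [t0|t0|t0] := sgrP t.
- rewrite (_ : (fun n => _) = (fun=> 0)); first exact: cvg_cst.
  by apply/funext; elim=> [|n /=]; [|move=> ->; rewrite /sgn_step !(expr0n,mulr0,subr0,mul0r)].
- by apply: sgn_step_iter_pos => //; move: t1; rewrite gtr0_norm.
- rewrite (_ : (fun n => _) = (fun n => - iter n sgn_step (- t))).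
    apply: cvgN; apply: sgn_step_iter_pos; rewrite ?oppr_gt0//.
    by move: t1; rewrite ltr0_norm.
  by apply/funext; elim=> [|n /= ->]; rewrite ?opprK// sgn_stepN.
Qed.

(** With s the sign of u, a bounded limit of polynomials in u, the indicator is s (s + 1) / 2. *)
Lemma rtrig_gt0 u : rtrig u -> (forall x, `|u x| <= 1) ->
  rtrig (\1_[set x | 0 < u x]).
Proof.
move=> tu u1.
have ts : rtrig (fun x => Num.sg (u x)).
  apply: (@rtrig_limit (fun n x => iter n sgn_step (u x)) _ 1) => [|n x|x].
  - elim=> [//|n IH].
    have e : (fun x => iter n.+1 sgn_step (u x)) = (fun x =>
      3 / 2 * iter n sgn_step (u x) + - 2^-1 * (iter n sgn_step (u x) *
        (iter n sgn_step (u x) * iter n sgn_step (u x)))).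
      by apply/funext => x; rewrite /= /sgn_step; field.
    rewrite e; apply: rtrigD; apply: rtrigZ => //; do 2 apply: rtrigM => //.
  - exact: sgn_step_iter_bound.
  - exact: sgn_step_iter_cvg.
have := rtrigM (rtrigZ 2^-1 ts) (rtrigD ts (rtrig_cst 1)); congr rtrig.
apply/funext => x; rewrite indicE; have [h|h|h] := sgrP (u x).
- by rewrite memNset ?mulr0 ?mul0r//= h ltxx.
- by rewrite mem_set// -[RHS]/(1 : R); field.
- by rewrite memNset ?addNr ?mulr0//= ltNge ltW.
Qed.

Lemma rtrig_indic (A : set circ) : measurable A -> rtrig (\1_A).
Proof.
move: A; apply: circle_measurable_ind => [c t|A tA|F tF].
- pose u x := cos (2 * pi * c) * complex.Re (@character R 1 x) +
               sin (2 * pi * c) * complex.Im (@character R 1 x).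
  have tu : rtrig u by apply: rtrigD; apply: rtrigZ; [exact: rtrig_Re|exact: rtrig_Im].
  (* [normr_Re_le] and [normr_Im_le] bound the coordinates of the character by 2, so |u| <= 4 and
     division by b brings u - t into [-1, 1]. *)
  pose b := 5 + `|t|; have b0 : 0 < b by rewrite /b ltr_wpDr.
  have := rtrig_gt0 (rtrigZ b^-1 (rtrigD tu (rtrig_cst (- t)))).
  have -> : arc c t = [set x | 0 < b^-1 * (u x + - t)].
    by apply/funext => x; rewrite /arc /= pmulr_rgt0 ?invr_gt0// subr_gt0.
  apply => x; rewrite normrM (ger0_norm (x := b^-1)) ?invr_ge0 ?(ltW b0)//.
  rewrite ler_pdivrMl// mulr1 /u /b.
  apply: (le_trans (ler_normB _ _)); rewrite lerD2r.
  apply: (le_trans (ler_normD _ _)); rewrite !normrM.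
  have cs : `|cos (2 * pi * c)| <= 1 by rewrite ler_norml cos_geN1 cos_le1.
  have ss : `|sin (2 * pi * c)| <= 1 by rewrite ler_norml sin_geN1 sin_le1.
  have := @normr_Re_le _ (character 1 x) 1; have := @normr_Im_le _ (character 1 x) 1.
  rewrite sqn_character lexx => /(_ isT) h1 /(_ isT) h2.
  have := normr_ge0 (cos (2 * pi * c)); have := normr_ge0 (sin (2 * pi * c)).
  nra.
- have := rtrigD (rtrig_cst 1) (rtrigZ (-1) tA); congr rtrig.
  apply/funext => x; rewrite !indicE in_setC; case: (x \in A) => /=; ring.
(* The indicator of the union is the limit of those of the finite unions, written as products over
   the complements. *)
- have := @rtrig_limit (fun n x => 1 - \prod_(i < n) (1 - \1_(F i) x)) (\1_(\bigcup_n F n)) 1.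
  have d01 (A : set circ) x : (\1_A x = 0 :> R) \/ (\1_A x = 1 :> R).
    by rewrite indicE; case: (x \in A); [right|left].
  have p01 n x : (\prod_(i < n) (1 - \1_(F i) x) = 0 :> R) \/
      (\prod_(i < n) (1 - \1_(F i) x) = 1 :> R).
    elim: n => [|n]; first by rewrite big_ord0; right.
    rewrite big_ord_recr /= => -[] ->; rewrite ?mul0r ?mul1r; first by left.
    by case: (d01 (F n) x) => ->; rewrite ?subr0 ?subrr; [right|left].
  apply => [n|n x|x].
  + have := rtrigD (rtrig_cst 1) (rtrigZ (-1) (@rtrig_prod n (fun i x => 1 - \1_(F i) x) _)).
    under [X in rtrig X]eq_fun do rewrite mulN1r; apply => i.
    have := rtrigD (rtrig_cst 1) (rtrigZ (-1) (tF i)).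
    by under [X in rtrig X]eq_fun do rewrite mulN1r.
  + by case: (p01 n x) => ->; rewrite ?subr0 ?subrr ?normr0 ?normr1.
  + rewrite indicE; have [xF|xF] := boolP (x \in \bigcup_n F n).
      move: xF; rewrite inE => -[k _ Fk]; apply: cvg_near_cst.
      near=> n; have kn : (k < n)%N by near: n; exact: nbhs_infty_gt.
      rewrite (bigD1 (Ordinal kn))//= indicE mem_set// subrr mul0r subr0//.
    rewrite (_ : (fun n => _) = (fun=> 0)); first exact: cvg_cst.
    apply/funext => n; rewrite big1 ?subrr// => i _; rewrite indicE memNset ?subr0//.
    by move=> Fi; move/negP: xF; apply; rewrite inE; exists (val i).
Unshelve. all: end_near. Qed.

(** The sum counts the naturals below y, hence is the ceiling of y. Truncating y at k makes the
    lower bound inductive. *)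
Lemma count_lt_bound n (y : R) : 0 <= y -> y <= n%:R ->
  y <= \sum_(j < n) (j%:R < y)%R%:R <= y + 1.
Proof.
move=> y0 yn.
have h k : Num.min k%:R y <= \sum_(j < k) (j%:R < y)%R%:R <= y + 1 /\
    \sum_(j < k) (j%:R < y)%R%:R <= k%:R :> R.
  elim: k => [|k [/andP[l r] s]].
    by rewrite big_ord0 lexx ge_min lexx /= addr_ge0.
  rewrite big_ord_recr /= -natr1; move: l r s.
  have [ky|yk] := ltP k%:R y; rewrite /= ?mulr1n ?addr0 => l r s; split; try lra.
    by apply/andP; split; [rewrite ge_min; apply/orP; left|]; lra.
  by apply/andP; split; [rewrite ge_min; apply/orP; right|]; lra.
by have [] := h n; rewrite (min_idPr yn).
Qed.

(** Layer-cake approximation: [U n] is (n + 1) u rounded up and divided by n + 1, an average of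
    indicators of superlevel sets. *)
Lemma rtrig_unit_bounded (u : circ -> R) : measurable_fun setT u ->
  (forall x, 0 <= u x <= 1) -> rtrig u.
Proof.
move=> mu_ u01.
pose U n x : R := n.+1%:R^-1 * \sum_(j < n.+1) \1_[set x | j%:R < n.+1%:R * u x] x.
have bd n x : u x <= U n x <= u x + n.+1%:R^-1.
  have /andP[u0 u1] := u01 x; have n0 : (0 : R) < n.+1%:R by rewrite ltr0n.
  have /andP[] := @count_lt_bound n.+1 (n.+1%:R * u x) (mulr_ge0 (ltW n0) u0) ltac:(by rewrite ler_piMr// (ltW n0)).
  have -> : \sum_(j < n.+1) (j%:R < n.+1%:R * u x)%R%:R =
      \sum_(j < n.+1) \1_[set x | j%:R < n.+1%:R * u x] x :> R.
    apply: eq_bigr => j _; rewrite indicE; congr (nat_of_bool _)%:R.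
    by apply/idP/idP; rewrite inE.
  move=> l r; rewrite /U ler_pdivlMl// ler_pdivrMl// mulrDr mulfV ?gt_eqF//.
  by rewrite l r.
apply: (@rtrig_limit U _ 2) => [n|n x|x].
- apply: rtrigZ; apply: (@rtrig_sum n.+1 (fun j => \1_[set x | j%:R < n.+1%:R * u x])) => j.
  apply: rtrig_indic; rewrite -[X in measurable X]setTI.
  have mnu : measurable_fun setT (fun x => n.+1%:R * u x) by exact: measurable_funM.
  rewrite (_ : [set x | _] = (fun x => n.+1%:R * u x) @^-1` `]j%:R, +oo[%classic).
    by apply: mnu.
  by apply/seteqP; split=> y /=; rewrite in_itv /= andbT.
- have /andP[u0 u1] := u01 x; have /andP[l r] := bd n x.
  have : (n.+1%:R^-1 : R) <= 1 by rewrite invf_le1 ?ler1n// ltr0n.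
  move: (U n x) (n.+1%:R^-1 : R) (u x) l r u0 u1 => a c v l r u0 u1 h.
  by rewrite ger0_norm; lra.
- apply: (@squeeze_cvgr _ _ _ _ (fun=> u x) (fun n => u x + n.+1%:R^-1)).
  + exact: nearW.
  + exact: cvg_cst.
  + rewrite -[X in _ --> X]addr0; apply: cvgD; first exact: cvg_cst.
    exact: cvg_harmonic.
Qed.

(** With [trig_closure_bmeas] this identifies the closure with the bounded Borel functions; an
    affine rescaling of each coordinate reduces to values in [0, 1]. *)
Lemma trig_closure_bmeasE f : bmeas f -> trig_closure f.
Proof.
have rt (u : circ -> R) (M : R) : measurable_fun setT u -> (forall x, `|u x| <= M) -> rtrig u.
  move=> mu_ uM; have M0 : 0 < `|M| + 1 by rewrite ltr_wpDl.
  have : rtrig (fun x => (2 * (`|M| + 1))^-1 * (u x + (`|M| + 1))).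
    apply: rtrig_unit_bounded => [|x].
      by apply: measurable_funM => //; exact: measurable_funD.
    have := le_trans (uM x) (ler_norm M); rewrite ler_norml => /andP[? ?].
    by rewrite mulr_ge0 ?invr_ge0/=; [rewrite ler_pdivrMl ?mulr_gt0//; lra|lra|lra].
  move=> /(rtrigZ (2 * (`|M| + 1))) /rtrigD /(_ (rtrig_cst (- (`|M| + 1)))).
  congr rtrig; apply/funext => x; rewrite mulVKf; first by rewrite addrK.
  by rewrite gt_eqF// mulr_gt0.
move=> [[m1 m2] [M fM]].
have t1 := rt _ (M + 1) m1 (fun x => normr_Re_le (fM x)).
have t2 := rt _ (M + 1) m2 (fun x => normr_Im_le (fM x)).
have := trig_linear 'i%C t2 t1; congr trig_closure; apply/funext => x.
by apply: complex_eq; case: (f x) => a b /=; ring.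
Qed.

End TrigClosure.

(** * From averages of characters to averages of bounded functions *)

Section CircleJointErgodicity.
Context {R : realType}.
Local Notation m := (@circle_measure R).
Implicit Types f g : circle R -> R[i].
Local Notation cI := (complex_integral m).

Let m1 : m setT = 1%E. Proof. exact: probability_setT. Qed.

Lemma phase_half : phase 2^-1 = -1 :> R[i].
Proof.
apply: complex_eq; rewrite /= ?oppr0.
  by rewrite mulrAC mulfV ?mul1r ?cospi.
by rewrite mulrAC mulfV ?mul1r ?sinpi.
Qed.

(** The translation is by 1 / (2 k). Under an invariant measure it forces the integral of the
    character to equal its own opposite. *)
Lemma character_translate_half k : k != 0 -> exists a : circle R,
  forall x, character k (x + a) = - character k x.
Proof.
move=> k0; exists (to_circle (2 * k%:~R)^-1) => x.
rewrite characterD character_to_circle invfM mulrCA mulfV ?intr_eq0// mulr1.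
by rewrite phase_half mulrN1.
Qed.

Lemma eq_oppc_eq0 (z : R[i]) : z = - z -> z = 0.
Proof. by case: z => a b [ha hb]; apply: complex_eq => /=; lra. Qed.

Lemma complex_integral_character k : k != 0 -> cI (character k) = 0.
Proof.
move=> /character_translate_half [a ka]; apply: eq_oppc_eq0.
have bk := @bmeas_character R k.
rewrite -{1}(complex_integral_preserved (circle_measurable_shift a) (circle_measure_shift a) bk.1).
have -> : (fun x => character k (x + a)) = (fun x => -1 * character k x).
  by apply/funext => x; rewrite ka mulN1r.
by rewrite complex_integralZ ?mulN1r//; exact: bmeas_integrable.
Qed.

(** An upper bound says enough here: the sequences concerned are energies, which are nonnegative. *)
Definition tends0 (u : nat -> R) := forall e, 0 < e -> \forall N \near \oo, u N < e.

Lemma bmeas_shift (f : circle R -> R[i]) (a : circle R) :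
  bmeas f -> bmeas (fun x : circle R => f (x + a)).
Proof. by move=> bf; apply: bmeas_comp => //; exact: circle_measurable_shift. Qed.

Section Slot.
Variables (t : nat -> circle R) (r : nat -> circle R -> R[i]) (B : R) (rho : R[i]).
Hypotheses (mr : forall n, bmeas (r n)) (rB : forall n x, sqn (r n x) <= B).

(** One function [f] varies, while the other factors are frozen in the uniformly bounded [r] and the
    product of their integrals in [rho]; the deviation is then linear in [f]. *)
Definition slot_deviation f N x :=
  cesaro (fun n => f (x + t n) * r n x) N - cI f * rho.

Let B0 : 0 <= B. Proof. exact: le_trans (sqn_ge0 _) (rB 0 0). Qed.

Lemma bmeas_cesaro (u : nat -> circle R -> R[i]) N : (forall n, bmeas (u n)) ->
  bmeas (fun x => cesaro (u^~ x) N).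
Proof. by move=> bu; apply: bmeasZ; apply: bmeas_sum. Qed.

Lemma bmeas_slot f n : bmeas f -> bmeas (fun x : circle R => f (x + t n) * r n x).
Proof. by move=> bf; apply: bmeasM => //; exact: bmeas_shift. Qed.

Lemma bmeas_slot_deviation f N : bmeas f -> bmeas (slot_deviation f N).
Proof.
move=> bf; apply: bmeasB; last exact: bmeas_cst.
by apply: bmeas_cesaro => n; exact: bmeas_slot.
Qed.

Lemma slot_deviationD f g N x : bmeas f -> bmeas g ->
  slot_deviation (fun x => f x + g x) N x = slot_deviation f N x + slot_deviation g N x.
Proof.
move=> bf bg; rewrite /slot_deviation complex_integralD; [|exact: bmeas_integrable|exact: bmeas_integrable].
rewrite /cesaro (eq_bigr (fun n : 'I_N => f (x + t n) * r n x + g (x + t n) * r n x)).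
  by rewrite big_split /= mulrDr; ring.
by move=> n _; rewrite mulrDl.
Qed.

Lemma slot_deviationZ c f N x : bmeas f ->
  slot_deviation (fun x => c * f x) N x = c * slot_deviation f N x.
Proof.
move=> bf; rewrite /slot_deviation complex_integralZ; last exact: bmeas_integrable.
rewrite /cesaro (eq_bigr (fun n : 'I_N => c * (f (x + t n) * r n x))).
  by rewrite -mulr_sumr; ring.
by move=> n _; rewrite mulrA.
Qed.

(** The bound is uniform in N, because translations preserve the energy of [f] and [r] is bounded.
    This allows [f] to be approximated before N tends to infinity. *)
Lemma energy_slot_deviation_le f N : bmeas f ->
  energy m (slot_deviation f N) <= 2 * (B + sqn rho) * energy m f.
Proof.
move=> bf; rewrite /slot_deviation.
have bc : bmeas (fun x : circle R => cesaro (fun n => f (x + t n) * r n x) N).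
  by apply: bmeas_cesaro => n; exact: bmeas_slot.
apply: (le_trans (energyD m1 bc (bmeas_cst _ (- (cI f * rho))))).
rewrite -mulrA ler_pM2l// mulrDl lerD//.
  apply: (energy_cesaro_le m1) => [n|n|].
  - exact: bmeas_slot.
  - rewrite -(energy_preserved (circle_measurable_shift (t n)) (circle_measure_shift (t n)) bf.1).
    by apply: (le_energyM m1); [exact: bmeas_shift|exact: mr|exact: rB].
  - by rewrite mulr_ge0// energy_ge0.
rewrite energy_cst// sqnN sqnM mulrC ler_wpM2l ?sqn_ge0//.
exact: sqn_integral_le.
Qed.

Lemma slot_deviation_tends0 :
  (forall k, tends0 (fun N => energy m (slot_deviation (character k) N))) ->
  forall f, bmeas f -> tends0 (fun N => energy m (slot_deviation f N)).
Proof.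
move=> hk f /trig_closure_bmeasE; elim=> [//|c {}f g tf IHf tg IHg|F {}f M tF IH FM Ff].
  have bf := trig_closure_bmeas tf; have bg := trig_closure_bmeas tg.
  move=> e e0; have e1 : 0 < e / (4 * (sqn c + 1)).
    by rewrite divr_gt0// mulr_gt0// ltr_wpDl// sqn_ge0.
  have e2 : 0 < e / 4 by rewrite divr_gt0.
  near=> N.
  have h1 : energy m (slot_deviation f N) < e / (4 * (sqn c + 1)) by near: N; exact: IHf.
  have h2 : energy m (slot_deviation g N) < e / 4 by near: N; exact: IHg.
  have -> : slot_deviation (fun x => c * f x + g x) N =
      fun x => c * slot_deviation f N x + slot_deviation g N x.
    apply/funext => x; rewrite -slot_deviationZ//.
    by apply: slot_deviationD => //; exact: bmeasZ.
  have bdf := bmeas_slot_deviation N bf.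
  apply: (le_lt_trans (energyD m1 (bmeasZ _ bdf) (bmeas_slot_deviation N bg))).
  rewrite energyZ//; move: h1; rewrite ltr_pdivlMr ?mulr_gt0 ?ltr_wpDl ?sqn_ge0//.
  have := energy_ge0 m (slot_deviation f N); have := sqn_ge0 c; nra.
have bF n := trig_closure_bmeas (tF n).
have bf : bmeas f by apply: trig_closure_bmeas; exact: trig_limit Ff.
(* After the factor 2 of [energyD], the remainder contributes at most 4 (B + |rho|^2) e / K < e / 2
   and the approximant less than e / 4. *)
move=> e e0; pose K := 8 * (B + sqn rho) + 1.
have K0 : 0 < K by rewrite /K ltr_wpDl// mulr_ge0// addr_ge0// sqn_ge0.
have eK : 0 < e / K by rewrite divr_gt0.
have [n _ hn] : exists2 n, True & energy m (fun x => F n x - f x) < e / K.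
  have /cvgrPdist_lt/(_ _ eK) := energy_dominated m1 (fun n => (bF n).1) FM Ff.
  case=> n _ /(_ n (leqnn n)) /=; rewrite sub0r normrN => h; exists n => //.
  exact: le_lt_trans (ler_norm _) h.
have e4 : 0 < e / 8 by rewrite divr_gt0.
near=> N.
have h1 : energy m (slot_deviation (F n) N) < e / 8 by near: N; exact: IH.
have bD : bmeas (fun x => f x - F n x) by exact: bmeasB.
have -> : slot_deviation f N =
    fun x => slot_deviation (F n) N x + slot_deviation (fun x => f x - F n x) N x.
  apply/funext => x; rewrite -slot_deviationD//; congr slot_deviation.
  by apply/funext => y; ring.
apply: (le_lt_trans (energyD m1 (bmeas_slot_deviation N (bF n)) (bmeas_slot_deviation N bD))).
have := energy_slot_deviation_le N bD.
have -> : energy m (fun x => f x - F n x) = energy m (fun x => F n x - f x).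
  by rewrite /energy; under eq_Rintegral do rewrite sqnC.
move: hn; rewrite ltr_pdivlMr// /K.
have := energy_ge0 m (fun x => F n x - f x); move: (energy m (fun x => F n x - f x)) => E0.
move: (energy m _) (energy m _) h1 => E1 E2 h1 E0_ge0 h3 h2; lra.
Unshelve. all: end_near. Qed.

End Slot.

Section Slots.
Variables (l : nat) (t : 'I_l -> nat -> circle R).

Definition deviation (F : 'I_l -> circle R -> R[i]) N x :=
  cesaro (fun n => \prod_(i < l) F i (x + t i n)) N - \prod_(i < l) cI (F i).

Hypothesis weyl : forall d : 'I_l -> int, (exists i, d i != 0) ->
  cesaro_null (fun n => \prod_(i < l) character (d i) (t i n)).

(** For characters the point splits off: the average is a null Weyl mean times a unimodular function
    of x, and the product of integrals is 0. When every [d i] vanishes, both terms are 1 once N >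
    0. *)
Lemma deviation_character_tends0 (d : 'I_l -> int) :
  tends0 (fun N => energy m (deviation (fun i => character (d i)) N)).
Proof.
have [[i di]|d0] := pselect (exists i, d i != 0).
  move=> e e0; near=> N.
  have -> : deviation (fun i => character (d i)) N = fun x =>
      (cesaro (fun n => \prod_(i < l) character (d i) (t i n)) N) *
      \prod_(i < l) character (d i) x.
    apply/funext => x; rewrite /deviation.
    rewrite (bigD1 (F := fun i => cI _) i)//= complex_integral_character// mul0r subr0.
    rewrite /cesaro -mulrA mulr_suml; congr (_ * _); apply: eq_bigr => n _.
    rewrite mulrC -big_split /=; apply: eq_bigr => j _; exact: characterD.
  have bp : bmeas (fun x => \prod_(i < l) @character R (d i) x).
    by apply: bmeas_prod => j _; exact: bmeas_character.
  have -> : energy m (fun x => cesaro (fun n => \prod_(i < l) character (d i) (t i n)) N *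
      \prod_(i < l) character (d i) x) =
      sqn (cesaro (fun n => \prod_(i < l) character (d i) (t i n)) N).
    rewrite energyZ// /energy; under eq_Rintegral.
      move=> x _; have -> : sqn (\prod_(i < l) character (d i) x) = 1.
        by elim/big_ind : _ => [|a b a1 b1|j _]; rewrite ?sqn1 ?sqn_character ?sqnM ?a1 ?b1 ?mulr1.
      over.
    by rewrite (Rintegral1 m1) mulr1.
  by near: N; apply: weyl => //; exists i.
have dE i : d i = 0 by apply/eqP/negPn/negP => di; apply: d0; exists i.
move=> e e0; near=> N; rewrite (_ : deviation _ N = fun=> 0).
  by rewrite (energy_cst m1) sqn0.
have c0 : @character R 0 = fun=> 1 by apply/funext => x; rewrite character0.
apply/funext => x; rewrite /deviation [X in _ - X]big1; last first.
  by move=> i _; rewrite dE c0 complex_integral_cst.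
rewrite /cesaro (eq_bigr (fun=> 1)); last first.
  by move=> n _; rewrite big1// => i _; rewrite dE c0.
rewrite sumr_const card_ord mulVf ?subrr// pnatr_eq0 -lt0n.
by near: N; exact: nbhs_infty_gt.
Unshelve. all: end_near. Qed.

Lemma deviation_tends0 (f : 'I_l -> circle R -> R[i]) : (forall i, bmeas (f i)) ->
  tends0 (fun N => energy m (deviation f N)).
Proof.
(* Hybrid induction: the functions of index below k are arbitrary and the others are characters, so
   each increase of k releases one more slot. *)
suff h k : (k <= l)%N -> forall f : 'I_l -> circle R -> R[i], (forall i, bmeas (f i)) ->
    (forall i : 'I_l, (k <= i)%N -> exists d, f i = character d) ->
    tends0 (fun N => energy m (deviation f N)).
  move=> bf; apply: (h l) => // i; rewrite leqNgt ltn_ord//.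
elim: k => [_ {}f _ fd|k IH kl {}f bf fd].
  have /choice [d df] : forall i, exists d, f i = character d by move=> i; exact: fd.
  have -> : f = fun i => character (d i) by apply/funext => i; rewrite df.
  exact: deviation_character_tends0.
pose i0 := Ordinal kl.
pose upd g i := if i == i0 then g else f i.
pose r n x := \prod_(i < l | i != i0) f i (x + t i n).
pose rho := \prod_(i < l | i != i0) cI (f i).
have dE g : deviation (upd g) = slot_deviation (t i0) r rho g.
  apply/funext => N; apply/funext => x; rewrite /deviation /slot_deviation.
  congr (_ - _); last first.
    rewrite (bigD1 i0)//= /upd eqxx; congr (_ * _).
    by apply: eq_bigr => i /negPf ->.
  congr cesaro; apply/funext => n; rewrite (bigD1 i0)//= {1}/upd eqxx; congr (_ * _).
  by apply: eq_bigr => i i0i; rewrite /upd (negPf i0i).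
have -> : f = upd (f i0).
  by apply/funext => i; rewrite /upd; case: eqP => // ->.
have /choice[M fM] : forall i, exists M : R, forall x, sqn (f i x) <= M.
  by move=> i; exact: (bf i).2.
rewrite dE; apply: (@slot_deviation_tends0 _ _ (\prod_(i < l | i != i0) M i)) => //.
- by move=> n; apply: bmeas_prod => i _; exact: bmeas_shift.
- move=> n x; rewrite /r (big_morph _ (@sqnM R) sqn1).
  by apply: ler_prod => i _; rewrite sqn_ge0 fM.
- move=> d; rewrite -dE; apply: IH; first exact: ltnW.
    by move=> i; rewrite /upd; case: eqP => _ //; exact: bmeas_character.
  move=> i ki; rewrite /upd; case: eqP => [_|ii0]; first by exists d.
  apply: fd; rewrite ltn_neqAle ki andbT; apply/eqP => kE; apply: ii0.
  exact/val_inj.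
Qed.

End Slots.

End CircleJointErgodicity.

(** * Passage from essentially bounded to bounded functions *)

Section BoundedRepresentative.
Context d (X : measurableType d) (R : realType).
Variable mu : {measure set X -> \bar R}.
Hypothesis mu1 : mu setT = 1%E.
Implicit Types f g : X -> R[i].
Local Notation cI := (complex_integral mu).

Lemma Lfun_measurable p (u : X -> R) : u \in Lfun mu p -> measurable_fun setT u.
Proof. by rewrite inE => /andP[]; rewrite inE. Qed.

Lemma complex_Lfun_measurable p f : complex_Lfun mu p f -> cmeasurable f.
Proof. by move=> [/Lfun_measurable m1 /Lfun_measurable m2]. Qed.

Lemma Lfun_pinfty_bound (u : X -> R) : u \in Lfun mu +oo%E ->
  exists2 M : R, 0 <= M & {ae mu, forall x, `|u x| <= M}.
Proof.
rewrite inE => /andP[_]; rewrite inE /= /finite_norm unlock mu1 lte01.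
have := ess_sup_inf.ess_sup_ge mu (abse \o (EFin \o u)); case: ess_sup_inf.ess_sup => [r h _|//|h _].
  exists `|r| => //; apply: filterS h => x /=; rewrite lee_fin => /le_trans; apply.
  exact: ler_norm.
by exists 0 => //; apply: filterS h => x /=; rewrite leeNy_eq.
Qed.

(** Truncating both coordinates at their essential bounds alters [f] only on a null set. *)
Lemma bounded_representative f : complex_Lfun mu +oo%E f ->
  exists2 g, bmeas g & {ae mu, forall x, f x = g x}.
Proof.
move=> Lf; have [m1 m2] := complex_Lfun_measurable Lf.
have [/Lfun_pinfty_bound[M M0 fM] /Lfun_pinfty_bound[N N0 fN]] := Lf.
pose clamp (B t : R) := Num.max (- B) (Num.min t B).
have clampE B t : `|t| <= B -> clamp B t = t.
  by rewrite ler_norml => /andP[Bt tB]; rewrite /clamp (min_idPl tB) (max_idPr Bt).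
have clamp_le B t : 0 <= B -> clamp B t ^+ 2 <= B ^+ 2.
  move=> B0; rewrite -real_normK ?num_real// lerXn2r ?nnegrE//.
  rewrite /clamp ler_norml le_max lexx /= ge_max ge_min lexx orbT andbT.
  by rewrite (le_trans _ B0)// oppr_le0.
have mclamp B (u : X -> R) : measurable_fun setT u -> measurable_fun setT (fun x => clamp B (u x)).
  by move=> mu_; apply: measurable_maxr => //; exact: measurable_minr.
exists (fun x => (clamp M (complex.Re (f x)) +i* clamp N (complex.Im (f x)))%C).
  split; first by split; exact: mclamp.
  by exists (M ^+ 2 + N ^+ 2) => x; rewrite /sqn /= lerD// clamp_le.
by apply: filterS2 fM fN => x hM hN; apply: complex_eq; rewrite /= clampE.
Qed.

Lemma eq_ae_complex_integral f g : cmeasurable f -> cmeasurable g ->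
  {ae mu, forall x, f x = g x} -> cI f = cI g.
Proof.
move=> [f1 f2] [g1 g2] fg; apply: complex_eq => /=; congr fine.
  apply: ae_eq_integral => //; [exact/measurable_EFinP|exact/measurable_EFinP|].
  by apply: filterS fg => x /= ->.
apply: ae_eq_integral => //; [exact/measurable_EFinP|exact/measurable_EFinP|].
by apply: filterS fg => x /= ->.
Qed.

Lemma ae_preserved (T : X -> X) (P : X -> Prop) : measurable_fun setT T ->
  (forall A, measurable A -> mu (T @^-1` A) = mu A) ->
  {ae mu, forall x, P x} -> {ae mu, forall x, P (T x)}.
Proof.
move=> mT Tmu [A [mA A0 PA]]; exists (T @^-1` A); split.
- by rewrite -[X in measurable X]setTI; exact: mT.
- by rewrite Tmu.
- by move=> x /= nP; exact: PA.
Qed.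

Lemma ae_forall_ord l (P : 'I_l -> X -> Prop) :
  (forall i, {ae mu, forall x, P i x}) -> {ae mu, forall x, forall i, P i x}.
Proof.
move=> aP; have : {ae mu, forall x, forall k (kl : (k < l)%N), P (Ordinal kl) x}.
  apply: ae_foralln => k; have [kl|lk] := pselect (k < l)%N.
    by apply: filterS (aP (Ordinal kl)) => x Px kl'; rewrite (bool_irrelevance kl' kl).
  by apply: aeW => x kl; case: lk.
by apply: filterS => x Px [k kl]; exact: Px.
Qed.

Lemma Lnorm2_normcE f :
  'N[mu]_2%:E[(fun x => (ComplexField.Normc.normc (f x))%:E)]%E =
  ((\int[mu]_x (sqn (f x))%:E) `^ 2^-1)%E.
Proof.
rewrite unlock /Lnorm; congr (_ `^ _)%E; apply: eq_integral => x _.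
rewrite /= powR_mulrn ?normr_ge0//.
by rewrite real_normK ?num_real// -sqn_normc.
Qed.

Lemma Lnorm2_normc f : bmeas f ->
  'N[mu]_2%:E[(fun x => (ComplexField.Normc.normc (f x))%:E)]%E = (Num.sqrt (energy mu f))%:E.
Proof.
move=> bf; rewrite Lnorm2_normcE (_ : (\int[mu]_x _)%E = (energy mu f)%:E).
  by rewrite poweR_EFin powR12_sqrt// energy_ge0.
by rewrite /energy /Rintegral fineK//; exact: (integrable_fin_num _ (bmeas_sqn mu1 bf)).
Qed.

End BoundedRepresentative.

Section RotationsJointlyErgodic.
Context {R : realType}.
Local Notation m := (@circle_measure R).

(** The index n + 1 in the first hypothesis appears because [multiple_average] runs over 1, ..., N
    and [cesaro] over 0, ..., N - 1. *)
Lemma rotations_jointly_ergodic l (S : 'I_l -> bijection (circle R))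
    (p : 'I_l -> {poly int}) (t : 'I_l -> nat -> circle R) :
  (forall i n x, zexpg (S i) (p i).[n.+1%:Z] x = x + t i n) ->
  (forall d : 'I_l -> int, (exists i, d i != 0) ->
    cesaro_null (fun n => \prod_(i < l) character (d i) (t i n))) ->
  jointly_ergodic m S p.
Proof.
move=> St weyl f Lf.
have m1 : m setT = 1%E by exact: probability_setT.
have /choice [g gP] : forall i, exists g, bmeas g /\ {ae m, forall x, f i x = g x}.
  by move=> i; have [g bg fg] := bounded_representative m1 (Lf i); exists g.
have bg i : bmeas (g i) := (gP i).1.
have cfg : \prod_(i < l) complex_integral m (f i) = \prod_(i < l) complex_integral m (g i).
  apply: eq_bigr => i _; apply: eq_ae_complex_integral; last exact: (gP i).2.
    exact: complex_Lfun_measurable (Lf i).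
  exact: (bg i).1.
have aefg : {ae m, forall x, forall n i, f i (x + t i n) = g i (x + t i n)}.
  apply: ae_foralln => n; apply: ae_forall_ord => i.
  exact: (ae_preserved (circle_measurable_shift (t i n))
    (circle_measure_shift (t i n)) (gP i).2).
have bdev N : bmeas (deviation t g N).
  apply: bmeasB; last exact: bmeas_cst.
  apply: bmeasZ; apply: bmeas_sum => n _; apply: bmeas_prod => i _.
  exact: bmeas_shift.
have avE N x : multiple_average S p f N x = cesaro (fun n => \prod_(i < l) f i (x + t i n)) N.
  rewrite /multiple_average /cesaro; congr (_ * _).
  rewrite big_add1 /= big_mkord; apply: eq_bigr => n _; apply: eq_bigr => i _.
  by rewrite St.
have mdev N : cmeasurable (fun x => multiple_average S p f N x - \prod_(i < l) complex_integral m (f i)).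
  under eq_fun do rewrite avE.
  apply: cmeasurableD; last exact: cmeasurable_cst.
  apply: cmeasurableM; first exact: cmeasurable_cst.
  apply: cmeasurable_sum => n; apply: cmeasurable_prod => i.
  have [f1 f2] := complex_Lfun_measurable (Lf i).
  split; first exact: (measurableT_comp f1 (circle_measurable_shift _)).
  exact: (measurableT_comp f2 (circle_measurable_shift _)).
rewrite (_ : (fun N => _) = EFin \o (fun N => Num.sqrt (energy m (deviation t g N)))); last first.
  apply/funext => N; rewrite /= -Lnorm2_normc// !Lnorm2_normcE; congr (_ `^ _)%E.
  apply: ge0_ae_eq_integral => //.
  - exact/measurable_EFinP/measurable_sqn.
  - exact/measurable_EFinP/measurable_sqn/(bdev N).1.
  - by move=> x _; rewrite lee_fin sqn_ge0.
  - by move=> x _; rewrite lee_fin sqn_ge0.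
  apply: filterS aefg => x fgx _; rewrite avE cfg /deviation; congr (sqn (cesaro _ _ - _))%:E.
  by apply/funext => n; apply: eq_bigr => i _.
apply: cvg_EFin; first exact: nearW.
apply/cvgrPdist_lt => e e0; near=> N.
rewrite /= sub0r normrN ger0_norm ?sqrtr_ge0// -[ltRHS]ger0_norm ?ltW// -sqrtr_sqr.
rewrite ltr_sqrt ?exprn_gt0//; near: N.
by apply: deviation_tends0 => //; rewrite exprn_gt0.
Unshelve. all: end_near. Qed.

End RotationsJointlyErgodic.

(** * Skew shifts and their Kronecker factor *)

Section SkewMaps.
Context {R : realType}.
Local Notation m := (@circle_measure R).
Local Notation mu := (@torus_measure R).

Lemma torus_measureT : mu setT = 1%E.
Proof.
have m1 : m setT = 1%E by exact: probability_setT.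
transitivity (m setT * m setT)%E; last by rewrite m1 mule1.
by rewrite -setXTT; exact: (product_measure1E m m measurableT measurableT).
Qed.

Lemma character1M (x : circle R) k : character 1 (x *~ k) = character k x.
Proof.
have [t ->] := to_circleP x; rewrite -raddfMz !character_to_circle.
by rewrite mul1r -mulrzl.
Qed.

(** Arcs generate the Borel sets of the circle and are defined through [character 1] alone. *)
Lemma measurable_into_circle d (X : measurableType d) (T : X -> circle R) :
  cmeasurable (fun x => character 1 (T x)) -> measurable_fun setT T.
Proof.
move=> [m1 m2] _ A; rewrite setTI; move: A.
apply: circle_measurable_ind => [c t|A mA|F mF].
- rewrite -[X in measurable X]setTI.
  pose u x := cos (2 * pi * c) * complex.Re (character 1 (T x)) +
              sin (2 * pi * c) * complex.Im (character 1 (T x)).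
  have mu_ : measurable_fun setT u.
    by apply: measurable_funD; apply: measurable_funM.
  rewrite (_ : T @^-1` arc c t = u @^-1` `]t, +oo[%classic); first exact: mu_.
  by apply/seteqP; split=> x; rewrite /= in_itv /= andbT.
- by rewrite preimage_setC; exact: measurableC.
- by rewrite preimage_bigcup; exact: bigcupT_measurable.
Qed.

(** The maps of the example have k = 1; k = 0 gives translations, and the other values occur among
    their powers. *)
Definition skew (k : int) (a b : circle R) (z : torus R) : torus R :=
  (z.1 + a, z.2 + z.1 *~ k + b).

Lemma bmeas_character_fst k : bmeas (fun z : torus R => character k z.1).
Proof. by apply: (bmeas_comp (T := fst)); [exact: measurable_fst|exact: bmeas_character]. Qed.

Lemma bmeas_character_snd k : bmeas (fun z : torus R => character k z.2).
Proof. by apply: (bmeas_comp (T := snd)); [exact: measurable_snd|exact: bmeas_character]. Qed.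

Lemma measurable_skew k a b : measurable_fun setT (skew k a b).
Proof.
apply/measurable_fun_pairP; split.
  exact: (measurableT_comp (circle_measurable_shift a) measurable_fst).
apply: measurable_into_circle.
rewrite (_ : (fun z => _) = (fun z : torus R =>
    character 1 z.2 * character k z.1 * character 1 b)).
  exact: (bmeasM (bmeasM (bmeas_character_snd 1) (bmeas_character_fst k))
    (bmeas_cst _ (character 1 b))).1.
by apply/funext => z; rewrite /skew /= !characterD character1M.
Qed.

(** Uniqueness of the product measure reduces this to rectangles, where each nonempty fibre of the
    preimage is a translate of the vertical side. *)
Lemma skew_preserving k a b (A : set (torus R)) : measurable A ->
  mu (skew k a b @^-1` A) = mu A.
Proof.
move=> mA; have ms := measurable_skew k a b.
pose s : {mfun torus R >-> torus R} := MeasurableFun.Pack (MeasurableFun.Class (isMeasurableFun.Build _ _ _ _ _ ms)).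
apply/esym; apply: (@product_measure_unique _ _ _ _ R m m (pushforward mu s)) => // B C mB mC.
transitivity ((\int[m]_x ((\1_((fun x => x + a) @^-1` B) x)%:E * m C))%E).
  rewrite /pushforward /torus_measure /product_measure1 /=.
  apply: eq_integral => x _; rewrite indicE /=.
  have [xB|xB] := pselect (B (x + a)).
    rewrite mem_set// mul1e -(circle_measure_shift (x *~ k + b) mC); congr (m _).
    by apply/seteqP; split=> y; rewrite xsectionE /= /skew /= addrA => //= -[].
  rewrite memNset// mul0e; apply: etrans (measure0 m); congr (m _).
  by apply/seteqP; split=> y //; rewrite xsectionE /= /skew /= => -[].
have mB' : measurable ((fun x : circle R => x + a) @^-1` B).
  by rewrite -[X in measurable X]setTI; exact: circle_measurable_shift.
rewrite ge0_integralZr//; last by apply/measurable_EFinP; exact: measurable_indic.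
rewrite integral_indic// setIT; congr (_ * _)%E.
exact: (circle_measure_shift a mB).
Qed.

End SkewMaps.

(** * Fibre integrals and uniqueness from rectangles *)

Section TorusUniqueness.
Context {R : realType}.
Local Notation m := (@circle_measure R).
Local Notation mu := (@torus_measure R).
Local Notation ri := (rintegrable mu).

Let m1 : m setT = 1%E. Proof. exact: probability_setT. Qed.
Let mu1 : mu setT = 1%E. Proof. exact: torus_measureT. Qed.

Lemma rintegrable_measurable d (X : measurableType d) (nu : {measure set X -> \bar R})
  (u : X -> R) : rintegrable nu u -> measurable_fun setT u.
Proof. by move=> iu; apply/measurable_EFinP; exact: (measurable_int nu). Qed.

(** For integrable [u], a version of its conditional expectation on the first coordinate; on the
    null set of fibres where [u] is not integrable the value is a mere default. *)
Definition fiber_integral (u : torus R -> R) (x : circle R) : R :=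
  Rintegral m setT (fun y => u (x, y)).

Lemma rintegrable_fiber_integral u : ri u -> rintegrable m (fiber_integral u).
Proof.
move=> iu; have iF := integrable_fubini_F (m1 := m) (m2 := m) (f := EFin \o u) iu.
apply: (le_integrable measurableT _ _ iF).
  apply/measurable_EFinP; apply: (@measurableT_comp _ _ _ _ _ _ fine) => //.
  exact: measurable_int iF.
have le_fine (z : \bar R) : (`|(fine z)%:E| <= `|z|)%E by case: z => //=; rewrite leey.
by move=> x _; exact: le_fine.
Qed.

Lemma Rintegral_fiber u : ri u ->
  Rintegral mu setT u = Rintegral m setT (fiber_integral u).
Proof.
move=> iu; congr fine.
have iF := integrable_fubini_F (m1 := m) (m2 := m) (f := EFin \o u) iu.
rewrite -[LHS](integral12_prod_meas1 (m1 := m) (m2 := m) (f := EFin \o u) iu).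
have iv := rintegrable_fiber_integral iu.
apply: ae_eq_integral => //; [exact: measurable_int iF|exact: measurable_int iv|].
have := integrable_ae measurableT iF; apply: filterS => x /(_ Logic.I) h _.
exact: esym (fineK h).
Qed.

Lemma rintegrable_fst (v : circle R -> R) : rintegrable m v -> ri (fun z => v z.1).
Proof.
move=> iv; have mv := rintegrable_measurable iv.
have mv' : measurable_fun setT (EFin \o (fun z : torus R => v z.1)).
  by apply/measurable_EFinP; apply: measurableT_comp => //; exact: measurable_fst.
apply: (integrable12ltyP m m mv').2.
have c x : (\int[m]_y `|(v x)%:E| = `|(v x)%:E|)%E.
  by rewrite integral_cst// -[RHS]mule1; congr (_ * _)%E; exact: m1.
under eq_integral do rewrite c.
by case/integrableP : iv.
Qed.

(** Rectangles are stable under intersection and generate the sigma-algebra, and the sets over which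
    [w] integrates to 0 form a Dynkin system. *)
Lemma measure_rectangle_zero_ae (w : torus R -> R) : ri w ->
  (forall A B, measurable A -> measurable B ->
    Rintegral mu setT (fun z => w z * (\1_A z.1 * \1_B z.2)) = 0) ->
  {ae mu, forall z, w z = 0}.
Proof.
move=> iw wAB; have mw := rintegrable_measurable iw.
have iwE E : measurable E -> mu.-integrable E (EFin \o w).
  by move=> mE; apply: (integrableS measurableT).
suff h E : measurable E -> (\int[mu]_(z in E) (w z)%:E = 0)%E.
  have := @integral_ae_eq _ _ R mu setT measurableT (fun=> 0%E) (EFin \o w) iw.
  move=> /(_ (measurable_cst _)) e.
  have : ae_eq mu setT (EFin \o w) (fun=> 0%E).
    by apply: e => E _ mE; rewrite h// integral0.
  by apply: filterS => z /(_ Logic.I) [].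
rewrite measurable_prod_measurableType.
move: E; apply: (dynkin_induction (G := [set A `*` B | A in measurable & B in measurable])).
- exact: measurable_prod_measurableType.
- move=> _ _ [A mA [B mB <-]] [C mC [D mD <-]]; rewrite -setXI.
  by exists (A `&` C); [exact: measurableI|exists (B `&` D) => //; exact: measurableI].
- have := wAB _ _ measurableT measurableT.
  under eq_Rintegral do rewrite !indicT mulr1 mulr1.
  by move=> h; rewrite -(fineK (integrable_fin_num measurableT iw)); congr EFin.
- move=> _ [A mA [B mB <-]]; have := wAB A B mA mB.
  have mAB : measurable (A `*` B) by exact: measurableX.
  rewrite (_ : Rintegral _ _ _ = Rintegral mu (A `*` B) w).
    by move=> h; rewrite -(fineK (integrable_fin_num mAB (iwE _ mAB))); congr EFin.
  rewrite [RHS]Rintegral_mkcond; apply: eq_Rintegral => z _.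
  rewrite patchE !indicE; have [zAB|zAB] := boolP (z \in A `*` B).
    by move: zAB; rewrite inE => -[? ?]; rewrite !mem_set// mulr1 mulr1.
  have [zA|zA] := boolP (z.1 \in A); last by rewrite mul0r mulr0.
  have [zB|zB] := boolP (z.2 \in B); last by rewrite mulr0 mulr0.
  by exfalso; move/negP: zAB; apply; rewrite inE; split; apply/set_mem.
- move=> E mE E0.
  have := @integral_setU _ _ R mu E (~` E) (EFin \o w) mE (measurableC mE).
  rewrite setUv E0 add0e => <-.
  + have := wAB _ _ measurableT measurableT.
    under eq_Rintegral do rewrite !indicT mulr1 mulr1.
    by move=> h; rewrite -(fineK (integrable_fin_num measurableT iw)); congr EFin.
  + exact/measurable_EFinP.
  + by rewrite disj_set2E setICr.
- move=> F mF tF F0; rewrite integral_bigcup//.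
    by rewrite eseries0.
  by apply: iwE; exact: bigcupT_measurable.
Qed.

Lemma bmeas_indic d (X : measurableType d) (A : set X) : measurable A ->
  bmeas (fun x => (\1_A x : R)%:C%C).
Proof.
move=> mA; split; last first.
  exists 1 => x; rewrite sqn_real indicE; case: (x \in A) => /=; rewrite ?expr1n ?expr0n//.
split; last exact: measurable_cst.
exact: measurable_indic.
Qed.

Lemma rintegrable_mul_indic (w : torus R -> R) A B : ri w -> measurable A -> measurable B ->
  ri (fun z => w z * (\1_A z.1 * \1_B z.2)).
Proof.
move=> iw mA mB; apply: (@rintegrableM _ _ _ _ _ _ 1) => //.
  apply: measurable_funM.
    by apply: measurableT_comp => //; exact: measurable_fst.
  by apply: measurableT_comp => //; exact: measurable_snd.
move=> z; rewrite !indicE; case: (_ \in A); case: (_ \in B);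
  by rewrite /= ?mulr1 ?mulr0 ?normr0 ?normr1.
Qed.

(** By the hypothesis and Fubini, [u] and its fibre integral have the same integral over every
    rectangle. *)
Lemma fiber_integral_ae (u : torus R -> R) : ri u ->
  (forall A B, measurable A -> measurable B ->
    Rintegral mu setT (fun z => u z * (\1_A z.1 * \1_B z.2)) =
    Rintegral mu setT (fun z => u z * \1_A z.1) * fine (m B)) ->
  {ae mu, forall z, u z = fiber_integral u z.1}.
Proof.
move=> iu uAB; have iv := rintegrable_fiber_integral iu.
have iv' := rintegrable_fst iv.
suff : {ae mu, forall z, u z - fiber_integral u z.1 = 0}.
  by apply: filterS => z /eqP; rewrite subr_eq0 => /eqP.
apply: measure_rectangle_zero_ae => [|A B mA mB]; first exact: rintegrableB.
under eq_Rintegral do rewrite mulrBl.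
rewrite RintegralB//; [|exact: rintegrable_mul_indic|exact: rintegrable_mul_indic].
rewrite uAB//.
have iuA : ri (fun z => u z * \1_A z.1).
  have := rintegrable_mul_indic iu mA measurableT; congr rintegrable.
  by apply/funext => z; rewrite indicT mulr1.
rewrite (Rintegral_fiber iuA) (Rintegral_fiber (rintegrable_mul_indic iv' mA mB)).
have fA : fiber_integral (fun z => u z * \1_A z.1) = fun x => fiber_integral u x * \1_A x.
  apply/funext => x; rewrite /fiber_integral indicE /=.
  case: (x \in A); rewrite /= ?mulr1 ?mulr0.
    by apply: eq_Rintegral => y _; rewrite mulr1.
  by under eq_Rintegral do rewrite mulr0; rewrite (Rintegral1 m1).
have fAB : fiber_integral (fun z => fiber_integral u z.1 * (\1_A z.1 * \1_B z.2)) =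
    fun x => fine (m B) * (fiber_integral u x * \1_A x).
  apply/funext => x; rewrite {1}/fiber_integral /=.
  under eq_Rintegral do rewrite mulrA.
  have iB : rintegrable m (\1_B).
    exact: (bmeas_integrable m1 (bmeas_indic mB)).1.
  rewrite RintegralZl// mulrC; congr (_ * _).
  by rewrite /Rintegral integral_indic// setIT.
rewrite fA fAB RintegralZl//; last first.
  apply: (@rintegrableM _ _ _ _ _ _ 1) => // z.
  by rewrite indicE; case: (_ \in A); rewrite /= ?normr0 ?normr1.
by rewrite mulrC subrr.
Qed.

End TorusUniqueness.

(** * Bessel's inequality for functions of modulus 1 *)

Section UnitBessel.
Context d (X : measurableType d) (R : realType).
Variable mu : {measure set X -> \bar R}.
Hypothesis mu1 : mu setT = 1%E.
Implicit Types f g e : X -> R[i].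
Local Notation cI := (complex_integral mu).

Definition square_integrable f :=
  cintegrable mu f /\ rintegrable mu (fun x => sqn (f x)).

Lemma bmeas_conj f : bmeas f -> bmeas (fun x => conjc (f x)).
Proof.
move=> [[m1 m2] [M fM]]; split; last by exists M => x; rewrite sqn_conj.
split.
  rewrite (_ : (fun x => _) = (fun x => complex.Re (f x)))//.
  by apply/funext => x; case: (f x).
rewrite (_ : (fun x => _) = (fun x => - complex.Im (f x))); first exact: measurableT_comp.
by apply/funext => x; case: (f x).
Qed.

(** One step of orthogonal projection. A function of modulus 1 has norm 1 on a probability space and
    is bounded, so all products involved stay integrable. *)
Lemma energy_sub_unit g e : square_integrable g -> bmeas e -> (forall x, sqn (e x) = 1) ->
  let c := cI (fun x => g x * conjc (e x)) in
  square_integrable (fun x => g x - c * e x) /\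
  energy mu (fun x => g x - c * e x) = energy mu g - sqn c.
Proof.
move=> [ig ig2] be e1 c.
have ige := cintegrableM ig (bmeas_conj be).
have E x : sqn (g x - c * e x) = sqn (g x) +
    complex.Re ((- 2 * conjc c) * (g x * conjc (e x))) + sqn c.
  rewrite -[sqn c]mulr1 -(e1 x) /sqn; case: (g x) (e x) c => [? ?] [? ?] [? ?] /=; ring.
have i3 := (cintegrableM ige (bmeas_cst X (- 2 * conjc c))).
have i3' : cintegrable mu (fun x => (- 2 * conjc c) * (g x * conjc (e x))).
  by move: i3; congr cintegrable; apply/funext => x; rewrite mulrC.
have ic : rintegrable mu (fun=> sqn c).
  by apply: (@rintegrable_bounded _ _ _ _ mu1 _ `|sqn c|).
have i4 := rintegrableD ig2 i3'.1; have i5 := rintegrableD i4 ic.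
split.
  split; last by move: i5; congr rintegrable; apply/funext => x; rewrite E.
  have := cintegrableD ig (bmeas_integrable mu1 (bmeasZ (- c) be)).
  by congr cintegrable; apply/funext => x; rewrite mulNr.
rewrite /energy; under eq_Rintegral do rewrite E.
rewrite RintegralD// RintegralD//; last exact: i3'.1.
rewrite (Rintegral1 mu1).
have -> : Rintegral mu setT (fun x => complex.Re (- 2 * conjc c * (g x * conjc (e x)))) =
    complex.Re (cI (fun x => - 2 * conjc c * (g x * conjc (e x)))) by [].
rewrite complex_integralZ// -/c /sqn; case: (c) => a b /=; ring.
Qed.

Lemma bessel f (e : nat -> X -> R[i]) : square_integrable f ->
  (forall j, bmeas (e j)) -> (forall j x, sqn (e j x) = 1) ->
  (forall j k, j != k -> cI (fun x => e j x * conjc (e k x)) = 0) ->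
  forall J, \sum_(j < J) sqn (cI (fun x => f x * conjc (e j x))) <= energy mu f.
Proof.
move=> sf be e1 ort J; pose c j := cI (fun x => f x * conjc (e j x)).
(* g is f minus its first J projections; it keeps the coefficients of index at least J, which the
   next steps use. *)
suff [g [sg gc gE]] : exists g, [/\ square_integrable g,
    forall k, (J <= k)%N -> cI (fun x => g x * conjc (e k x)) = c k &
    energy mu g = energy mu f - \sum_(j < J) sqn (c j)].
  by rewrite -subr_ge0 -gE energy_ge0.
elim: J => [|J [g [sg gc gE]]].
  by exists f; split=> //; rewrite big_ord0 subr0.
have [sg' gE'] := energy_sub_unit sg (be J) (e1 J).
rewrite (gc J (leqnn J)) in sg' gE'.
exists (fun x => g x - c J * e J x); split=> //; last first.
  by rewrite gE' gE big_ord_recr /=; ring.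
move=> k Jk.
rewrite (_ : (fun x => _) = (fun x => g x * conjc (e k x) +
    - c J * (e J x * conjc (e k x)))); last by apply/funext => x; ring.
have bee := bmeasM (be J) (bmeas_conj (be k)).
rewrite complex_integralD; last 2 first.
- exact: cintegrableM sg.1 (bmeas_conj (be k)).
- exact/bmeas_integrable/bmeasZ.
rewrite complex_integralZ; last exact: bmeas_integrable.
rewrite ort ?mulr0 ?addr0; first by rewrite gc// ltnW.
by rewrite neq_ltn Jk.
Qed.

Lemma bessel_constant f (e : nat -> X -> R[i]) : square_integrable f ->
  (forall j, bmeas (e j)) -> (forall j x, sqn (e j x) = 1) ->
  (forall j k, j != k -> cI (fun x => e j x * conjc (e k x)) = 0) ->
  (forall j, sqn (cI (fun x => f x * conjc (e j x))) =
             sqn (cI (fun x => f x * conjc (e j.+1 x)))) ->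
  cI (fun x => f x * conjc (e 0%N x)) = 0.
Proof.
move=> sf be e1 ort ce; apply: sqn_eq0; set s := sqn _.
have sE j : sqn (cI (fun x => f x * conjc (e j x))) = s.
  by elim: j => [//|j IH]; rewrite -ce.
have := bessel sf be e1 ort => bE.
have Js J : J%:R * s <= energy mu f.
  apply: le_trans (bE J); rewrite (eq_bigr (fun=> s)) ?sumr_const ?card_ord ?mulr_natl//.
apply/eqP; rewrite eq_le sqn_ge0 andbT leNgt; apply/negP => s0.
have := Js (Num.trunc (energy mu f / s)).+1.
apply/negP; rewrite -ltNge -ltr_pdivrMr//; exact: truncnS_gt.
Qed.

End UnitBessel.

Lemma complex_limit_unique (R : realType) (u v : nat -> R[i]) (z w : R[i]) :
  (complex.Re (u n) @[n --> \oo] --> complex.Re z) /\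
  (complex.Im (u n) @[n --> \oo] --> complex.Im z) ->
  (forall n, u n = v n) ->
  (complex.Re (v n) @[n --> \oo] --> complex.Re w) /\
  (complex.Im (v n) @[n --> \oo] --> complex.Im w) ->
  z = w.
Proof.
move=> [u1 u2] /funext uv [v1 v2]; subst v.
by apply: complex_eq; [exact: (cvg_unique _ u1 v1)|exact: (cvg_unique _ u2 v2)].
Qed.

(** * Eigenfunctions of a skew shift *)

Section Kronecker.
Context {R : realType}.
Local Notation m := (@circle_measure R).
Local Notation mu := (@torus_measure R).
Local Notation cI := (complex_integral mu).

Let m1 : m setT = 1%E. Proof. exact: probability_setT. Qed.
Let mu1 : mu setT = 1%E. Proof. exact: torus_measureT. Qed.

Definition tcharacter (k l : int) (z : torus R) : R[i] :=
  character k z.1 * character l z.2.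

Lemma bmeas_tcharacter k l : bmeas (tcharacter k l).
Proof. exact: bmeasM (bmeas_character_fst k) (bmeas_character_snd l). Qed.

Lemma sqn_tcharacter k l z : sqn (tcharacter k l z) = 1.
Proof. by rewrite sqnM !sqn_character mulr1. Qed.

Lemma conj_tcharacter k l z : conjc (tcharacter k l z) = tcharacter (- k) (- l) z.
Proof. by rewrite /tcharacter !characterN rmorphM. Qed.

Lemma tcharacterD k l k' l' z :
  tcharacter k l z * tcharacter k' l' z = tcharacter (k + k') (l + l') z.
Proof. by rewrite /tcharacter !character_addl; ring. Qed.

Lemma tcharacter_skew k l (a b : circle R) z : tcharacter k l (skew 1 a b z) =
  (character k a * character l b) * tcharacter (k + l) l z.
Proof.
rewrite /tcharacter -[(skew 1 a b z).1]/(z.1 + a) -[(skew 1 a b z).2]/(z.2 + z.1 *~ 1 + b).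
by rewrite mulr1z !characterD character_addl; ring.
Qed.

(** A horizontal translation, [skew 0 a 0], changes the sign. The frequencies met along one chain
    differ in their first component, so this yields their orthogonality. *)
Lemma complex_integral_tcharacter k l : k != 0 -> cI (tcharacter k l) = 0.
Proof.
move=> /(@character_translate_half R) [a ka]; apply: eq_oppc_eq0.
have bk := bmeas_tcharacter k l.
rewrite -{1}(complex_integral_preserved (measurable_skew 0 a 0) (skew_preserving 0 a 0) bk.1).
have -> : (fun x => tcharacter k l (skew 0 a 0 x)) = (fun x => -1 * tcharacter k l x).
  by apply/funext => x; rewrite /tcharacter /skew /= mulr0z !addr0 ka mulN1r mulNr.
by rewrite complex_integralZ ?mulN1r//; exact: bmeas_integrable.
Qed.

Lemma Lfun2_square_integrable f : complex_Lfun mu 2%:E f -> square_integrable mu f.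
Proof.
move=> [f1 f2]; split.
  split; apply/Lfun1_integrable; apply: (Lfun_subset12 _) => //; by rewrite mu1.
apply: rintegrableD.
  exact: Lfun2_integrable_sqr f1.
exact: Lfun2_integrable_sqr f2.
Qed.

Lemma bounded_Lfun2 (u : torus R -> R) (M : R) : measurable_fun setT u ->
  (forall x, `|u x| <= M) -> u \in Lfun mu 2%:E.
Proof.
move=> mu_ uM; rewrite inE; apply/andP; split; rewrite inE//=.
rewrite /finite_norm unlock /Lnorm poweR_lty//.
apply: (@le_lt_trans _ _ (\int[mu]_x (M ^+ 2)%:E)%E); last by rewrite integral_cst// mu1 mule1 ltry.
have M0 : 0 <= M by exact: le_trans (normr_ge0 _) (uM (0, 0)).
apply: ge0_le_integral => //.
- by move=> x _; exact: poweR_ge0.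
- under eq_fun do rewrite /= powR_mulrn ?normr_ge0//.
  by apply/measurable_EFinP; apply: measurable_funX; exact: measurableT_comp.
- by move=> x _; rewrite /= lee_fin powR_mulrn ?normr_ge0// lerXn2r ?nnegrE.
Qed.

Section Eigenfunction.
Variables (T : bijection (torus R)) (a b : circle R) (f : torus R -> R[i]) (lambda : R[i]).
Hypothesis TE : forall z, T z = skew 1 a b z.
Hypothesis Lf : complex_Lfun mu 2%:E f.
Hypothesis lambda1 : `|lambda| = 1.
Hypothesis fT : {ae mu, forall z, f (T z) = lambda * f z}.

Let sf := Lfun2_square_integrable Lf.
Let mf : cmeasurable f := complex_Lfun_measurable Lf.

Definition coefficient k l := cI (fun z => f z * conjc (tcharacter k l z)).

Lemma sqn_lambda : sqn lambda = 1.
Proof.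
rewrite sqn_normc; have := lambda1; rewrite normc_def => /(congr1 (@complex.Re R)) /=.
by case: lambda => x y /= ->; rewrite expr1n.
Qed.

(** Change of variables by [T]: composition multiplies [f] by [lambda], and the character by a
    unimodular constant while moving its frequency to (k + l, l). *)
Lemma sqn_coefficient_step k l : sqn (coefficient k l) = sqn (coefficient (k + l) l).
Proof.
have mfe k' l' : cmeasurable (fun z => f z * conjc (tcharacter k' l' z)).
  exact: cmeasurableM mf (bmeas_conj (bmeas_tcharacter k' l')).1.
pose K : R[i] := lambda * conjc (character k a * character l b).
have -> : coefficient k l = K * coefficient (k + l) l.
  rewrite /coefficient -(complex_integral_preserved (measurable_skew 1 a b) (skew_preserving 1 a b) (mfe k l)).
  rewrite -complex_integralZ; last exact: cintegrableM sf.1 (bmeas_conj (bmeas_tcharacter _ _)).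
  apply: eq_ae_complex_integral.
  - have := mfe k l; move=> [h1 h2]; split.
      exact: (measurableT_comp h1 (measurable_skew 1 a b)).
    exact: (measurableT_comp h2 (measurable_skew 1 a b)).
  - exact: cmeasurableM (cmeasurable_cst _ _) (mfe _ _).
  - apply: filterS fT => z fz; rewrite -TE fz TE tcharacter_skew rmorphM /K.
    by rewrite -!mulrA; congr (_ * _); rewrite mulrCA.
by rewrite sqnM /K sqnM sqn_conj sqnM !sqn_character sqn_lambda !mul1r.
Qed.

Lemma coefficient0 k l : l != 0 -> coefficient k l = 0.
Proof.
move=> l0.
have := @bessel_constant _ _ R mu mu1 f (fun j => tcharacter (k + l *+ j) l) sf.
rewrite mulr0n addr0; apply.
- by move=> j; exact: bmeas_tcharacter.
- by move=> j z; exact: sqn_tcharacter.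
- move=> i j ij; under eq_fun do rewrite conj_tcharacter tcharacterD.
  apply: complex_integral_tcharacter.
  have -> : k + l *+ i + - (k + l *+ j) = l *+ i - l *+ j by ring.
  have ln n : l *+ n = l * n%:R by rewrite mulr_natr.
  by rewrite !ln -mulrBr mulf_neq0// subr_eq0 eqr_nat.
- move=> j; rewrite -/(coefficient _ l) sqn_coefficient_step -/(coefficient _ l).
  by rewrite mulrSr addrA.
Qed.

Let bfst (h : circle R -> R[i]) : bmeas h -> bmeas (fun z : torus R => h z.1).
Proof. by move=> bh; apply: (bmeas_comp (T := fst)) => //; exact: measurable_fst. Qed.

Let bsnd (h : circle R -> R[i]) : bmeas h -> bmeas (fun z : torus R => h z.2).
Proof. by move=> bh; apply: (bmeas_comp (T := snd)) => //; exact: measurable_snd. Qed.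

(** Vanishing is linear in [h] and stable under dominated convergence, so it passes from characters
    of x to all bounded functions of x. *)
Lemma integral_fst_character0 (h : circle R -> R[i]) l : bmeas h -> l != 0 ->
  cI (fun z => f z * (h z.1 * character l z.2)) = 0.
Proof.
move=> /trig_closure_bmeasE th l0; elim: th => [k|c {}h g th IHh tg IHg|F {}h M tF IH FM Fh].
- have nl0 : - l != 0 by rewrite oppr_eq0.
  have := coefficient0 (- k) nl0; rewrite /coefficient.
  by under eq_fun do rewrite conj_tcharacter !opprK.
- have bh := bfst (trig_closure_bmeas th); have bg := bfst (trig_closure_bmeas tg).
  have bl := bmeas_character_snd (R := R) l.
  have ih := cintegrableM sf.1 (bmeasM bh bl); have ig := cintegrableM sf.1 (bmeasM bg bl).
  rewrite (_ : (fun z => _) = (fun z => c * (f z * (h z.1 * character l z.2)) +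
    f z * (g z.1 * character l z.2))); last by apply/funext => z; ring.
  rewrite complex_integralD ?complex_integralZ//; first by rewrite IHh IHg mulr0 addr0.
  have := cintegrableM ih (bmeas_cst _ c); congr cintegrable.
  by apply/funext => z; rewrite mulrC.
- have il := cintegrableM sf.1 (bmeas_character_snd (R := R) l).
  have bF n := bfst (trig_closure_bmeas (tF n)).
  have cF : ccvg (fun n z => F n z.1) (fun z : torus R => h z.1) by move=> z; exact: Fh.
  have := complex_integral_dominated il (fun n => (bF n).1) (fun n z => FM n z.1) cF.
  have E (g : circle R -> R[i]) : (fun z : torus R => f z * character l z.2 * g z.1) =
      (fun z => f z * (g z.1 * character l z.2)).
    by apply/funext => z; ring.
  rewrite E => /complex_limit_unique; apply => [n|]; first by rewrite E IH.
  by split; exact: cvg_cst.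
Qed.

(** In the second coordinate only the frequency 0 survives, on both sides, and induction on [g] goes
    beyond characters. For indicators this becomes the hypothesis of [fiber_integral_ae]. *)
Lemma integral_fst_snd (h g : circle R -> R[i]) : bmeas h -> bmeas g ->
  cI (fun z => f z * (h z.1 * g z.2)) =
  cI (fun z => f z * h z.1) * complex_integral m g.
Proof.
move=> bh /trig_closure_bmeasE tg.
have bh1 := bfst bh; have ifh := cintegrableM sf.1 bh1.
elim: tg => [l|c {}g g' tg IHg tg' IHg'|F {}g M tF IH FM Fg].
- have [->|l0] := eqVneq l 0.
    rewrite (_ : character 0 = fun=> 1); last by apply/funext => x; rewrite character0.
    rewrite (complex_integral_cst m1) mulr1; congr complex_integral.
    by apply/funext => z; rewrite mulr1.
  by rewrite complex_integral_character// mulr0 integral_fst_character0.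
- have bg := bsnd (trig_closure_bmeas tg); have bg' := bsnd (trig_closure_bmeas tg').
  have ig := cintegrableM sf.1 (bmeasM bh1 bg); have ig' := cintegrableM sf.1 (bmeasM bh1 bg').
  rewrite (_ : (fun z => _) = (fun z => c * (f z * (h z.1 * g z.2)) +
    f z * (h z.1 * g' z.2))); last by apply/funext => z; ring.
  rewrite complex_integralD ?complex_integralZ//; last first.
    have := cintegrableM ig (bmeas_cst _ c); congr cintegrable.
    by apply/funext => z; rewrite mulrC.
  have i1 := bmeas_integrable m1 (trig_closure_bmeas tg).
  have i2 := bmeas_integrable m1 (trig_closure_bmeas tg').
  have i3 := bmeas_integrable m1 (bmeasZ c (trig_closure_bmeas tg)).
  by rewrite complex_integralD// complex_integralZ// IHg IHg'; ring.
- have bF n := bsnd (trig_closure_bmeas (tF n)).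
  have cF : ccvg (fun n z => F n z.2) (fun z : torus R => g z.2) by move=> z; exact: Fg.
  have := complex_integral_dominated ifh (fun n => (bF n).1) (fun n z => FM n z.2) cF.
  have i1 := bmeas_integrable m1 (bmeas_cst (circle R) (1 : R[i])).
  have [d1 d2] := complex_integral_dominated i1 (fun n => (trig_closure_bmeas (tF n)).1) FM Fg.
  have E (g' : circle R -> R[i]) : (fun z : torus R => f z * h z.1 * g' z.2) =
      (fun z => f z * (h z.1 * g' z.2)).
    by apply/funext => z; ring.
  have E1 (g' : circle R -> R[i]) : (fun x => 1 * g' x) = g' by apply/funext => x; rewrite mul1r.
  rewrite E1 in d1 d2.
  rewrite E => c; apply: (complex_limit_unique (v := fun n =>
    cI (fun z => f z * h z.1) * complex_integral m (fun x => 1 * F n x)) c) => [n|].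
    by rewrite E IH E1.
  split.
    under eq_fun do rewrite Re_mulc.
    by rewrite Re_mulc; apply: cvgB; apply: cvgMr.
  under eq_fun do rewrite Im_mulc.
  by rewrite Im_mulc; apply: cvgD; apply: cvgMr.
Qed.

Lemma eigenfunction_fst : {ae mu, forall z, f z =
  (fiber_integral (fun z => complex.Re (f z)) z.1 +i*
   fiber_integral (fun z => complex.Im (f z)) z.1)%C}.
Proof.
have H A B : measurable A -> measurable B ->
    cI (fun z => f z * ((\1_A z.1 * \1_B z.2 : R))%:C%C) =
    cI (fun z => f z * (\1_A z.1 : R)%:C%C) * (fine (m B))%:C%C.
  move=> mA mB; have := integral_fst_snd (bmeas_indic mA) (bmeas_indic mB).
  have -> : complex_integral m (fun x => (\1_B x)%:C%C) = (fine (m B))%:C%C.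
    apply: complex_eq => /=; last exact: Rintegral1.
    by rewrite /Rintegral integral_indic// setIT.
  by under eq_fun do rewrite -rmorphM.
have rr (z : R[i]) (r : R) : complex.Re (z * r%:C%C) = complex.Re z * r.
  by case: z => x y /=; ring.
have ir (z : R[i]) (r : R) : complex.Im (z * r%:C%C) = complex.Im z * r.
  by case: z => x y /=; ring.
have aR : {ae mu, forall z, complex.Re (f z) =
    fiber_integral (fun z => complex.Re (f z)) z.1}.
  apply: (fiber_integral_ae sf.1.1) => A B mA mB.
  have := congr1 (@complex.Re R) (H A B mA mB); rewrite rr /=.
  by under eq_Rintegral do rewrite rr; under [in RHS]eq_Rintegral do rewrite rr.
have aI : {ae mu, forall z, complex.Im (f z) =
    fiber_integral (fun z => complex.Im (f z)) z.1}.
  apply: (fiber_integral_ae sf.1.2) => A B mA mB.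
  have := congr1 (@complex.Im R) (H A B mA mB); rewrite ir /=.
  by under eq_Rintegral do rewrite ir; under [in RHS]eq_Rintegral do rewrite ir.
by apply: filterS2 aR aI => z h1 h2; apply: complex_eq.
Qed.

End Eigenfunction.

End Kronecker.

(** * The sigma-algebra generated by the eigenfunctions *)

Section KroneckerFactor.
Context {R : realType}.
Local Notation mu := (@torus_measure R).

Lemma preimage_fst_measurable (C : set (circle R)) : measurable C ->
  measurable (fst @^-1` C : set (torus R)).
Proof. by move=> mC; rewrite -[X in measurable X]setTI; exact: measurable_fst. Qed.

Lemma symmetric_difference_eq0 (A B : set (torus R)) : measurable A -> measurable B ->
  {ae mu, forall z, A z <-> B z} -> mu ((A `\` B) `|` (B `\` A)) = 0%E.
Proof.
move=> mA mB AB; apply/negligibleP.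
  by apply: measurableU; exact: measurableD.
apply: negligibleS AB => z /= h ABz; case: h => -[]; tauto.
Qed.

(** An eigenfunction depends on x only almost everywhere, so its preimages are cylinders up to null
    sets; such sets form a sigma-algebra. *)
Definition mod_null_fst (A : set (torus R)) := measurable A /\
  exists2 C : set (circle R), measurable C & {ae mu, forall z, A z <-> C z.1}.

Lemma sigma_algebra_mod_null_fst : sigma_algebra setT mod_null_fst.
Proof.
split.
- by split=> //; exists set0 => //; exact: aeW.
- move=> A [mA [C mC AC]]; rewrite setTD; split; first exact: measurableC.
  by exists (~` C); [exact: measurableC|apply: filterS AC => z; rewrite /setC /=; tauto].
- move=> F mF; split; first by apply: bigcupT_measurable => n; exact: (mF n).1.
  have /choice[C CP] : forall n, exists C : set (circle R), measurable C /\
      {ae mu, forall z, F n z <-> C z.1}.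
    by move=> n; have [_ [C mC FC]] := mF n; exists C.
  exists (\bigcup_n C n); first by apply: bigcupT_measurable => n; exact: (CP n).1.
  have : {ae mu, forall z, forall n, F n z <-> C n z.1}.
    by apply: ae_foralln => n; exact: (CP n).2.
  by apply: filterS => z h; split=> -[n _ ?]; exists n => //; apply/h.
Qed.

(** The single map [T i0] already makes a common eigenfunction depend on x. Conversely [character 1]
    of x is an eigenfunction of every map, and arcs are its preimages. The index type covers the
    whole action as well as one map. *)
Lemma kronecker_skew (I : Type) (i0 : I) (T : I -> bijection (torus R)) (a b : I -> circle R) :
  (forall i z, T i z = skew 1 (a i) (b i) z) ->
  eq_mod_null mu (kronecker_algebra mu T) (@first_coordinate_algebra R).
Proof.
move=> TE; split=> [A kA|B [C mC <-]].
  suff [mA [C mC AC]] : mod_null_fst A.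
    exists (fst @^-1` C : set (torus R)); first by exists C => //; rewrite setTI.
    by apply: symmetric_difference_eq0 => //; exact: preimage_fst_measurable.
  move: A kA; apply: smallest_sub; first exact: sigma_algebra_mod_null_fst.
  move=> _ [f [B [[Lf _ [lambda fT]] mB ->]]].
  have [m1 m2] := complex_Lfun_measurable Lf.
  have [i1 i2] := (Lfun2_square_integrable Lf).1.
  split.
    rewrite -[X in measurable X]setTI.
    exact: (measurable_fun_pair m1 m2).
  have n1 := rintegrable_measurable (rintegrable_fiber_integral i1).
  have n2 := rintegrable_measurable (rintegrable_fiber_integral i2).
  exists ((fun x => (fiber_integral (fun z => complex.Re (f z)) x,
                     fiber_integral (fun z => complex.Im (f z)) x)) @^-1` B).
    rewrite -[X in measurable X]setTI; exact: (measurable_fun_pair n1 n2).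
  have := eigenfunction_fst (TE i0) Lf (fT i0).1 (fT i0).2.
  by apply: filterS => z /= ->.
have eig : eigenfunction mu T (fun z => character 1 z.1).
  have [[m1 m2] [M bM]] := @bmeas_character_fst R 1.
  split.
  - split; apply: (@bounded_Lfun2 _ _ (M + 1)) => // z.
      exact: normr_Re_le.
    exact: normr_Im_le.
  - move=> h; have : mu setT = 0%E.
      apply/negligibleP => //; apply: negligibleS h => z _ /= c0.
      have := sqn_character 1 z.1; rewrite c0 sqn0 => /esym/eqP.
      by rewrite oner_eq0.
    by rewrite torus_measureT => /eqP; rewrite onee_eq0.
  - exists (fun i => character 1 (a i)) => i; split.
      rewrite normc_def; have := sqn_character 1 (a i); rewrite /sqn => ->.
      by rewrite sqrtr1.
    by apply: aeW => z; rewrite TE /skew [z.1 + _]addrC characterD.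
exists ([set: torus R] `&` fst @^-1` C); last first.
  by rewrite setDv setU0 measure0.
rewrite setTI; move: C mC; apply: circle_measurable_ind => [c t|C kC|F kF].
- apply: sub_sigma_algebra.
  exists (fun z => character 1 z.1), [set w : R * R |
    t < cos (2 * pi * c) * w.1 + sin (2 * pi * c) * w.2]; split=> //.
  rewrite -[X in measurable X]setTI.
  have mh : measurable_fun setT (fun w : R * R =>
      cos (2 * pi * c) * w.1 + sin (2 * pi * c) * w.2).
    by apply: measurable_funD; apply: measurable_funM.
  rewrite (_ : [set w | _] = (fun w : R * R =>
      cos (2 * pi * c) * w.1 + sin (2 * pi * c) * w.2) @^-1` `]t, +oo[%classic); first exact: mh.
  by apply/seteqP; split=> w; rewrite /= in_itv /= andbT.
- rewrite -preimage_setC; have [_ kD _] := smallest_sigma_algebra setT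
    [set A | exists f (B : set (R * R)), [/\ eigenfunction mu T f, measurable B &
        A = (fun x => (complex.Re (f x), complex.Im (f x))) @^-1` B]].
  by rewrite -setTD; exact: kD.
- rewrite preimage_bigcup; have [_ _ kU] := smallest_sigma_algebra setT
    [set A | exists f (B : set (R * R)), [/\ eigenfunction mu T f, measurable B &
        A = (fun x => (complex.Re (f x), complex.Im (f x))) @^-1` B]].
  exact: kU.
Qed.

End KroneckerFactor.

Lemma continuous_pair (Z U V : topologicalType) (f : Z -> U) (g : Z -> V) :
  continuous f -> continuous g -> continuous (fun z => (f z, g z)).
Proof.
move=> cf cg z.
exact: (@cvg_pair _ _ _ (nbhs z) (nbhs (f z)) (nbhs (g z)) _ _ _ f g (cf z) (cg z)).
Qed.

(* [(k, a, b)] stands for the affine map [(x, y) |-> (x + a, y + k x + b)]. *)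
Definition affine_group (R : realType) : Type := (discrete_topology int * R * R)%type.

(** * The nilpotent group of skew shifts *)

Section AffineGroup.
Variable R : realType.
Local Notation G := (affine_group R).

HB.instance Definition _ := Topological.copy G (discrete_topology int * R * R)%type.

Definition ag_one : G := (0 : int, 0, 0).
Definition ag_inv (g : G) : G :=
  (- (g.1.1 : int), - g.1.2, - g.2 + (g.1.1 : int)%:~R * g.1.2).
(** Composition with [h] acting first: the product term comes from applying the linear part of [g]
    to the horizontal translation of [h]. *)
Definition ag_mul (g h : G) : G :=
  ((g.1.1 : int) + (h.1.1 : int), g.1.2 + h.1.2,
   g.2 + h.2 + (g.1.1 : int)%:~R * h.1.2).

Let mulA : associative ag_mul.
Proof.
move=> [[k a] b] [[k' a'] b'] [[k'' a''] b'']; rewrite /ag_mul /=.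
by congr (_, _, _); rewrite ?addrA// intrD; ring.
Qed.

Let mul1 : left_id ag_one ag_mul.
Proof. by move=> [[k a] b]; rewrite /ag_mul /= mul0r !add0r addr0. Qed.

Let mulr1 : right_id ag_one ag_mul.
Proof. by move=> [[k a] b]; rewrite /ag_mul /= mulr0 !addr0. Qed.

Let mulV : left_inverse ag_one ag_inv ag_mul.
Proof.
move=> [[k a] b]; rewrite /ag_mul /ag_inv /ag_one /= !addNr mulrNz.
by congr (_, _, _); ring.
Qed.

Let mulrV : right_inverse ag_one ag_inv ag_mul.
Proof.
move=> [[k a] b]; rewrite /ag_mul /ag_inv /ag_one /= !subrr.
by congr (_, _, _); ring.
Qed.

HB.instance Definition _ := isGroup.Build G mulA mul1 mulr1 mulV mulrV.

Lemma discrete_continuous (Z : topologicalType) (f : discrete_topology int -> Z) :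
  continuous f.
Proof.
move=> k U /= fU; have : nbhs k [set k] by exact: discrete_set1.
move=> h; apply: (@filterS _ (nbhs k) _ [set k]) => // _ ->.
exact: (nbhs_singleton fU).
Qed.

Local Notation D := (discrete_topology int).

Lemma affine_group_linear_part_continuous : continuous (fun g : G => g.1.1 : D).
Proof.
by move=> g; apply: (@continuous_comp _ _ _ (fst : D * R * R -> D * R) fst);
  exact: cvg_fst.
Qed.

Lemma affine_group_fst_translation_continuous : continuous (fun g : G => g.1.2).
Proof.
move=> g; apply: (@continuous_comp _ _ _ (fst : D * R * R -> D * R) snd).
  exact: cvg_fst.
exact: cvg_snd.
Qed.

Lemma affine_group_snd_translation_continuous : continuous (fun g : G => g.2).
Proof. by move=> g; exact: (@cvg_snd (D * R)%type R). Qed.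

Lemma affine_group_continuous (Z : topologicalType) (k : Z -> D) (a b : Z -> R) :
  continuous k -> continuous a -> continuous b -> continuous (fun z => (k z, a z, b z) : G).
Proof.
by move=> ck ca cb; apply: continuous_pair cb; exact: continuous_pair.
Qed.

Let mulg_continuous : continuous (fun xy : G * G => (xy.1 * xy.2)%g).
Proof.
have p1 : continuous (fst : G * G -> G) by move=> x; exact: cvg_fst.
have p2 : continuous (snd : G * G -> G) by move=> x; exact: cvg_snd.
apply: affine_group_continuous => x.
- apply: (@continuous_comp _ _ _ (fun xy : G * G => (xy.1.1.1 : D, xy.2.1.1 : D))
    (fun kl => (kl.1 : int) + (kl.2 : int) : D)).
    apply: continuous_pair => z.
      exact: (continuous_comp (p1 z) (@affine_group_linear_part_continuous _)).
    exact: (continuous_comp (p2 z) (@affine_group_linear_part_continuous _)).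
  move: (_, _) => [k l] U /= Ukl.
  exists ([set k], [set l]) => /=; first by split; exact: discrete_set1.
  by move=> [k' l'] /= [-> ->]; exact: (nbhs_singleton Ukl).
- apply: cvgD.
    exact: (continuous_comp (p1 x) (@affine_group_fst_translation_continuous _)).
  exact: (continuous_comp (p2 x) (@affine_group_fst_translation_continuous _)).
- apply: cvgD.
    apply: cvgD.
      exact: (continuous_comp (p1 x) (@affine_group_snd_translation_continuous _)).
    exact: (continuous_comp (p2 x) (@affine_group_snd_translation_continuous _)).
  apply: cvgM.
    apply: (@continuous_comp _ _ _ (fun xy : G * G => xy.1.1.1 : D)
      (fun k : D => (k : int)%:~R : R)).
      exact: (continuous_comp (p1 x) (@affine_group_linear_part_continuous _)).
    exact: discrete_continuous.
  exact: (continuous_comp (p2 x) (@affine_group_fst_translation_continuous _)).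
Qed.

Let invg_continuous : continuous (fun x : G => (x^-1)%g).
Proof.
apply: affine_group_continuous => x.
- apply: (continuous_comp (@affine_group_linear_part_continuous x)
    (@discrete_continuous D (fun k => - (k : int) : D) _)).
- exact: cvgN (@affine_group_fst_translation_continuous x).
- apply: cvgD; first exact: cvgN (@affine_group_snd_translation_continuous x).
  apply: cvgM; last exact: affine_group_fst_translation_continuous.
  exact: (continuous_comp (@affine_group_linear_part_continuous x)
    (@discrete_continuous _ (fun k : D => (k : int)%:~R : R) _)).
Qed.

HB.instance Definition _ :=
  isTopologicalGroup.Build G mulg_continuous invg_continuous.

Lemma affine_group_hausdorff : hausdorff_space G.
Proof.
move=> g h gh.
have e2 : g.2 = h.2.
  apply: (@Rhausdorff R) => U V nU nV.
  have [z [/= zU zV]] := gh _ _ (affine_group_snd_translation_continuous nU) (affine_group_snd_translation_continuous nV).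
  by exists z.2.
have e12 : g.1.2 = h.1.2.
  apply: (@Rhausdorff R) => U V nU nV.
  have [z [/= zU zV]] := gh _ _ (affine_group_fst_translation_continuous nU) (affine_group_fst_translation_continuous nV).
  by exists z.1.2.
have e11 : g.1.1 = h.1.1.
  have [z [/= zU zV]] := gh _ _ (affine_group_linear_part_continuous (discrete_set1 (g.1.1 : D)))
    (affine_group_linear_part_continuous (discrete_set1 (h.1.1 : D))).
  by rewrite -zU -zV.
by move: g h {gh} e2 e12 e11 => [[? ?] ?] [[? ?] ?] /= -> -> ->.
Qed.

Lemma affine_group_second_countable : @second_countable G.
Proof.
pose I (q r : rat) : set R := [set x | ratr q < x < ratr r].
have oI q r : open (I q r).
  by rewrite (_ : I q r = `]ratr q, ratr r[%classic); [exact: interval_open|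
    apply/seteqP; split=> x /=; rewrite in_itv].
have Iball (x e : R) : 0 < e -> exists q r, I q r x /\ forall y, I q r y -> `|x - y| < e.
  move=> e0.
  have [q] : exists q : rat, ratr q \in `]x - e, x[ by apply: rat_in_itvoo; lra.
  have [r] : exists r : rat, ratr r \in `]x, x + e[ by apply: rat_in_itvoo; lra.
  rewrite !in_itv /= => /andP[? ?] /andP[? ?]; exists q, r; split; first by apply/andP.
  by move=> y /andP[? ?]; rewrite ltr_norml; apply/andP; split; lra.
pose B (i : int * (rat * rat) * (rat * rat)) : set G :=
  [set g | [/\ g.1.1 = i.1.1, I i.1.2.1 i.1.2.2 g.1.2 & I i.2.1 i.2.2 g.2]].
exists (range B); first by apply: (card_le_trans (card_image_le _ _)); exact: countableP.
split.
  move=> _ [[[k [q r]] [s t]] _ <-].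
  have -> : B (k, (q, r), (s, t)) = (fun g : G => g.1.1 : D) @^-1` [set k] `&`
      ((fun g : G => g.1.2) @^-1` I q r `&` (fun g : G => g.2) @^-1` I s t).
    by apply/seteqP; split=> g /= => [[? ? ?]|[? [? ?]]].
  apply: openI; first by apply: open_comp => [x _|]; [exact: affine_group_linear_part_continuous|exact: discrete_open].
  by apply: openI; apply: open_comp => // x _;
    [exact: affine_group_fst_translation_continuous|
     exact: affine_group_snd_translation_continuous].
move=> [[k a] b] U /= [[V W] /= [[[V1 V2] /= [nV1 nV2] V12] nW] VWU].
have /nbhs_ballP[e1 /= e10 e1V] := nV2; have /nbhs_ballP[e2 /= e20 e2W] := nW.
have [q [r [Ia Ia1]]] := Iball a e1 e10; have [s [t [Ib Ib1]]] := Iball b e2 e20.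
exists (B (k, (q, r), (s, t))).
  by split; [exists (k, (q, r), (s, t))|split].
move=> [[k' a'] b'] [/= -> ha hb]; apply: (VWU (k, a', b')); split => /=.
  apply: (V12 (k, a')); split => /=; first exact: nbhs_singleton.
  by apply: e1V; exact: Ia1.
by apply: e2W; exact: Ib1.
Qed.

End AffineGroup.

(** * The Lie structure of the group *)

Section AffineSmooth.
Variables (R : realType) (V W : normedModType R).

(** The derivative in direction v is the constant [c v], again of this form with increments 0; hence
    the induction on the order. *)
Lemma affine_smooth (U : set V) (f : V -> W) (c : V -> W) : continuous f ->
  (forall x v (h : R), f (h *: v + x) = f x + h *: c v) -> smooth_on U f.
Proof.
move=> cf fc k; elim: k f c cf fc => [|k IH] f c cf fc; first by split=> // x _; exact: cf.
have dE v x : (fun h : R => h^-1 *: ((f \o shift x) (h *: v) - f x)) @ 0^' --> c v.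
  apply: cvg_near_cst; near=> h; rewrite /= fc addrAC subrr add0r scalerA.
  by rewrite mulVf ?scale1r//; near: h; exact: nbhs_dnbhs_neq.
split; first by move=> x _; exact: cf.
move=> v; split; first by move=> x _; apply/cvg_ex; exists (c v); exact: dE.
have -> : 'D_v f = fun=> c v by apply/funext => x; apply: cvg_lim; [exact: norm_hausdorff|exact: dE].
apply: (IH _ (fun=> 0)); first by move=> x; exact: cvg_cst.
by move=> x w h; rewrite scaler0 addr0.
Unshelve. all: end_near. Qed.

End AffineSmooth.

Section AffineGroupLie.
Variable R : realType.
Local Notation G := (affine_group R).
Local Notation D := (discrete_topology int).
Local Notation W := 'rV[R]_2.

Definition translation_row (a b : R) : W :=
  a *: delta_mx 0 0 + b *: delta_mx 0 (inord 1).

Lemma translation_row0 a b : translation_row a b 0 0 = a.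
Proof.
rewrite /translation_row !mxE eqxx /= (_ : (0 == inord 1 :> 'I_2) = false) ?mulr1 ?mulr0 ?addr0//.
by rewrite -val_eqE /= inordK.
Qed.

Lemma translation_row1 a b : translation_row a b 0 (inord 1) = b.
Proof.
rewrite /translation_row !mxE eqxx /= eqxx (_ : (inord 1 == 0 :> 'I_2) = false) ?mulr1 ?mulr0 ?add0r//.
by rewrite -val_eqE /= inordK.
Qed.

Lemma translation_rowK (u : W) : translation_row (u 0 0) (u 0 (inord 1)) = u.
Proof.
apply/rowP => i; have [->|i1] := eqVneq i 0; first exact: translation_row0.
rewrite (_ : i = inord 1) ?translation_row1//; apply: val_inj; rewrite /= inordK//.
by case: i i1 => [[|[|]]].
Qed.

Lemma translation_row_linear (h a b a' b' : R) :
  translation_row (h * a + a') (h * b + b') =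
  translation_row a' b' + h *: translation_row a b.
Proof.
rewrite /translation_row scalerDr !scalerDl !scalerA.
rewrite [h * a *: _ + _]addrC [h * b *: _ + _]addrC.
by rewrite addrACA.
Qed.

Lemma translation_row_continuous (Z : topologicalType) (a b : Z -> R) :
  continuous a -> continuous b -> continuous (fun z => translation_row (a z) (b z)).
Proof.
move=> ca cb z; apply: cvgD.
  by apply: cvgZr_tmp; exact: ca.
by apply: cvgZr_tmp; exact: cb.
Qed.

Lemma inverse_row_continuous (Z : topologicalType) (a b : Z -> R) (k : R) :
  continuous a -> continuous b ->
  continuous (fun z => translation_row (- a z) (- b z + k * a z)).
Proof.
move=> ca cb; apply: translation_row_continuous => z; first by apply: cvgN; exact: ca.
apply: cvgD; first by apply: cvgN; exact: cb.
by apply: cvgM; [exact: cvg_cst|exact: ca].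
Qed.

Let component_chart_continuous : continuous (fun g : G => translation_row g.1.2 g.2).
Proof.
apply: translation_row_continuous.
  exact: affine_group_fst_translation_continuous.
exact: affine_group_snd_translation_continuous.
Qed.

Let component_chart_inv_continuous (k : int) :
  continuous (fun u : W => (k : D, u 0 0, u 0 (inord 1)) : G).
Proof.
apply: affine_group_continuous; last 2 first.
- exact: coord_continuous.
- exact: coord_continuous.
- exact: (@cst_continuous W D k).
Qed.

Let chart_image k : (fun g : G => translation_row g.1.2 g.2) @` [set g | g.1.1 = k] = setT.
Proof.
apply/seteqP; split=> // u _; exists (k, u 0 0, u 0 (inord 1)) => //=.
exact: translation_rowK.
Qed.

Let component_open (k : int) : open [set g : G | g.1.1 = k].
Proof.
rewrite (_ : [set g : G | g.1.1 = k] = (fun g : G => g.1.1 : D) @^-1` [set k])//.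
by apply: open_comp => [x _|]; [exact: affine_group_linear_part_continuous|exact: discrete_open].
Qed.

Let component_image_open (k : int) :
  open ((fun g : G => translation_row g.1.2 g.2) @` [set g : G | g.1.1 = k]).
Proof. by rewrite chart_image; exact: openT. Qed.

Let component_chartK (k : int) (x : G) : x.1.1 = k -> (k, translation_row x.1.2 x.2 0 0,
  translation_row x.1.2 x.2 0 (inord 1)) = x.
Proof. by move: x => [[k' a] b] /= ->; rewrite translation_row0 translation_row1. Qed.

(** One chart for each whole component: once the integer is fixed, the product term of the group law
    is linear in the coordinates, and multiplication and inversion become affine. *)
Definition component_chart (k : int) : chart R G 2 :=
  @Chart R G 2 [set g : G | g.1.1 = k] (fun g : G => translation_row g.1.2 g.2)
    (fun u => (k, u 0 0, u 0 (inord 1))) (@component_open k) (@component_image_open k)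
    (@component_chartK k) (fun x _ => @component_chart_continuous x)
    (fun u _ => @component_chart_inv_continuous k u).

Let atlas := range component_chart.

Let cover (x : G) : exists2 c, atlas c & chart_dom c x.
Proof. by exists (component_chart x.1.1); [exists x.1.1|]. Qed.

Let transition c d : atlas c -> atlas d ->
  smooth_on [set u | chart_cod c u /\ chart_dom d (chart_inv c u)]
    (fun u => d (chart_inv c u)).
Proof.
move=> [k _ <-] [l _ <-]; rewrite [X in smooth_on _ X](_ : _ = id).
  by apply: (@affine_smooth _ _ _ _ id id) => [u|x v h]; [exact: cvg_id|rewrite addrC].
by apply/funext => u; exact: translation_rowK.
Qed.

Let mul_smooth c d e : atlas c -> atlas d -> atlas e ->
  smooth_on
    [set uv : W * W | [/\ chart_cod c uv.1, chart_cod d uv.2 &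
      chart_dom e (chart_inv c uv.1 * chart_inv d uv.2)%g]]
    (fun uv => e (chart_inv c uv.1 * chart_inv d uv.2)%g).
Proof.
move=> [k _ <-] [l _ <-] [n _ <-].
pose f (uv : W * W) := translation_row (uv.1 0 0 + uv.2 0 0)
  (uv.1 0 (inord 1) + uv.2 0 (inord 1) + k%:~R * uv.2 0 0).
apply: (@affine_smooth _ _ _ _ f f) => [|x v h].
  have c1 i : continuous (fun uv : W * W => uv.1 0 i).
    move=> x; apply: (@continuous_comp _ _ _ (fst : W * W -> W) (fun u : W => u 0 i)).
      exact: cvg_fst.
    exact: coord_continuous.
  have c2 i : continuous (fun uv : W * W => uv.2 0 i).
    move=> x; apply: (@continuous_comp _ _ _ (snd : W * W -> W) (fun u : W => u 0 i)).
      exact: cvg_snd.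
    exact: coord_continuous.
  apply: translation_row_continuous => x; first by apply: cvgD; [exact: c1|exact: c2].
  apply: cvgD; first by apply: cvgD; [exact: c1|exact: c2].
  by apply: cvgM; [exact: cvg_cst|exact: c2].
rewrite /f -translation_row_linear /= !mxE; congr translation_row; ring.
Qed.

Let inv_smooth c d : atlas c -> atlas d ->
  smooth_on [set u | chart_cod c u /\ chart_dom d (chart_inv c u)^-1%g]
    (fun u => d (chart_inv c u)^-1%g).
Proof.
move=> [k _ <-] [l _ <-].
pose f (u : W) := translation_row (- u 0 0) (- u 0 (inord 1) + k%:~R * u 0 0).
apply: (@affine_smooth _ _ _ _ f f) => [|x v h].
  have co i : continuous (fun u : W => u 0 i) by exact: coord_continuous.
  by apply: inverse_row_continuous; exact: co.
rewrite /f -translation_row_linear /= !mxE; congr translation_row; ring.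
Qed.

Definition affine_group_lie : lie_structure R G :=
  LieStructure (@affine_group_hausdorff R) (@affine_group_second_countable R)
    cover transition mul_smooth inv_smooth.

End AffineGroupLie.

(** * Groups of nilpotency class two *)

Section StepTwo.
Variable G : groupType.
Local Open Scope group_scope.

Lemma generated_subgroup (A : set G) : subgroup_closed (generated A).
Proof.
split; first by move=> H [[H1 _] _].
by move=> x y Ax Ay H hH; apply: hH.1.2; [exact: Ax|exact: Ay].
Qed.

Lemma sub_generated (A : set G) : A `<=` generated A.
Proof. by move=> x Ax H [_]; exact. Qed.

Lemma commg_eq1 (x y : G) : [~ x, y] = 1 -> x * y = y * x.
Proof.
move=> /(congr1 (fun z => x * z)); rewrite /commg /conjg mulg1 mulVKg.
by move=> /(congr1 (fun z => y * z)); rewrite mulVKg => ->.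
Qed.

Lemma commute_commg (x y : G) : x * y = y * x -> [~ x, y] = 1.
Proof. by move=> xy; rewrite /commg /conjg xy mulKg mulVg. Qed.

Lemma step_nilpotent2 (H : set G) :
  (forall x y z, H x -> H y -> H z -> x * [~ y, z] = [~ y, z] * x) ->
  (exists x y, [/\ H x, H y & x * y <> y * x]) ->
  step_nilpotent 2 H.
Proof.
move=> Hc [x [y [Hx Hy xy]]]; split.
  apply/seteqP; split=> [g|_ ->]; last exact: (generated_subgroup _).1.
  apply; split; first by split=> [//|_ _ -> ->]; rewrite divg1.
  move=> _ [u [v [Hu Hv ->]]]; apply: commute_commg.
  (* The centralizer of u is a subgroup containing all commutators, hence the subgroup that they
     generate. *)
  suff : commutator_subgroup H H `<=` [set v | u * v = v * u] by exact.
  apply: smallest_sub; last by move=> _ [y' [z' [Hy' Hz' ->]]]; exact: Hc.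
  split=> /=; first by rewrite mulg1 mul1g.
  move=> s t us ut; rewrite mulgA us -!mulgA; congr (_ * _).
  by apply: (can_inj (mulgK t)); rewrite -!mulgA mulVg mulg1 ut mulKg.
case=> [|[|//]] _ /=.
  by move=> H1; apply: xy; move: Hx Hy; rewrite H1 => -> ->.
move=> L1; apply: xy; apply: commg_eq1.
have : commutator_subgroup H H [~ x, y] by apply: sub_generated; exists x, y.
by rewrite L1.
Qed.

End StepTwo.

(** * The action of the group on the torus *)

Section TorusAction.
Context {R : realType}.
Local Notation G := (affine_group R).

Definition torus_act_fun (g : G) : torus R -> torus R :=
  skew g.1.1 (to_circle g.1.2) (to_circle g.2).

Lemma torus_act_funM (g h : G) z :
  torus_act_fun (g * h)%g z = torus_act_fun g (torus_act_fun h z).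
Proof.
move: g h z => [[k a] b] [[k' a'] b'] [x y]; rewrite /torus_act_fun /skew /=.
congr (_, _); first by rewrite raddfD [to_circle a + _]addrC addrA.
have -> : to_circle (b + b' + k%:~R * a') =
    to_circle b + to_circle b' + to_circle a' *~ k.
  by rewrite !raddfD -raddfMz mulrzl.
have -> : x *~ (k + k') = x *~ k + x *~ k' by exact: mulrzDr.
have -> : (x + to_circle a') *~ k = x *~ k + to_circle a' *~ k by exact: mulrzDl.
by rewrite !addrA (ACl (1*3*5*2*6*4))%AC.
Qed.

Lemma torus_act_fun1 z : torus_act_fun 1%g z = z.
Proof. by case: z => x y; rewrite /torus_act_fun /skew /= raddf0 mulr0z !addr0. Qed.

Lemma torus_act_funK (g : G) : cancel (torus_act_fun g) (torus_act_fun g^-1%g).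
Proof. by move=> z; rewrite -torus_act_funM mulVg torus_act_fun1. Qed.

Lemma torus_act_funVK (g : G) : cancel (torus_act_fun g^-1%g) (torus_act_fun g).
Proof. by move=> z; rewrite -torus_act_funM mulgV torus_act_fun1. Qed.

Definition torus_act (g : G) : bijection (torus R) :=
  Bijection (torus_act_funK g) (torus_act_funVK g).

Lemma torus_actM g h : torus_act (g * h)%g = (torus_act g * torus_act h)%g.
Proof. by apply: bijection_eq => z; exact: torus_act_funM. Qed.

Lemma torus_actV g : torus_act g^-1%g = (torus_act g)^-1%g.
Proof. by apply: bijection_eq. Qed.

Lemma torus_act_commg g h : torus_act [~ g, h]%g = [~ torus_act g, torus_act h]%g.
Proof. by rewrite /commg /conjg !torus_actM !torus_actV. Qed.

(** A commutator has trivial linear part and no horizontal translation, and vertical translations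
    commute with every skew shift. *)
Lemma affine_group_commg_central (x g h : G) :
  (x * [~ g, h] = [~ g, h] * x)%g.
Proof.
suff [c ->] : exists c : R, [~ g, h]%g = (0, 0, c).
  move: x => [[k a] b]; rewrite /mul /=; congr (_, _, _) => /=.
  - by rewrite addrC.
  - by rewrite addrC.
  - by rewrite mulr0 mul0r !addr0 addrC.
move: g h => [[k a] b] [[k' a'] b']; eexists.
rewrite /commg /conjg; congr (_, _, _) => /=.
  by lia.
ring.
Qed.

Lemma step_nilpotent_affine_group : step_nilpotent 2 [set: G].
Proof.
apply: step_nilpotent2; first by move=> *; exact: affine_group_commg_central.
exists (1 : int, 0, 0), (0 : int, 1, 0); split=> // /(congr1 snd) /=.
by rewrite !mul0r mul1r !addr0 add0r => /eqP; rewrite oner_eq0.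
Qed.

(** Integral translations act trivially, so noncommutation is asked of the maps and not of the group
    elements. Centrality of commutators is inherited from the image of the action. *)
Lemma step_nilpotent_generated l (g : 'I_l -> G) :
  (exists i j, torus_act (g i * g j)%g <> torus_act (g j * g i)%g) ->
  step_nilpotent 2 (generated (range (fun i => torus_act (g i)))).
Proof.
move=> [i [j gij]].
have HK : generated (range (fun i => torus_act (g i))) `<=` range torus_act.
  apply: smallest_sub; last by move=> _ [k _ <-]; exists (g k).
  split; first by exists 1%g => //; apply: bijection_eq => z; exact: torus_act_fun1.
  by move=> _ _ [x _ <-] [y _ <-]; exists (x / y)%g; rewrite // torus_actM torus_actV.
apply: step_nilpotent2.
  move=> _ _ _ /HK[x _ <-] /HK[y _ <-] /HK[z _ <-].
  by rewrite -torus_act_commg -!torus_actM affine_group_commg_central.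
exists (torus_act (g i)), (torus_act (g j)); split.
- by apply: sub_generated; exists i.
- by apply: sub_generated; exists j.
- by rewrite -!torus_actM.
Qed.

Lemma torus_act_preserving g : measure_preserving (torus_measure R) (torus_act g).
Proof.
split.
- exact: measurable_skew.
- by rewrite -torus_actV; exact: measurable_skew.
- by move=> A mA; exact: skew_preserving.
Qed.

Definition shear (k : int) (z : torus R) : torus R := (z.1, z.2 + z.1 *~ k).

Lemma shear_is_zmod_morphism k : zmod_morphism (shear k).
Proof.
move=> [x y] [x' y']; rewrite /shear /=; congr (_, _).
by rewrite mulrzBl -[RHS]/((y + x *~ k) - (y' + x' *~ k)) opprD addrACA.
Qed.

HB.instance Definition _ k :=
  GRing.isZmodMorphism.Build (torus R) (torus R) (shear k) (shear_is_zmod_morphism k).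

Lemma circle_mulz_continuous k : continuous (fun x : circle R => x *~ k : circle R).
Proof.
apply: circle_continuousP.
rewrite (_ : _ \o _ = @to_circle R \o (fun t => k%:~R * t)).
  move=> t; apply: continuous_comp; first exact: mulrl_continuous.
  exact: to_circle_continuous.
by apply/funext => t /=; rewrite -raddfMz mulrzl.
Qed.

Lemma shear_continuous k : continuous (shear k).
Proof.
have c1 : continuous (fst : torus R -> circle R) by move=> z; exact: cvg_fst.
have c2 : continuous (snd : torus R -> circle R) by move=> z; exact: cvg_snd.
apply: continuous_pair => // z.
apply: (@continuous_comp _ _ _ (fun z : torus R => (z.2, z.1 *~ k : circle R))
  (fun xy : torus R => xy.1 + xy.2)); last exact: circle_addr_continuous.
apply: continuous_pair => // w.
exact: (@continuous_comp _ _ _ fst (fun x : circle R => x *~ k : circle R) w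
  (c1 w) (@circle_mulz_continuous k _)).
Qed.

Lemma shearK k : cancel (shear k) (shear (- k)).
Proof. by move=> [x y]; rewrite /shear /= mulrNz addrK. Qed.

Lemma torus_act_unipotent g : unipotent_affine (torus_act g).
Proof.
move: g => [[k a] b]; exists (shear k), (shear (- k)), (to_circle a, to_circle b); split.
- split; first exact: shearK.
  by have := shearK (- (k : int)); rewrite opprK.
- by split; exact: shear_continuous.
- have sh (z : torus R) : shear k z - z = (0, z.1 *~ k).
    move: z => [x y]; transitivity ((x - x, y + x *~ k - y) : torus R); first by [].
    by rewrite subrr addrAC subrr add0r.
  (* A - I sends (x, y) to (0, k x), so its square is 0. *)
  by exists 2 => z; rewrite /= !sh /= mul0rz.
- by [].
Qed.

End TorusAction.

(** * The torus as a nilmanifold *)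

Section Nilmanifold.
Context {R : realType}.
Local Notation G := (affine_group R).
Local Notation D := (discrete_topology int).
Local Open Scope quotient_scope.

Definition integral_points : set G :=
  [set g | g.1.2 \is a Num.int /\ g.2 \is a Num.int].

Lemma integral_points_subgroup : subgroup_closed integral_points.
Proof.
split; first by split; rewrite /= rpred0.
move=> [[k a] b] [[k' a'] b'] [/= a1 b1] [/= a1' b1']; split => /=.
  by rewrite rpredB.
by rewrite !(rpredD, rpredN, rpredM)//; exact: intr_int.
Qed.

Definition integral_subgroup : subgroupType G := Subgroup integral_points_subgroup.

Local Notation X := (coset_space integral_subgroup).

Lemma coset_space_eqP (g h : G) : \pi_X g = \pi_X h <->
  to_circle g.1.2 = to_circle h.1.2 /\ to_circle g.2 = to_circle h.2.
Proof.
have e : \pi_X g = \pi_X h <-> integral_points (g^-1 * h)%g.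
  by split=> [/eqmodP/asboolP|h1]; [|apply/eqmodP/asboolP].
rewrite e; move: g h {e} => [[k a] b] [[k' a'] b']; rewrite /integral_points /=.
have -> : - a + a' = - (a - a') by ring.
(* The extra term k (a - a') is integral as soon as a - a' is, so it does not affect the class of
   b. *)
have -> : - b + k%:~R * a + b' + (- (k : int))%:~R * a' = - (b - b') + k%:~R * (a - a').
  by rewrite mulrNz; ring.
rewrite rpredN; split=> [[aa bb]|[/to_circle_eq aa /to_circle_eq bb]].
  split; apply/to_circle_eq => //.
  have := rpredB bb (rpredM (intr_int R (k : int)) aa); rewrite addrK rpredN//.
by split=> //; rewrite rpredD ?rpredN// rpredM// intr_int.
Qed.

Definition to_torus (c : X) : torus R := (to_circle (repr c).1.2, to_circle (repr c).2).

Definition of_torus (z : torus R) : X := \pi_X ((0 : int, repr z.1, repr z.2) : G).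

Lemma to_torus_pi (g : G) : to_torus (\pi_X g) = (to_circle g.1.2, to_circle g.2).
Proof.
have [e1 e2] : to_circle (repr (\pi_X g)).1.2 = to_circle g.1.2 /\
    to_circle (repr (\pi_X g)).2 = to_circle g.2.
  by apply/coset_space_eqP; exact: reprK.
by rewrite /to_torus e1 e2.
Qed.

Lemma of_torus_to_circle (a b : R) :
  of_torus (to_circle a, to_circle b) = \pi_X ((0 : int, a, b) : G).
Proof. by apply/coset_space_eqP; rewrite /= !to_circleK. Qed.

Lemma to_torusK : cancel to_torus of_torus.
Proof.
move=> c; rewrite -[c]reprK to_torus_pi of_torus_to_circle.
exact/coset_space_eqP.
Qed.

Lemma of_torusK : cancel of_torus to_torus.
Proof. by move=> [x y]; rewrite to_torus_pi /= !to_circleK. Qed.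

Lemma to_torus_continuous : continuous to_torus.
Proof.
apply/quotient_continuous.
rewrite (_ : _ \o _ = fun g : G => (to_circle g.1.2, to_circle g.2)).
  apply: continuous_pair => g.
    exact: (continuous_comp (@affine_group_fst_translation_continuous R g)
      (@to_circle_continuous R _)).
  exact: (continuous_comp (@affine_group_snd_translation_continuous R g)
    (@to_circle_continuous R _)).
by apply/funext => g; exact: to_torus_pi.
Qed.

Let pi_row_continuous : continuous (fun z : R * R => \pi_X ((0 : int, z.1, z.2) : G)).
Proof.
move=> z; apply: (@continuous_comp _ _ _ (fun z : R * R => (0 : int, z.1, z.2) : G)
  (fun g => \pi_X g)); last exact: pi_continuous.
apply: affine_group_continuous; [exact: (@cst_continuous (R * R)%type D (0 : int))|..] => w.
  exact: cvg_fst.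
exact: cvg_snd.
Qed.

(** The projection of R onto R/Z is open, so continuity descends from R^2. *)
Lemma of_torus_continuous : continuous of_torus.
Proof.
move=> [x y]; have [a ->] := to_circleP x; have [b ->] := to_circleP y.
move=> U; rewrite of_torus_to_circle => /(@pi_row_continuous (a, b)).
move=> [[A B] /= [nA nB] ABU].
exists (@to_circle R @` A, @to_circle R @` B) => /=.
  split; apply/circle_nbhsP.
    by apply: filterS nA => s As; exists s.
  by apply: filterS nB => s Bs; exists s.
move=> [_ _] [/= [s As <-] [t Bt <-]]; rewrite /= of_torus_to_circle.
exact: (ABU (s, t)).
Qed.

Lemma coset_translate_torus (g : G) (c : X) :
  to_torus (coset_translate g c) = torus_act g (to_torus c).
Proof.
rewrite -[c]reprK coset_translateE !to_torus_pi; move: (repr c) g => [[k' a'] b'] [[k a] b].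
rewrite /= /torus_act_fun /skew /=; congr (_, _).
  by rewrite raddfD addrC.
have -> : to_circle (b + b' + k%:~R * a') =
    to_circle b + to_circle b' + to_circle a' *~ k.
  by rewrite !raddfD -raddfMz mulrzl.
by rewrite [to_circle b + _]addrC addrAC.
Qed.

Lemma integral_subgroup_discrete : discrete_subgroup integral_subgroup.
Proof.
move=> [[k a] b] [/= /intrP[p ->] /intrP[q ->]].
exists ((fun g : G => g.1.1 : D) @^-1` [set k] `&`
  ((fun g : G => g.1.2) @^-1` ball (p%:~R : R) 1 `&` (fun g : G => g.2) @^-1` ball (q%:~R : R) 1)).
  apply: openI.
    by apply: open_comp => [x _|]; [exact: affine_group_linear_part_continuous|exact: discrete_open].
  apply: openI; apply: open_comp.
  - by move=> x _; exact: affine_group_fst_translation_continuous.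
  - exact: ball_open.
  - by move=> x _; exact: affine_group_snd_translation_continuous.
  - exact: ball_open.
have int1 (r s : int) : ball (r%:~R : R) 1 s%:~R -> s = r.
  rewrite /ball /= -intrB -intr_norm -[1]/(1%:~R) ltr_int => h; lia.
apply/seteqP; split=> [[[k' a'] b']|_ ->] /=.
  move=> [[-> [pa qb]] [/= /intrP[r ar] /intrP[s bs]]].
  by rewrite ar in pa *; rewrite bs in qb *; rewrite (int1 _ _ pa) (int1 _ _ qb).
split; last by split => /=; exact: intr_int.
by split=> //; split; exact: ballxx.
Qed.

Lemma integral_subgroup_cocompact : cocompact_subgroup integral_subgroup.
Proof.
rewrite /cocompact_subgroup.
(* Every coset meets the closed unit square of the component k = 0. *)
have -> : [set: X] = (fun z : R * R => \pi_X ((0 : int, z.1, z.2) : G)) @`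
    (`[0, 1]%classic `*` `[0, 1]%classic).
  apply/seteqP; split=> // c _; rewrite -[c]reprK; move: (repr c) => [[k a] b].
  have fr (t : R) : exists2 s : R, `[0, 1]%classic s & to_circle s = to_circle t.
    have /andP[fl fu] := Num.Theory.floor_itv t; exists (t - (Num.floor t)%:~R).
      by rewrite /= in_itv /=; rewrite intrD in fu; apply/andP; split; lra.
    by apply/to_circle_eq; rewrite addrAC subrr add0r rpredN intr_int.
  have [s s01 sa] := fr a; have [t t01 tb] := fr b.
  by exists (s, t) => //; apply/coset_space_eqP.
apply: continuous_compact; last by apply: compact_setX; exact: segment_compact.
by apply: continuous_subspaceT; exact: pi_row_continuous.
Qed.

Lemma torus_act_nilsystem l (g : 'I_l -> G) : nilsystem 2 (fun i => torus_act (g i)).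
Proof.
exists G, (affine_group_lie R), integral_subgroup; split.
- exact: step_nilpotent_affine_group.
- exact: integral_subgroup_discrete.
- exact: integral_subgroup_cocompact.
- exists to_torus, of_torus; split.
  + by split; [exact: to_torusK|exact: of_torusK].
  + by split; [exact: to_torus_continuous|exact: of_torus_continuous].
  + move=> h A mA; rewrite (_ : (fun y => _) = torus_act h).
      by have [_ _] := torus_act_preserving h; exact.
    by apply/funext => z; rewrite coset_translate_torus of_torusK.
  + by move=> i; exists (g i) => x; rewrite coset_translate_torus.
Qed.

Lemma torus_act_affine_nilsystem l (g : 'I_l -> G) :
  (exists i j, torus_act (g i * g j)%g <> torus_act (g j * g i)%g) ->
  affine_nilsystem 2 (fun i => torus_act (g i)).
Proof.
move=> gij; split.
- by move=> i; exact: torus_act_preserving.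
- by move=> i; exact: torus_act_unipotent.
- exact: torus_act_nilsystem.
- exact: step_nilpotent_generated.
Qed.

End Nilmanifold.

(** * The example *)

Section Example.
Context {R : realType}.
Local Notation m := (@circle_measure R).
Local Notation mu := (@torus_measure R).
Local Notation al := (Num.sqrt 2 : R).
Local Notation be := (Num.sqrt 3 : R).

Definition rotation_bij (a : circle R) : bijection (circle R) :=
  Bijection (fun x => addrK a x) (fun x => subrK a x).

Lemma rotation_preserving a : measure_preserving m (rotation_bij a).
Proof.
split; [exact: circle_measurable_shift|exact: circle_measurable_shift|].
by move=> A mA; exact: circle_measure_shift.
Qed.

Lemma rotation_expg a n x : (rotation_bij a ^+ n)%g x = x + a *+ n.
Proof.
elim: n x => [|n IH] x; first by rewrite mulr0n addr0.
by rewrite expgS /= IH mulrSr addrA.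
Qed.

Lemma torus_act_expg (a c : R) n : (torus_act ((1 : int, a, c) : affine_group R) ^+ n)%g =
  torus_act ((n%:Z, n%:R * a, n%:R * c + a * (n%:R ^+ 2 - n%:R) / 2) : affine_group R).
Proof.
have -> : ((n%:Z, n%:R * a, n%:R * c + a * (n%:R ^+ 2 - n%:R) / 2) : affine_group R) =
    (((1 : int, a, c) : affine_group R) ^+ n)%g.
  elim: n => [|n IH].
    by congr (_, _, _); rewrite /= ?mul0r// expr0n subr0 mulr0 mul0r addr0.
  rewrite expgS -IH; congr (_, _, _); rewrite /= -natr1.
    by ring.
  by field.
elim: n => [|n IH]; first by apply: bijection_eq => z; rewrite /= torus_act_fun1.
by rewrite !expgS torus_actM IH.
Qed.

Definition angle (i : 'I_4) : R := nth 0 [:: al; al; be; be + 2 * al] i.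

(** The halves of the angles absorb the linear terms of a_i (N^2 - N) / 2. The quadratic parts leave
    -(2 al + be) n^3 - (al + be) n^2 / 2, cancelled by the corrections in the second and third
    entries, whose exponents are n^3 and n^2 and whose signs are - and +. *)
Definition vertical_angle (i : 'I_4) : R :=
  nth 0 [:: al / 2; al / 2 - (be + 2 * al); be / 2 + (al + be) / 2; (be + 2 * al) / 2] i.

Definition generator (i : 'I_4) : affine_group R := (1 : int, angle i, vertical_angle i).

Definition times (i : 'I_4) : {poly int} :=
  nth 0 [:: 'X^3 + 'X; 'X^3; 'X^2; 'X^2 + 'X] i.

(** At nonnegative n the exponents are natural numbers, so [zexpg] is an ordinary power. *)
Definition times_nat (i : 'I_4) (n : nat) : nat :=
  nth 0%N [:: (n ^ 3 + n)%N; (n ^ 3)%N; (n ^ 2)%N; (n ^ 2 + n)%N] i.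

Lemma timesE i n : (times i).[n%:Z] = (times_nat i n)%:Z.
Proof.
case: i => [[|[|[|[|//]]]]] ?; rewrite /times /times_nat /= !hornerE /=;
  by rewrite ?PoszD -?rmorphXn.
Qed.

Lemma irrational_combination (k l : int) : (k != 0) || (l != 0) ->
  irrational (k%:~R * al + l%:~R * be).
Proof.
move=> kl j j0; apply/negP; rewrite mulrDr !mulrA -!intrM => /irrational_sqrt2_sqrt3[].
move=> /eqP; rewrite mulf_eq0 (negPf j0) /= => /eqP k0 /eqP.
by rewrite mulf_eq0 (negPf j0) /= => /eqP l0; move: kl; rewrite k0 l0.
Qed.

Lemma rotations_weyl (d : 'I_4 -> int) : (exists i, d i != 0) ->
  cesaro_null (fun n => \prod_(i < 4)
    character (d i) (to_circle (angle i) *+ times_nat i n.+1)).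
Proof.
move=> [i0 di0].
set d0 := d ord0; set d1 := d (lift ord0 ord0).
set d2 := d (lift ord0 (lift ord0 ord0)); set d3 := d (lift ord0 (lift ord0 (lift ord0 ord0))).
have {i0 di0} dn0 : [|| d0 != 0, d1 != 0, d2 != 0 | d3 != 0].
  apply/negPn/negP; rewrite !negb_or !negbK => /and4P[/eqP e0 /eqP e1 /eqP e2 /eqP e3].
  move/eqP: di0; apply; case: i0 => [[|[|[|[|//]]]]] hi.
  - by rewrite -[RHS]e0; congr d; exact: val_inj.
  - by rewrite -[RHS]e1; congr d; exact: val_inj.
  - by rewrite -[RHS]e2; congr d; exact: val_inj.
  - by rewrite -[RHS]e3; congr d; exact: val_inj.
(* The cubic, quadratic and linear coefficients. If A = B = 0 then d2 = d3 = 0 and d1 = - d0, so C =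
   d0 sqrt 2: the highest nonzero coefficient is always irrational. *)
pose A : R := (d0 + d1)%:~R * al + 0%:~R * be.
pose B : R := (2 * d3)%:~R * al + (d2 + d3)%:~R * be.
pose C : R := (d0 + 2 * d3)%:~R * al + d3%:~R * be.
have -> : (fun n => \prod_(i < 4) character (d i) (to_circle (angle i) *+ times_nat i n.+1)) =
    (fun n => phase (A * (n + 1)%:R ^+ 3 + B * (n + 1)%:R ^+ 2 + C * (n + 1)%:R + 0)).
  apply/funext => n; rewrite !big_ord_recl big_ord0 mulr1 -!raddfMn.
  rewrite !character_to_circle -!phaseD /angle /times_nat /= -/d0 -/d1 -/d2 -/d3.
  have nE (a : R) k : a *+ k = a * k%:R by rewrite mulr_natr.
  rewrite (nE al) (nE al) (nE be) (nE (be + _)) !natrD !natrX -addn1.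
  by congr phase; rewrite /A /B /C !intrD !intrM; ring.
pose u n := phase (A * n%:R ^+ 3 + B * n%:R ^+ 2 + C * n%:R + 0).
apply: (@cesaro_null_shift _ u 1) => [n|]; first by rewrite sqn_phase.
have [A0|A0] := eqVneq (d0 + d1) 0; last first.
  by apply: weyl_cubic; apply: irrational_combination; rewrite A0.
have A_eq0 : A = 0 by rewrite /A A0 !mul0r addr0.
have [B0|B0] := boolP ((d3 == 0) && (d2 + d3 == 0)); last first.
  have : irrational B.
    apply: irrational_combination; rewrite -negb_and; apply: contra B0.
    by rewrite mulf_eq0.
  move=> /(@weyl_quadratic _ _ C 0); congr cesaro_null; apply/funext => n.
  by rewrite /u A_eq0; congr phase; ring.
move: B0 => /andP[/eqP d30 /eqP]; rewrite d30 addr0 => d20.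
have : irrational C.
  apply: irrational_combination; move: dn0.
  have -> : d1 = - d0 by apply/eqP; rewrite -addr_eq0 addrC A0.
  by rewrite d20 d30 eqxx oppr_eq0 /= !orbF orbb mulr0 addr0.
move=> /(@weyl_linear _ _ 0); congr cesaro_null; apply/funext => n.
have B_eq0 : B = 0 by rewrite /B d20 d30 mulr0 addr0 !mul0r addr0.
by rewrite /u A_eq0 B_eq0; congr phase; ring.
Qed.

End Example.

Lemma bmeas_Lfun_pinfty d (X : measurableType d) (R : realType)
    (mu : {measure set X -> \bar R}) (f : X -> R[i]) :
  bmeas f -> complex_Lfun mu +oo%E f.
Proof.
move=> [[m1 m2] [M fM]].
have bound (u : X -> R) : measurable_fun setT u -> (forall x, u x ^+ 2 <= M) ->
    u \in Lfun mu +oo%E.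
  move=> mf uM; rewrite inE; apply/andP; split; rewrite inE //= /finite_norm unlock.
  case: ifP => // _; apply: (@le_lt_trans _ _ (Num.sqrt M)%:E); last exact: ltry.
  apply/ess_sup_inf.ess_supP; apply: aeW => x /=.
  by rewrite lee_fin -sqrtr_sqr ler_wsqrtr.
split; apply: bound => // x; apply: le_trans (fM x); rewrite /sqn ?lerDl ?lerDr sqr_ge0//.
Qed.

(** * Failure of joint ergodicity on the torus *)

Section Resonance.
Context {R : realType}.
Local Notation mu := (@torus_measure R).
Local Notation al := (Num.sqrt 2 : R).
Local Notation be := (Num.sqrt 3 : R).

Lemma complex_integral_vertical k : k != 0 ->
  complex_integral mu (fun z : torus R => character k z.2) = 0.
Proof.
move=> /(@character_translate_half R) [a ka]; apply: eq_oppc_eq0.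
have bk := @bmeas_character_snd R k.
rewrite -{1}(complex_integral_preserved (measurable_skew 0 0 a) (skew_preserving 0 0 a) bk.1).
have -> : (fun x : torus R => character k (skew 0 0 a x).2) =
    (fun x => -1 * character k x.2).
  by apply/funext => x; rewrite /skew /= mulr0z addr0 ka mulN1r.
by rewrite complex_integralZ ?mulN1r//; exact/bmeas_integrable/bk/torus_measureT.
Qed.

Lemma zexpg_generator i n (s r : R) :
  (zexpg (torus_act (generator i)) (times i).[n%:Z] (to_circle s, to_circle r)).2 =
  to_circle (r + (times_nat i n)%:R * s + ((times_nat i n)%:R * vertical_angle i +
    angle i * ((times_nat i n)%:R ^+ 2 - (times_nat i n)%:R) / 2)).
Proof.
rewrite timesE /= (torus_act_expg (angle i) (vertical_angle i)) /= /skew /=.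
have -> : to_circle s *~ times_nat i n = to_circle ((times_nat i n)%:R * s).
  by rewrite -raddfMz -pmulrn mulr_natl.
by rewrite -!raddfD.
Qed.

Definition sign (i : 'I_4) : int := nth 0 [:: 1; -1; 1; -1] i.

Lemma resonance n (z : torus R) :
  \prod_(i < 4) character (sign i)
    (zexpg (torus_act (generator i)) (times i).[n%:Z] z).2 = 1.
Proof.
move: z => [x y]; have [s ->] := to_circleP x; have [r ->] := to_circleP y.
under eq_bigr do rewrite zexpg_generator character_to_circle.
rewrite !big_ord_recl big_ord0 mulr1 -!phaseD /angle /vertical_angle /times_nat /sign /=.
rewrite -(@phase0 R); congr phase.
rewrite !natrD !natrX !(mulrNz, mulr1z).
by field.
Qed.

Lemma not_jointly_ergodic_skews :
  ~ jointly_ergodic mu (fun i => torus_act (generator i)) times.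
Proof.
pose f i (z : torus R) := character (sign i) z.2.
have Lf i : complex_Lfun mu +oo%E (f i).
  by apply: bmeas_Lfun_pinfty; exact: bmeas_character_snd.
move=> /(_ f Lf).
have -> : \prod_(i < 4) complex_integral mu (f i) = 0.
  by rewrite big_ord_recl complex_integral_vertical ?mul0r.
set u := (fun N : nat => _) => u0.
(* Once N > 0 the average is the constant 1 while the product of integrals is 0, so the norm is 1;
   at N = 0 the average is an empty sum. *)
have u1 : \forall N \near \oo, u N = 1%E.
  near=> N; rewrite /u.
  under eq_fun => z.
    rewrite /multiple_average (eq_bigr (fun=> 1)); last by move=> n _; exact: resonance.
    rewrite sumr_const_nat subn1 /= mulVf ?subr0; last first.
      by rewrite pnatr_eq0 -lt0n; near: N; exact: nbhs_infty_gt.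
  over.
  have mu1 : mu setT = 1%E by exact: torus_measureT.
  by have := Lnorm2_normc mu1 (bmeas_cst _ 1); rewrite energy_cst// sqn1 sqrtr1.
have {u1} u1 : u @ \oo --> 1%E by exact: cvg_near_cst.
have /(_ (fmap_proper_filter _ _))/eqP := cvg_unique (@ereal_hausdorff R) u0 u1.
by rewrite eq_sym onee_eq0.
Unshelve. all: end_near. Qed.

Lemma generators_not_commute : exists i j, torus_act (@generator R i * generator j)%g <>
  torus_act (generator j * generator i)%g.
Proof.
(* At the origin the second coordinates of the two products differ by sqrt 3 - sqrt 2, the
   difference of the angles, which is not an integer. *)
exists ord0, (lift ord0 (lift ord0 ord0)) => /(congr1 (fun T : bijection (torus R) => (T 0).2)) /=.
rewrite /skew /= !mul0rz !addr0 !add0r.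
move=> /to_circle_eq; rewrite /angle /= opprD addrACA [in X in _ - X]addrC subrr add0r => h.
have [] // := @irrational_sqrt2_sqrt3 R (-1) 1; rewrite mulrNz mulNr addrC.
exact: h.
Qed.

End Resonance.

Theorem theorem1p16 (R : realType) :
  exists (T : 'I_4 -> bijection (torus R)) (p : 'I_4 -> {poly int})
         (S : 'I_4 -> bijection (circle R)),
    affine_nilsystem 2 T /\
    eq_mod_null (torus_measure R)
      (kronecker_algebra (torus_measure R) T)
      (@first_coordinate_algebra R) /\
    (forall i, eq_mod_null (torus_measure R)
      (kronecker_algebra (torus_measure R) (fun _ : unit => T i))
      (@first_coordinate_algebra R)) /\
    (forall i, measure_preserving (@circle_measure R) (S i)) /\
    (forall i y, fst (T i y) = S i (fst y)) /\
    ~ jointly_ergodic (torus_measure R) T p /\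
    jointly_ergodic (@circle_measure R) S p.
Proof.
exists (fun i => torus_act (generator i)), times,
  (fun i => rotation_bij (to_circle (angle i))).
split; first exact: (torus_act_affine_nilsystem generators_not_commute).
split.
  by apply: (@kronecker_skew _ _ ord0 _ (fun i => to_circle (angle i))
    (fun i => to_circle (vertical_angle i))).
split.
  by move=> i; apply: (@kronecker_skew _ _ tt _ (fun=> to_circle (angle i))
    (fun=> to_circle (vertical_angle i))).
split; first by move=> i; exact: rotation_preserving.
split; first by [].
split; first exact: not_jointly_ergodic_skews.
apply: rotations_jointly_ergodic (@rotations_weyl R) => i n x.
by rewrite timesE rotation_expg.
Qed.
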